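(* Let $n\ge1$ and let $A\in GL(n,\mathbb{C})$. Let $X_1$ be a logarithm of $A$ (a linear vector field with $\exp(X_1)=A$) such that its semisimple part $X_{1,s}$ is diagonal and such that its nilpotent part $X_{1,N}$ satisfies $[X_{1,N},Y]=0$ for every weakly resonant vector field $Y$. Let $\varphi = Az+f_2+\cdots+f_k+\cdots$ be an element of $\mathrm{Diff}_\infty(\mathbb{R}^n,0)$ (resp. $\mathrm{Diff}(\mathbb{R}^n,0)$, $\widehat{\mathrm{Diff}}(\mathbb{C}^n,0)$), where $f_j$ is the homogeneous part of degree $j$ of the Taylor expansion of $\varphi$ at $0$ for $j\ge2$. Suppose that for some $k\ge2$ one of the following conditions holds: (a) $f_2=\cdots=f_{k-1}=0$ and $f_k$ contains non-vanishing weakly resonant monomials; (b) $Az+f_2+\cdots+f_{k-1}$ is strongly resonant, there is no weakly resonant monomial of degree $d$ with $2\le d\le k-1$, and $f_k$ contains non-vanishing weakly resonant monomials. Then there is no vector field $X\in\mathcal X_\infty(\mathbb{R}^n,0)$ (resp. $\mathcal X(\mathbb{R}^n,0)$, $\hat{\mathcal X}(\mathbb{C}^n,0)$) such that $j^1X=X_1$ and $\varphi=\exp(X)$. Here all resonance notions are with respect to $X_{1,s}$.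
   Context: Spaces. $\mathcal X_\infty(\mathbb{R}^n,0)$ and $\mathrm{Diff}_\infty(\mathbb{R}^n,0)$ are the sets of local $C^\infty$ vector fields singular at $0$, and of local $C^\infty$ diffeomorphisms fixing $0$, defined near $0\in\mathbb{R}^n$; $\mathcal X(\mathbb{R}^n,0)$ and $\mathrm{Diff}(\mathbb{R}^n,0)$ are their real analytic analogues. $\hat{\mathcal X}(\mathbb{C}^n,0)$ is the set of formal vector fields $\sum_j a_j\,\partial/\partial z_j$ with $a_j$ in the maximal ideal $\mathfrak m$ of $\mathbb{C}[[z_1,\dots,z_n]]$, and $\widehat{\mathrm{Diff}}(\mathbb{C}^n,0)$ is the group of formal diffeomorphisms $(\varphi_1,\dots,\varphi_n)$, $\varphi_j\in\mathfrak m$, with invertible linear part. $\exp(X)$ is the time-one flow of $X$ (as a germ); for formal $X$ it has components $\sum_{j\ge0}X^{\circ j}(z_k)/j!$, $1\le k\le n$, with $X$ acting as a derivation. $j^1$ is the first jet (linear part). Linear part. A linear vector field $X_1=\sum_j(Bz)_j\,\partial/\partial z_j$ is identified with its matrix $B$; $X_1=X_{1,s}+X_{1,N}$ is its additive Jordan decomposition (semisimple plus nilpotent, commuting), and $\exp(X_1)$ is the linear map $e^B$. Diagonal, and the coordinates $w$. In the complex setting, $X_{1,s}$ diagonal means that its matrix in the coordinates $z$ is diagonal, and one puts $w=z$. In the real setting ($X_1$ real), $X_{1,s}$ diagonal means that its matrix is in real Jordan normal form, i.e. block diagonal with blocks $(\beta)$, $\beta\in\mathbb{R}$, and $\begin{pmatrix}\lambda&-\mu\\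 \mu&\lambda\end{pmatrix}$, $\lambda,\mu\in\mathbb{R}$; then one uses the complex linear coordinates $(w_1,\dots,w_n)$ given by $w_q=z_q$ for a $1\times1$ block in the coordinate $z_q$, and $z_p=w_p+w_{p+1}$, $z_{p+1}=-iw_p+iw_{p+1}$ for a $2\times2$ block in the coordinates $(z_p,z_{p+1})$. In either case $X_{1,s}=\sum_{k=1}^n\gamma_kw_k\,\partial/\partial w_k$ with $\gamma_1,\dots,\gamma_n\in\mathbb{C}$. Resonances. A monomial $\lambda w_1^{a_1}\cdots w_n^{a_n}e_j$ or monomial vector field $\lambda w_1^{a_1}\cdots w_n^{a_n}\,\partial/\partial w_j$ ($e_j$ the $j$-th canonical basis vector, $a_k\in\mathbb{Z}_{\ge0}$) has degree $a_1+\cdots+a_n$; it is strongly resonant if $\gamma_j=\sum_k a_k\gamma_k$, and weakly resonant if $\gamma_j-\sum_k a_k\gamma_k\in 2\pi i\,\mathbb{Z}\setminus\{0\}$. A formal endomorphism (resp. formal vector field in $\hat{\mathcal X}(\mathbb{C}^n,0)$) is strongly (weakly) resonant if all its monomials with non-zero coefficient, when it is expressed in the coordinates $w$, are strongly (weakly) resonant. The monomials of $f_k$ are likewise those of its expression in the coordinates $w$ ($\varphi$ being conjugated by the linear change of coordinates), and ''non-vanishing'' means with non-zero coefficient. *)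

(* Defs.v *)
From mathcomp Require Import all_boot all_order all_algebra complex mpoly.
From mathcomp Require Import all_classical all_reals all_analysis.

Set Implicit Arguments.
Unset Strict Implicit.
Unset Printing Implicit Defensive.

Import Order.TTheory GRing.Theory Num.Theory.
Import numFieldNormedType.Exports.

Local Open Scope classical_set_scope.
Local Open Scope ring_scope.

(** * Formal power series *)

(* [f a] is the coefficient of the monomial ['X_[a]]. *)
Definition fps (K : Type) (n : nat) := 'X_{1..n} -> K.

(* n-tuples of power series: formal endomorphisms [(F_1, .., F_n)] as well as
   formal vector fields [\sum_i F_i d/dz_i]. *)
Definition fvect (K : Type) (n : nat) := 'I_n -> fps K n.

Definition fps_var (K : nzRingType) (n : nat) (i : 'I_n) : fps K n :=
  fun a => (a == U_(i)%MM)%:R.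

(* The bound on the degree only makes the index type finite. *)
Definition fps_mul (K : nzRingType) (n : nat) (f g : fps K n) : fps K n :=
  fun a => \sum_(b : 'X_{1..n < (mdeg a).+1} | (b <= a)%MM)
             f b * g (a - b)%MM.

Definition fps_deriv (K : nzRingType) (n : nat) (j : 'I_n) (f : fps K n) :
    fps K n :=
  fun a => f (a + U_(j))%MM *+ (a j).+1.

Definition vf_act (K : nzRingType) (n : nat) (X : fvect K n) (f : fps K n) :
    fps K n :=
  fun a => \sum_j fps_mul (X j) (fps_deriv j f) a.

Definition lie_bracket (K : nzRingType) (n : nat) (X Y : fvect K n) :
    fvect K n :=
  fun i a => vf_act X (Y i) a - vf_act Y (X i) a.

Definition in_maxideal (K : nzRingType) (n : nat) (F : fvect K n) : Prop :=
  forall i, F i 0%MM = 0.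

Definition linear_fvect (K : nzRingType) (n : nat) (B : 'M[K]_n) :
    fvect K n :=
  fun i a => \sum_j B i j * fps_var K j a.

Definition linear_part (K : nzRingType) (n : nat) (F : fvect K n) : 'M[K]_n :=
  \matrix_(i, j) F i U_(j)%MM.

Definition homog_part (K : nzRingType) (n d : nat) (F : fvect K n) :
    fvect K n :=
  fun i a => if mdeg a == d then F i a else 0.

Definition jet (K : nzRingType) (n d : nat) (F : fvect K n) : fvect K n :=
  fun i a => if (mdeg a <= d)%N then F i a else 0.

(* The series [f (P w)]: the monomial ['X_[b]] of [f] contributes
   [\prod_i (\sum_j P i j w_j) ^+ b i], homogeneous of degree [mdeg b]. *)
Definition lin_subst (K : comNzRingType) (n : nat) (P : 'M[K]_n)
    (f : fps K n) : fps K n :=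
  fun a => \sum_(b : 'X_{1..n < (mdeg a).+1} | mdeg b == mdeg a)
             f b * (\prod_i (\sum_j P i j *: 'X_j) ^+ b i : {mpoly K[n]})@_a.

(* For coordinates [w] given by [z = P w], the expression [P^-1 F(P w)] in
   the coordinates [w] of an endomorphism, or vector field, [F]. *)
Definition in_coords (K : comUnitRingType) (n : nat) (P : 'M[K]_n)
    (F : fvect K n) : fvect K n :=
  fun i a => \sum_l invmx P i l * lin_subst P (F l) a.

(** * Exponentials; convergence in [R[i]^o] is the usual one of C *)

Definition is_expmx (R : realType) (n : nat) (B A : 'M[R[i]]_n) : Prop :=
  forall i j, series (fun m => (B ^+ m) i j / m`!%:R) @ \oo
                --> (A i j : R[i]^o).

Definition is_formal_exp (R : realType) (n : nat) (X phi : fvect R[i] n) :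
    Prop :=
  forall i a,
    series (fun m => iter m (vf_act X) (fps_var R[i] i) a / m`!%:R) @ \oo
      --> (phi i a : R[i]^o).

(** * Linear part and resonances *)

Definition is_jordan_decomp (R : realType) (n : nat) (B S N : 'M[R[i]]_n) :
    Prop :=
  [/\ B = S + N, diagonalizable S, exists m, N ^+ m = 0 & S *m N = N *m S].

(* For [T] the set of first indices of the 2 x 2 blocks: [p] and [q] are the
   first and second index of such a block. *)
Definition block2 (n : nat) (T : {set 'I_n}) (p q : 'I_n) : bool :=
  (p \in T) && (q == p.+1 :> nat).

(* Here [S q p] is the [mu] of the block with indices [p], [q]. *)
Definition real_jordan_form (R : realType) (n : nat) (T : {set 'I_n})
    (S : 'M[R[i]]_n) : Prop :=
  [/\ S \is a mxOver Num.real,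
      forall p, p \in T -> exists2 q : 'I_n, q = p.+1 :> nat & q \notin T,
      forall p q, block2 T p q -> S q q = S p p /\ S p q = - S q p
    & forall p q, S p q != 0 -> [|| p == q, block2 T p q | block2 T q p]].

(* The matrix [P] of [z = P w], where [z_p = w_p + w_q] and
   [z_q = - i w_p + i w_q] for a 2 x 2 block with indices [p], [q]. *)
Definition real_coords (R : realType) (n : nat) (T : {set 'I_n}) :
    'M[R[i]]_n :=
  \matrix_(j, l)
    if j \in T then ((l == j) || block2 T j l)%:R
    else if [exists p, block2 T p j] then
      (if l == j then 'i%C else if block2 T l j then - 'i%C else 0)
    else (l == j)%:R.

(* The coefficients [gamma_k] of [S = \sum_k gamma_k w_k d/dw_k]. *)
Definition eigen_coefs (R : realType) (n : nat) (P S : 'M[R[i]]_n) :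
    'I_n -> R[i] :=
  fun k => (invmx P *m S *m P) k k.

Definition strong_monomial (R : realType) (n : nat) (gamma : 'I_n -> R[i])
    (j : 'I_n) (a : 'X_{1..n}) : Prop :=
  gamma j = \sum_k gamma k *+ a k.

Definition weak_monomial (R : realType) (n : nat) (gamma : 'I_n -> R[i])
    (j : 'I_n) (a : 'X_{1..n}) : Prop :=
  exists2 m : int, m != 0 &
    gamma j - \sum_k gamma k *+ a k = (2 * pi)%:C%C * 'i%C * m%:~R.

(* In the next definitions [F] is given in the coordinates [z = P w]. *)
Definition strongly_resonant (R : realType) (n : nat) (P S : 'M[R[i]]_n)
    (F : fvect R[i] n) : Prop :=
  forall j a, in_coords P F j a != 0 ->
    strong_monomial (eigen_coefs P S) j a.

Definition weakly_resonant (R : realType) (n : nat) (P S : 'M[R[i]]_n)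
    (F : fvect R[i] n) : Prop :=
  forall j a, in_coords P F j a != 0 ->
    weak_monomial (eigen_coefs P S) j a.

Definition has_weak_monomial (R : realType) (n : nat) (P S : 'M[R[i]]_n)
    (F : fvect R[i] n) : Prop :=
  exists j a, in_coords P F j a != 0 /\
    weak_monomial (eigen_coefs P S) j a.

Definition commutes_with_weak (R : realType) (n : nat) (P S N : 'M[R[i]]_n) :
    Prop :=
  forall Y : fvect R[i] n, in_maxideal Y -> weakly_resonant P S Y ->
    forall j a, lie_bracket (linear_fvect N) Y j a = 0.

Definition condition_a (R : realType) (n k : nat) (P S : 'M[R[i]]_n)
    (phi : fvect R[i] n) : Prop :=
  (forall d, (2 <= d <= k.-1)%N -> forall j a, homog_part d phi j a = 0) /\
  has_weak_monomial P S (homog_part k phi).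

Definition condition_b (R : realType) (n k : nat) (P S : 'M[R[i]]_n)
    (phi : fvect R[i] n) : Prop :=
  [/\ strongly_resonant P S (jet k.-1 phi),
      forall j (a : 'X_{1..n}), (2 <= mdeg a <= k.-1)%N ->
        ~ weak_monomial (eigen_coefs P S) j a
    & has_weak_monomial P S (homog_part k phi)].

(** * Formal vector fields and diffeomorphisms *)

Definition formal_vf (R : realType) (n : nat) (X : fvect R[i] n) : Prop :=
  in_maxideal X.

Definition formal_diff (R : realType) (n : nat) (phi : fvect R[i] n) : Prop :=
  in_maxideal phi /\ linear_part phi \in unitmx.

(** * Germs at 0 of real maps, represented by total functions *)

Definition partial (R : realType) (n : nat) (j : 'I_n) (f : 'cV[R]_n -> R) :
    'cV[R]_n -> R :=
  fun x => 'D_(delta_mx j 0) f x.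

Definition smooth_on (R : realType) (n : nat) (U : set 'cV[R]_n)
    (F : 'cV[R]_n -> 'cV[R]_n) : Prop :=
  forall (i : 'I_n) (s : seq 'I_n) x, U x ->
    differentiable (foldr (@partial R n) (fun y => F y i 0) s) x.

Definition smooth_germ (R : realType) (n : nat) (F : 'cV[R]_n -> 'cV[R]_n) :
    Prop :=
  exists2 U : set 'cV[R]_n, open_nbhs (0 : 'cV[R]_n) U & smooth_on U F.

Definition taylor (R : realType) (n : nat) (F : 'cV[R]_n -> 'cV[R]_n) :
    fvect R n :=
  fun i a =>
    foldr (fun j g => iter (a j) (partial j) g) (fun y => F y i 0)
      (enum 'I_n) 0 / (\prod_j (a j)`!)%:R.

Definition ctaylor (R : realType) (n : nat) (F : 'cV[R]_n -> 'cV[R]_n) :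
    fvect R[i] n :=
  fun i a => (taylor F i a)%:C%C.

(* The series is summed by increasing degree [d]; absolute convergence makes
   this the sum over all multi-indices. *)
Definition taylor_sums_to (R : realType) (n : nat)
    (F : 'cV[R]_n -> 'cV[R]_n) (x : 'cV[R]_n) : Prop :=
  forall i : 'I_n,
    let term (a : 'X_{1..n}) := taylor F i a * \prod_j x j 0 ^+ a j in
    cvgn (series (fun d =>
      \sum_(a : 'X_{1..n < d.+1} | mdeg a == d) `|term a|)) /\
    series (fun d => \sum_(a : 'X_{1..n < d.+1} | mdeg a == d) term a) @ \oo
      --> F x i 0.

Definition analytic_germ (R : realType) (n : nat)
    (F : 'cV[R]_n -> 'cV[R]_n) : Prop :=
  smooth_germ F /\ \forall x \near (0 : 'cV[R]_n), taylor_sums_to F x.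

Definition local_vf (R : realType) (n : nat)
    (reg : ('cV[R]_n -> 'cV[R]_n) -> Prop) (X : 'cV[R]_n -> 'cV[R]_n) :
    Prop :=
  reg X /\ X 0 = 0.

Definition local_diff (R : realType) (n : nat)
    (reg : ('cV[R]_n -> 'cV[R]_n) -> Prop) (phi : 'cV[R]_n -> 'cV[R]_n) :
    Prop :=
  [/\ reg phi, phi 0 = 0
    & exists psi : 'cV[R]_n -> 'cV[R]_n,
        [/\ reg psi, psi 0 = 0,
            \forall x \near (0 : 'cV[R]_n), psi (phi x) = x
          & \forall x \near (0 : 'cV[R]_n), phi (psi x) = x]].

(* [phi] is the germ of the time-one flow of [X]: near 0 it sends [x] to the
   value at time 1 of the integral curve of [X] starting at [x], which must
   stay where [X] is smooth (so that it is unique). *)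
Definition is_exp_germ (R : realType) (n : nat)
    (X phi : 'cV[R]_n -> 'cV[R]_n) : Prop :=
  exists U : set 'cV[R]_n,
    [/\ open_nbhs (0 : 'cV[R]_n) U, smooth_on U X
      & \forall x \near (0 : 'cV[R]_n), exists c : R -> 'cV[R]_n,
          [/\ c 0 = x, c 1 = phi x
            & forall t : R, 0 <= t <= 1 ->
                U (c t) /\ is_derive t 1 c (X (c t))]].

(* Main.v *)
Require Import Defs.
From HB Require Import structures.
From mathcomp Require Import all_boot all_order all_algebra complex mpoly ring lra.
From mathcomp Require Import all_classical all_reals all_analysis.

Set Implicit Arguments.
Unset Strict Implicit.
Unset Printing Implicit Defensive.

Import Order.TTheory GRing.Theory Num.Theory.
Import numFieldNormedType.Exports.

Local Open Scope classical_set_scope.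
Local Open Scope ring_scope.

(* If [phi = exp X], then [X] is invariant by [phi]: [X o phi = Dphi . X].
   Compare the terms of degree [k] on both sides, in the diagonalizing
   coordinates, and keep the monomials of weight [gamma_i - l] in the i-th
   component, with [l] in [2 pi i Z] and [l <> 0].  The field [X_k] contributes
   [Y o A - A Y], where [Y] is its weakly resonant part of weight [l]; as [Y]
   commutes with [X_{1,N}], this equals [(e^(-l) - 1) A Y = 0].  The map
   contributes the bracket of [X_1] with the part of weight [l] of [f_k], that
   is, [l] times this part, which therefore vanishes.  The lower order terms do
   not interfere: in case (a) the map is linear up to degree [k - 1], and in
   case (b) the same comparison in degree [d < k] shows that [X_d] is strongly
   resonant, because [Y |-> Y o A - A Y] is injective on the weights which are
   neither strongly nor weakly resonant.

   For formal fields, the invariance holds because the exponential of a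
   derivation is multiplicative.  For germs, the flow of [X] commutes with its
   time-one map, by uniqueness of integral curves, and one takes Taylor
   expansions. *)

(** Only Taylor coefficients of degree at most [k] enter the comparison, so everything is truncated
    to polynomials; the formal, smooth and analytic cases differ only in how they yield
    [X o phi = Dphi . X] up to degree [k]. A homogeneous part of this identity is a finite sum in
    which [X_k] and [f_k] each occur linearly, whereas the exponential series mixes all powers of
    [X]. A field has weight [l] when its i-th component has weight [gamma_i - l], so that it is an
    eigenvector of the bracket with [X_{1,s}], of eigenvalue [-l]. Because of [X_{1,N}], the number
    [e^(-l)] is a priori only a generalized eigenvalue of the pull-back [Y |-> A^-1 (Y o A)]. This
    is enough for injectivity when [e^(-l) <> 1]. When [e^(-l) = 1], however, the pull-back minus
    the identity could be a non-zero nilpotent operator, and [X_k] might then compensate for [f_k].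
    The hypothesis on [X_{1,N}] removes exactly this nilpotent remainder. *)

Definition mcomp (K : comNzRingType) (n : nat) (p : 'I_n -> {mpoly K[n]})
    (f : {mpoly K[n]}) : {mpoly K[n]} :=
  f \mPo [tuple p i | i < n].

HB.instance Definition _ (K : comNzRingType) (n : nat)
    (p : 'I_n -> {mpoly K[n]}) :=
  GRing.LRMorphism.copy (mcomp p) (comp_mpoly [tuple p i | i < n]).

(** The Lie derivative along the field with components [q j]; applied to the components of a map
    [p], it gives [Dp . q]. *)
Definition deriv_along (K : nzRingType) (n : nat) (q : 'I_n -> {mpoly K[n]})
    (f : {mpoly K[n]}) : {mpoly K[n]} :=
  \sum_j q j * f^`M(j).

Definition vanishes_below (K : nzRingType) (n d : nat) (f : {mpoly K[n]}) :=
  forall a, (mdeg a < d)%N -> f@_a = 0.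

Definition linform (K : nzRingType) (n : nat) (M : 'M[K]_n) (i : 'I_n) :
    {mpoly K[n]} :=
  \sum_j M i j *: 'X_j.

Definition weight (K : nzRingType) (n : nat) (gamma : 'I_n -> K)
    (a : 'X_{1..n}) : K :=
  \sum_k gamma k *+ a k.

(** An eigenvector, of eigenvalue [c], of the derivation [\sum_k gamma_k w_k d/dw_k]; the zero
    polynomial has every weight. *)
Definition of_weight (K : nzRingType) (n : nat) (gamma : 'I_n -> K) (c : K)
    (f : {mpoly K[n]}) :=
  forall a, f@_a != 0 -> weight gamma a = c.

Lemma mnm_ind (n : nat) (P : 'X_{1..n} -> Prop) :
  P 0%MM -> (forall i m, P m -> P (U_(i) + m)%MM) -> forall m, P m.
Proof.
move=> P0 PS m; move: {2}(mdeg m) (erefl (mdeg m)) => d.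
elim: d m => [|d IHd] m; first by move/eqP; rewrite mdeg_eq0 => /eqP ->.
move=> dm; have [i mi]: exists i, m i != 0%N.
  apply/existsP; rewrite -negb_forall; apply/negP => /forallP m0.
  by move: dm; rewrite mdegE big1 // => i _; apply/eqP.
have le_im: (U_(i) <= m)%MM by rewrite lep1mP.
rewrite -(submK le_im) addmC; apply/PS/IHd.
by apply/eqP; rewrite -(eqn_add2r 1) -(mdeg1 i) -mdegD submK // dm mdeg1 addn1.
Qed.

(** * Substitutions and derivations of polynomials *)

Section Polynomials.
Variables (K : comNzRingType) (n : nat).
Implicit Types (p q : 'I_n -> {mpoly K[n]}) (f g h : {mpoly K[n]})
  (M N : 'M[K]_n).

(** Suits identities between morphisms and derivations: the product rule replaces computations with
    exponents. *)
Lemma mpoly_ring_ind (P : {mpoly K[n]} -> Prop) :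
  (forall c, P c%:MP) -> (forall i, P 'X_i) ->
  (forall f g, P f -> P g -> P (f + g)) ->
  (forall f g, P f -> P g -> P (f * g)) -> forall f, P f.
Proof.
move=> PC PX PD PM; elim/mpolyind => [|c m f _ _ Pf]; first exact: (PC 0).
apply: (PD) => //; rewrite -mul_mpolyC; apply: (PM) => //.
elim/mnm_ind: m => [|i m Pm]; first by rewrite mpolyX0; apply: (PC 1).
by rewrite mpolyXD; apply: (PM).
Qed.

Lemma mcompX p i : mcomp p 'X_i = p i.
Proof. by rewrite /mcomp comp_mpolyXU -tnth_nth tnth_map tnth_ord_tuple. Qed.

Lemma mcompC p c : mcomp p c%:MP = c%:MP.
Proof. exact: comp_mpolyC. Qed.

Lemma mcompZ p c f : mcomp p (c *: f) = c *: mcomp p f.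
Proof. exact: comp_mpolyZ. Qed.

Lemma mcompE p f : mcomp p f = \sum_(m <- msupp f) f@_m *: mcomp p 'X_[m].
Proof.
rewrite {1}[f]mpolyE rmorph_sum /=.
by apply: eq_bigr => m _; rewrite mcompZ.
Qed.

Lemma eq_mcomp p q f : p =1 q -> mcomp p f = mcomp q f.
Proof.
by move=> epq; congr (_ \mPo _); apply: eq_from_tnth => i; rewrite !tnth_mktuple.
Qed.

Lemma mcompA p q f : mcomp p (mcomp q f) = mcomp (fun i => mcomp p (q i)) f.
Proof.
elim/mpoly_ring_ind: f => [c|i|f g Hf Hg|f g Hf Hg].
- by rewrite !mcompC.
- by rewrite !mcompX.
- by rewrite !rmorphD /= Hf Hg.
- by rewrite !rmorphM /= Hf Hg.
Qed.

Lemma mcomp_linform p M i :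
  mcomp p (linform M i) = \sum_j M i j *: p j.
Proof.
rewrite rmorph_sum /=; apply: eq_bigr => j _.
by rewrite mcompZ mcompX.
Qed.

Lemma linform_mx1 i : linform (1%:M : 'M[K]_n) i = 'X_i.
Proof.
rewrite /linform (bigD1 i) //= big1 ?mxE ?eqxx ?scale1r ?addr0 // => j /negbTE.
by rewrite eq_sym !mxE => ->; rewrite scale0r.
Qed.

Lemma linform_mul M N i :
  linform (M *m N) i = \sum_j M i j *: linform N j.
Proof.
rewrite /linform; under [RHS]eq_bigr do rewrite scaler_sumr.
rewrite exchange_big /=; apply: eq_bigr => l _.
by rewrite mxE scaler_suml; apply: eq_bigr => j _; rewrite scalerA.
Qed.

Lemma mcomp_id f : mcomp (fun i => 'X_i) f = f.
Proof. exact: comp_mpoly_id. Qed.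

Lemma mcomp_linformA M N f :
  mcomp (linform M) (mcomp (linform N) f) = mcomp (linform (N *m M)) f.
Proof.
by rewrite mcompA; apply: eq_mcomp => i; rewrite mcomp_linform linform_mul.
Qed.

Lemma mcomp_linformV M N f : N *m M = 1%:M ->
  mcomp (linform M) (mcomp (linform N) f) = f.
Proof.
move=> NM; rewrite mcomp_linformA NM -[RHS]mcomp_id.
by apply: eq_mcomp => i; rewrite linform_mx1.
Qed.

Lemma mderivXU i j : ('X_i : {mpoly K[n]})^`M(j) = (i == j)%:R%:MP.
Proof.
rewrite mderivX mnm1E; case: eqP => [->|_]; last by rewrite scale0r mpolyC0.
by rewrite scale1r -{1}[U_(j)%MM]add0m addmK mpolyX0.
Qed.

Lemma mderiv_linform M i j : (linform M i)^`M(j) = (M i j)%:MP.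
Proof.
rewrite raddf_sum /= (bigD1 j) //= big1 => [|l /negbTE lj].
  by rewrite mderivZ mderivXU eqxx addr0 -mul_mpolyC mulr1.
by rewrite mderivZ mderivXU lj mpolyC0 scaler0.
Qed.

Lemma mderiv_mcomp p f j :
  (mcomp p f)^`M(j) = \sum_l mcomp p f^`M(l) * (p l)^`M(j).
Proof.
elim/mpoly_ring_ind: f => [c|i|f g Hf Hg|f g Hf Hg].
- rewrite mcompC mderivC big1 // => l _; by rewrite mderivC rmorph0 mul0r.
- rewrite mcompX (bigD1 i) //= big1 => [|l /negbTE li].
    by rewrite mderivXU eqxx mcompC mul1r addr0.
  by rewrite mderivXU eq_sym li mcompC mul0r.
- rewrite rmorphD mderivD Hf Hg -big_split /=; apply: eq_bigr => l _.
  by rewrite mderivD rmorphD mulrDl.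
- rewrite rmorphM mderivM Hf Hg mulr_suml mulr_sumr -big_split /=.
  apply: eq_bigr => l _; rewrite mderivM rmorphD !rmorphM /=; ring.
Qed.

Fact deriv_along_is_linear q : linear (deriv_along q).
Proof.
move=> c f g; rewrite /deriv_along scaler_sumr -big_split /=.
by apply: eq_bigr => j _; rewrite mderivD mderivZ mulrDr scalerAr.
Qed.

HB.instance Definition _ q :=
  GRing.isLinear.Build K {mpoly K[n]} {mpoly K[n]} _ (deriv_along q)
    (deriv_along_is_linear q).

Lemma deriv_alongM q f g :
  deriv_along q (f * g) = deriv_along q f * g + f * deriv_along q g.
Proof.
rewrite /deriv_along mulr_suml mulr_sumr -big_split /=.
apply: eq_bigr => j _; rewrite mderivM; ring.
Qed.

Lemma deriv_alongX q i : deriv_along q 'X_i = q i.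
Proof.
rewrite /deriv_along (bigD1 i) //= big1 => [|l /negbTE li].
  by rewrite mderivXU eqxx mulr1 addr0.
by rewrite mderivXU eq_sym li mulr0.
Qed.

Lemma deriv_alongC q c : deriv_along q c%:MP = 0.
Proof. by rewrite /deriv_along big1 // => j _; rewrite mderivC mulr0. Qed.

Lemma deriv_along_linform q M i :
  deriv_along q (linform M i) = \sum_j M i j *: q j.
Proof.
by rewrite linear_sum; apply: eq_bigr => j _; rewrite linearZ /= deriv_alongX.
Qed.

(* [mcomp (linform M)] intertwines the derivations given by a field in the
   coordinates [z = M w] and in the coordinates [w]. *)
Lemma deriv_along_mcomp_linform M N q f : N *m M = 1%:M ->
  deriv_along (fun j => \sum_l N j l *: mcomp (linform M) (q l))
    (mcomp (linform M) f) = mcomp (linform M) (deriv_along q f).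
Proof.
move=> NM; have MN := mulmx1C NM; rewrite /deriv_along rmorph_sum /=.
under eq_bigr => j _ do rewrite mderiv_mcomp mulr_sumr.
rewrite exchange_big /=; apply: eq_bigr => l _; rewrite rmorphM /=.
under eq_bigr => j _ do rewrite mderiv_linform mulrCA.
rewrite -mulr_sumr mulrC; congr (_ * _).
under eq_bigr => j _ do rewrite mulrC mul_mpolyC scaler_sumr.
rewrite exchange_big (bigD1 l) //= [X in _ + X]big1 ?addr0 => [|s /negbTE sl].
  under eq_bigr => j _ do rewrite scalerA.
  rewrite -scaler_suml; have := congr1 (fun A : 'M[K]_n => A l l) MN.
  by rewrite !mxE eqxx => ->; rewrite scale1r.
under eq_bigr => j _ do rewrite scalerA.
rewrite -scaler_suml; have := congr1 (fun A : 'M[K]_n => A l s) MN.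
by rewrite !mxE eq_sym sl => ->; rewrite scale0r.
Qed.

(** * Order of vanishing *)

Lemma vanishes_below0 d : vanishes_below d (0 : {mpoly K[n]}).
Proof. by move=> a _; rewrite mcoeff0. Qed.

Lemma vanishes_belowD d f g :
  vanishes_below d f -> vanishes_below d g -> vanishes_below d (f + g).
Proof. by move=> f0 g0 a lt_a; rewrite mcoeffD f0 ?g0 ?addr0. Qed.

Lemma vanishes_belowZ d c f : vanishes_below d f -> vanishes_below d (c *: f).
Proof. by move=> f0 a lt_a; rewrite mcoeffZ f0 ?mulr0. Qed.

Lemma vanishes_belowN d f : vanishes_below d f -> vanishes_below d (- f).
Proof. by move=> f0 a lt_a; rewrite mcoeffN f0 ?oppr0. Qed.

Lemma vanishes_belowB d f g :
  vanishes_below d f -> vanishes_below d g -> vanishes_below d (f - g).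
Proof. by move=> f0 g0; apply/vanishes_belowD/vanishes_belowN. Qed.

Lemma vanishes_below_sum d I (r : seq I) (P : pred I) (F : I -> {mpoly K[n]}) :
  (forall i, P i -> vanishes_below d (F i)) ->
  vanishes_below d (\sum_(i <- r | P i) F i).
Proof.
move=> F0; elim/big_rec: _ => [|i f Pi f0]; first exact: vanishes_below0.
by apply: vanishes_belowD f0; apply: F0.
Qed.

Lemma vanishes_belowW d e f :
  (e <= d)%N -> vanishes_below d f -> vanishes_below e f.
Proof. by move=> le_ed f0 a lt_a; apply/f0/(leq_trans lt_a). Qed.

Lemma vanishes_belowM d e f g : vanishes_below d f -> vanishes_below e g ->
  vanishes_below (d + e) (f * g).
Proof.
move=> f0 g0 a lt_a; rewrite mcoeffM big1 // => -[b c] /= /eqP abc.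
have [lt_b|ge_b] := ltnP (mdeg b) d; first by rewrite f0 ?mul0r.
have lt_bc : (mdeg b + mdeg c < d + e)%N by rewrite -mdegD -abc.
rewrite g0 ?mulr0 //; by rewrite -(ltn_add2l d); apply: leq_ltn_trans lt_bc; rewrite leq_add2r.
Qed.

Lemma vanishes_below_mderiv d f j :
  vanishes_below d f -> vanishes_below d.-1 f^`M(j).
Proof.
move=> f0 a lt_a; rewrite mcoeff_deriv f0 ?mul0rn // mdegD mdeg1 addn1.
by move: lt_a; case: d f0.
Qed.

Lemma deriv_alongBl q q' f : deriv_along q f - deriv_along q' f =
  deriv_along (fun j => q j - q' j) f.
Proof.
by rewrite /deriv_along -sumrB; apply: eq_bigr => j _; rewrite mulrBl.
Qed.

(** Differentiation costs one order and the factor [q j] brings [d]; for [d = 2] one order is gained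
    over [f]. *)
Lemma vanishes_below_deriv_alongM d e q f :
  (forall i, vanishes_below d (q i)) ->
  vanishes_below e f -> vanishes_below (d + e.-1) (deriv_along q f).
Proof.
move=> q0 f0; apply: vanishes_below_sum => j _.
by apply: vanishes_belowM => //; apply: vanishes_below_mderiv.
Qed.

Lemma vanishes_below_deriv_along d q f :
  (forall i, vanishes_below 1 (q i)) ->
  vanishes_below d f -> vanishes_below d (deriv_along q f).
Proof.
move=> q0 f0; apply: vanishes_below_sum => j _.
case: d f0 => [|d] f0; first by move=> a; rewrite ltn0.
by rewrite -add1n; apply: vanishes_belowM (q0 j) (vanishes_below_mderiv j f0).
Qed.

Lemma vanishes_below_mcompX p (m : 'X_{1..n}) :
  (forall i, vanishes_below 1 (p i)) -> vanishes_below (mdeg m) (mcomp p 'X_[m]).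
Proof.
move=> p0; elim/mnm_ind: m => [|i m IHm]; first by rewrite mdeg0.
by rewrite mdegD mdeg1 mpolyXD rmorphM /= mcompX; apply: vanishes_belowM.
Qed.

Lemma vanishes_below_mcomp d p f : (forall i, vanishes_below 1 (p i)) ->
  vanishes_below d f -> vanishes_below d (mcomp p f).
Proof.
move=> p0 f0; rewrite mcompE; apply: vanishes_below_sum => m _.
have [lt_m|le_m] := ltnP (mdeg m) d.
  by rewrite f0 // scale0r; apply: vanishes_below0.
by apply/vanishes_belowZ/(vanishes_belowW le_m)/vanishes_below_mcompX.
Qed.

(** By telescoping, the difference is a sum of products with one factor [p i - q i], of order
    [e + 1], and [mdeg m - 1] factors of order 1. *)
Lemma vanishes_below_mcompXB e p q (m : 'X_{1..n}) :
  (forall i, vanishes_below 1 (p i)) -> (forall i, vanishes_below 1 (q i)) ->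
  (forall i, vanishes_below e.+1 (p i - q i)) ->
  vanishes_below (e + mdeg m) (mcomp p 'X_[m] - mcomp q 'X_[m]).
Proof.
move=> p0 q0 pq0; elim/mnm_ind: m => [|i m IHm].
  by rewrite mpolyX0 !rmorph1 subrr; apply: vanishes_below0.
rewrite mdegD mdeg1 mpolyXD !rmorphM /= !mcompX.
rewrite (_ : _ - _ = (p i - q i) * mcomp p 'X_[m]
                     + q i * (mcomp p 'X_[m] - mcomp q 'X_[m])); last by ring.
apply: vanishes_belowD.
  by rewrite addnA addn1; apply: vanishes_belowM => //; apply: vanishes_below_mcompX.
by rewrite addnCA; apply: vanishes_belowM.
Qed.

Lemma vanishes_below_mcompB d e p q f :
  (forall i, vanishes_below 1 (p i)) -> (forall i, vanishes_below 1 (q i)) ->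
  (forall i, vanishes_below e.+1 (p i - q i)) -> vanishes_below d f ->
  vanishes_below (e + d) (mcomp p f - mcomp q f).
Proof.
move=> p0 q0 pq0 f0; rewrite ![mcomp _ f]mcompE -sumrB.
apply: vanishes_below_sum => m _; rewrite -scalerBr.
have [lt_m|le_m] := ltnP (mdeg m) d.
  by rewrite f0 // scale0r; apply: vanishes_below0.
apply: vanishes_belowZ; have := vanishes_below_mcompXB (m := m) p0 q0 pq0.
by apply: vanishes_belowW; rewrite leq_add2l.
Qed.

Lemma mcoeff_linform M i j : (linform M i)@_U_(j) = M i j.
Proof.
rewrite raddf_sum /= (bigD1 j) //= big1 => [|l /negbTE lj].
  by rewrite mcoeffZ mcoeffXU eqxx mulr1 addr0.
by rewrite mcoeffZ mcoeffXU lj mulr0.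
Qed.

Lemma mcoeff_linform_nlin M i a : mdeg a != 1%N -> (linform M i)@_a = 0.
Proof.
move=> a1; rewrite raddf_sum /= big1 // => l _; rewrite mcoeffZ mcoeffX.
by case: (U_(l)%MM =P a) a1 => [<-|_]; rewrite ?mdeg1 ?mulr0.
Qed.

Lemma vanishes_below_linform M i : vanishes_below 1 (linform M i).
Proof. by move=> a a0; rewrite mcoeff_linform_nlin // neq_ltn a0. Qed.

Lemma linear_approx f : vanishes_below 1 f ->
  vanishes_below 2 (f - \sum_j f@_U_(j) *: 'X_j).
Proof.
move=> f0 a; rewrite mcoeffB ltnS leq_eqVlt => /orP[/mdeg1P[i /eqP ->]|lt_a].
  rewrite raddf_sum /= (bigD1 i) //= big1 => [|l /negbTE li].
    by rewrite mcoeffZ mcoeffXU eqxx mulr1 addr0 subrr.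
  by rewrite mcoeffZ mcoeffXU li mulr0.
rewrite f0 // sub0r raddf_sum /= big1 ?oppr0 // => l _.
by rewrite mcoeffZ mcoeffX; case: eqP lt_a => [<-|_]; rewrite ?mdeg1 ?mulr0.
Qed.

(** The nonlinear part of [f] has order 2, hence feels the change from [q] to [p] one order later
    than the linear part does. *)
Lemma mcomp_linearize e p q f : vanishes_below 1 f ->
  (forall i, vanishes_below 1 (p i)) -> (forall i, vanishes_below 1 (q i)) ->
  (forall i, vanishes_below e.+1 (p i - q i)) ->
  vanishes_below e.+2
    (mcomp p f - mcomp q f - \sum_j f@_U_(j) *: (p j - q j)).
Proof.
move=> f0 p0 q0 pq0; set g := f - \sum_j f@_U_(j) *: 'X_j.
have g0 : vanishes_below 2 g by apply: linear_approx.
rewrite (_ : _ - _ - _ = mcomp p g - mcomp q g); last first.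
  rewrite !rmorphB !rmorph_sum /=.
  under [X in _ = _ - X - _]eq_bigr do rewrite mcompZ mcompX.
  under [X in _ = _ - (_ - X)]eq_bigr do rewrite mcompZ mcompX.
  under eq_bigr do rewrite scalerBr.
  rewrite sumrB; ring.
by rewrite -addn2; apply: vanishes_below_mcompB.
Qed.

(** * Linear substitutions *)

Lemma dhomog_linform M i : linform M i \is 1.-homog.
Proof.
apply: rpred_sum => j _; apply: rpredZ.
by rewrite dhomogX; apply/eqP/mdeg1.
Qed.

Lemma dhomog_mcompX M (m : 'X_{1..n}) :
  mcomp (linform M) 'X_[m] \is (mdeg m).-homog.
Proof.
elim/mnm_ind: m => [|i m IHm]; first by rewrite mpolyX0 rmorph1 mdeg0 dhomog1.
rewrite mdegD mdeg1 mpolyXD rmorphM /= mcompX.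
by apply: dhomogM => //; apply: dhomog_linform.
Qed.

Lemma mcoeff_mcomp_linform_eq0 M d f a :
  (forall b, mdeg b = d -> f@_b = 0) -> mdeg a = d ->
  (mcomp (linform M) f)@_a = 0.
Proof.
move=> f0 ad; rewrite mcompE raddf_sum /= big1 // => m _.
rewrite mcoeffZ; have [md|md] := eqVneq (mdeg m) d; first by rewrite f0 ?mul0r.
by rewrite (dhomog_nemf_coeff (dhomog_mcompX M m)) ?mulr0 //= ad eq_sym.
Qed.

(** A linear substitution preserves degrees, so agreement in the single degree [mdeg a] is
    enough. *)
Lemma lin_substE (M : 'M[K]_n) (F : fps K n) f a :
  (forall b, mdeg b = mdeg a -> F b = f@_b) ->
  lin_subst M F a = (mcomp (linform M) f)@_a.
Proof.
move=> Ff; set g := \sum_(b : 'X_{1..n < (mdeg a).+1}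
                            | mdeg b == mdeg a) F b *: 'X_[K, val b].
have -> : lin_subst M F a = (mcomp (linform M) g)@_a.
  rewrite /lin_subst rmorph_sum /= raddf_sum /=; apply: eq_bigr => b _.
  rewrite mcompZ mcoeffZ; congr (_ * _@__).
  rewrite /mcomp comp_mpolyX; apply: eq_bigr => i _.
  by rewrite tnth_mktuple.
apply/eqP; rewrite -subr_eq0 -mcoeffB -rmorphB; apply/eqP.
apply: mcoeff_mcomp_linform_eq0 (erefl _) => c ca.
rewrite mcoeffB raddf_sum /=.
have lt_c : (mdeg c < (mdeg a).+1)%N by rewrite ca.
rewrite (bigD1 (BMultinom lt_c)) /= ?ca // big1 => [|b /andP[_ bc]].
  by rewrite mcoeffZ mcoeffX eqxx mulr1 addr0 -Ff // subrr.
rewrite mcoeffZ mcoeffX; case: eqP => [bE|_]; last by rewrite mulr0.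
by case/eqP: bc; apply: val_inj.
Qed.

(** * Weights *)

Variable gamma : 'I_n -> K.

Lemma weight0 : weight gamma 0%MM = 0.
Proof. by rewrite /weight big1 // => k _; rewrite mnm0E. Qed.

Lemma weightD a b : weight gamma (a + b)%MM = weight gamma a + weight gamma b.
Proof.
by rewrite /weight -big_split /=; apply: eq_bigr => k _; rewrite mnmDE mulrnDr.
Qed.

Lemma weightU i : weight gamma U_(i)%MM = gamma i.
Proof.
rewrite /weight (bigD1 i) //= big1 => [|k /negbTE ki]; rewrite mnm1E.
  by rewrite eqxx mulr1n addr0.
by rewrite eq_sym ki mulr0n.
Qed.

Lemma of_weight0 c : of_weight gamma c 0.
Proof. by move=> a; rewrite mcoeff0 eqxx. Qed.

Lemma of_weightD c f g :
  of_weight gamma c f -> of_weight gamma c g -> of_weight gamma c (f + g).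
Proof.
move=> fc gc a; rewrite mcoeffD; have [->|/fc //] := eqVneq f@_a 0.
by rewrite add0r => /gc.
Qed.

Lemma of_weightZ c k f : of_weight gamma c f -> of_weight gamma c (k *: f).
Proof.
move=> fc a; rewrite mcoeffZ => kf; apply: fc; apply: contraNneq kf => ->.
by rewrite mulr0.
Qed.

Lemma of_weight_sum c I (r : seq I) (P : pred I) (F : I -> {mpoly K[n]}) :
  (forall i, P i -> of_weight gamma c (F i)) ->
  of_weight gamma c (\sum_(i <- r | P i) F i).
Proof.
move=> Fc; elim/big_rec: _ => [|i f Pi fc]; first exact: of_weight0.
by apply: of_weightD fc; apply: Fc.
Qed.

Lemma of_weightM c d f g : of_weight gamma c f -> of_weight gamma d g ->
  of_weight gamma (c + d) (f * g).
Proof.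
move=> fc gd a; have [//|ne] := eqVneq (weight gamma a) (c + d).
rewrite mcoeffM big1 ?eqxx // => -[b e] /= /eqP aE.
have [->|/fc bc] := eqVneq f@_b 0; first by rewrite mul0r.
have [->|/gd ed] := eqVneq g@_e 0; first by rewrite mulr0.
by case/eqP: ne; rewrite aE weightD bc ed.
Qed.

Lemma of_weight_mcompX p (m : 'X_{1..n}) :
  (forall i, of_weight gamma (gamma i) (p i)) ->
  of_weight gamma (weight gamma m) (mcomp p 'X_[m]).
Proof.
move=> pw; elim/mnm_ind: m => [|i m IHm].
  rewrite mpolyX0 rmorph1 weight0 => a; rewrite mcoeff1.
  by case: (a =P 0%MM) => [->|_]; rewrite ?weight0 ?eqxx.
by rewrite mpolyXD rmorphM /= mcompX weightD weightU; apply: of_weightM.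
Qed.

Lemma of_weight_mcomp c p f : (forall i, of_weight gamma (gamma i) (p i)) ->
  of_weight gamma c f -> of_weight gamma c (mcomp p f).
Proof.
move=> pw fc; rewrite mcompE; apply: of_weight_sum => m _.
have [->|/fc <-] := eqVneq f@_m 0; first by rewrite scale0r; apply: of_weight0.
by apply/of_weightZ/of_weight_mcompX.
Qed.

Lemma of_weight_mderiv c f j :
  of_weight gamma c f -> of_weight gamma (c - gamma j) f^`M(j).
Proof.
move=> fc a; rewrite mcoeff_deriv => nz.
rewrite -(fc (a + U_(j))%MM) ?weightD ?weightU ?addrK //.
by apply: contraNneq nz => ->; rewrite mul0rn.
Qed.

Lemma of_weight_deriv_along c k q f :
  (forall j, of_weight gamma (gamma j + k) (q j)) -> of_weight gamma c f ->
  of_weight gamma (c + k) (deriv_along q f).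
Proof.
move=> qk fc; apply: of_weight_sum => j _.
rewrite (_ : c + k = gamma j + k + (c - gamma j)); last by ring.
by apply: of_weightM => //; apply: of_weight_mderiv.
Qed.

Lemma of_weight_linform (M : 'M[K]_n) i :
  (forall j, M i j != 0 -> gamma i = gamma j) ->
  of_weight gamma (gamma i) (linform M i).
Proof.
move=> Mg a; have [/eqP/mdeg1P[j /eqP ->]|a1] := eqVneq (mdeg a) 1%N.
  by rewrite mcoeff_linform weightU => /Mg.
by rewrite mcoeff_linform_nlin ?eqxx.
Qed.

End Polynomials.

(** * Complex sequences, Cauchy products and the complex exponential *)

Definition cvgC (R : realType) (u : nat -> R[i]) (a : R[i]) : Prop :=
  complex.Re (u n) @[n --> \oo] --> complex.Re a /\
  complex.Im (u n) @[n --> \oo] --> complex.Im a.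

(** A submultiplicative norm with values in [R] itself, so that majorants are real series. *)
Definition norm1 (R : realType) (z : R[i]) : R :=
  `|complex.Re z| + `|complex.Im z|.

(* Domination by the terms of an exponential series, which makes Cauchy
   products converge. *)
Definition exp_dominated (R : realType) (u : nat -> R[i]) : Prop :=
  exists c C : R, [/\ 0 <= c, 0 <= C
    & forall m, norm1 (u m) <= c * (C ^+ m / m`!%:R)].

Definition cauchy_product (K : pzRingType) (u v : nat -> K) : nat -> K :=
  fun m => \sum_(0 <= i < m.+1) u i * v (m - i)%N.

Lemma series_cauchy_product (K : pzRingType) (u v : nat -> K) N :
  \sum_(0 <= m < N) cauchy_product u v m =
  \sum_(0 <= i < N) u i * \sum_(0 <= j < N - i) v j.
Proof.
elim: N => [|N IHN]; first by rewrite !big_nil.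
rewrite big_nat_recr //= IHN [in RHS]big_nat_recr //= subSnn big_nat1.
rewrite /cauchy_product big_nat_recr //= subnn addrA; congr (_ + _).
rewrite -big_split /=; apply: eq_big_nat => i /andP[_ lt_i].
by rewrite -mulrDr subSn 1?ltnW // big_nat_recr.
Qed.

(** The defect between both products is the sum over the triangle [i, j < N <= i + j]. *)
Lemma cauchy_productB (K : comPzRingType) (u v : nat -> K) N :
  (\sum_(0 <= i < N) u i) * (\sum_(0 <= j < N) v j)
  - \sum_(0 <= m < N) cauchy_product u v m =
  \sum_(0 <= i < N) u i * \sum_(N - i <= j < N) v j.
Proof.
rewrite series_cauchy_product mulr_suml -sumrB.
apply: eq_big_nat => i /andP[_ lt_i].
rewrite -mulrBr; congr (_ * _).
by rewrite (big_cat_nat (leq0n _) (leq_subr i N)) /= addrAC subrr add0r.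
Qed.

Lemma exprD_fact (K : numFieldType) (x y : K) m :
  (x + y) ^+ m / m`!%:R =
  cauchy_product (fun i => x ^+ i / i`!%:R) (fun i => y ^+ i / i`!%:R) m.
Proof.
rewrite addrC exprDn mulr_suml /cauchy_product big_mkord; apply: eq_bigr => i _.
have le_im : (i <= m)%N by rewrite -ltnS.
rewrite -(bin_fact le_im) -mulr_natr !natrM.
have nz j : j`!%:R != 0 :> K by rewrite pnatr_eq0 -lt0n fact_gt0.
have nzb : 'C(m, i)%:R != 0 :> K by rewrite pnatr_eq0 -lt0n bin_gt0.
by field; rewrite !nz nzb.
Qed.

Section ComplexSequences.
Variable R : realType.
Implicit Types (u v : nat -> R[i]) (a b z : R[i]).

(** From here on, limits are taken on real and imaginary parts, where the real series of [expR],
    [cos] and [sin] apply. *)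
Lemma cvgCP u a : u @ \oo --> (a : R[i]^o) -> cvgC u a.
Proof.
move=> /(@cvgrPdist_lt (R[i]) (R[i]^o)) ua.
split; apply/cvgrPdist_lt => e e0.
  have e0' : 0 < e%:C%C :> R[i] by rewrite ltcR.
  apply: filterS (ua _ e0') => n; rewrite -ltcR; apply: le_lt_trans.
  by rewrite -raddfB; apply: normc_ge_Re.
have e0' : 0 < e%:C%C :> R[i] by rewrite ltcR.
apply: filterS (ua _ e0') => n; rewrite -ltcR; apply: le_lt_trans.
(* The imaginary part of [z] is minus the real part of [i z], and [i] has modulus 1. *)
rewrite -raddfB -normrN -raddfN /=; have := normc_ge_Re ('i%C * (a - u n)).
by rewrite normrM normc_def /= expr0n expr1n add0r sqrtr1 mul1r; apply: le_trans;
  rewrite lecR; case: (a - u n) => x y /=; rewrite !(mul0r, mul1r, sub0r, normrN).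
Qed.

Lemma cvgC_unique u a b : cvgC u a -> cvgC u b -> a = b.
Proof.
move=> [ua ua'] [ub ub']; apply/eqP; rewrite eq_complex; apply/andP.
by split; apply/eqP; [apply: cvg_unique ua ub|apply: cvg_unique ua' ub'];
  exact: norm_hausdorff.
Qed.

Lemma eq_cvgC u v a : u =1 v -> cvgC u a -> cvgC v a.
Proof. by move=> /funext ->. Qed.

Lemma cvgC_cst a : cvgC (fun=> a) a.
Proof. by split; apply: cvg_cst. Qed.

Lemma cvgCD u v a b : cvgC u a -> cvgC v b -> cvgC (fun n => u n + v n) (a + b).
Proof.
move=> [ua ua'] [vb vb']; split.
  by rewrite raddfD; under eq_fun do rewrite raddfD; apply: cvgD.
by rewrite raddfD; under eq_fun do rewrite raddfD; apply: cvgD.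
Qed.

Lemma cvgCM u v a b : cvgC u a -> cvgC v b -> cvgC (fun n => u n * v n) (a * b).
Proof.
have ReM (x y : R[i]) : complex.Re (x * y) =
  complex.Re x * complex.Re y - complex.Im x * complex.Im y.
  by case: x y => ? ? [].
have ImM (x y : R[i]) : complex.Im (x * y) =
  complex.Re x * complex.Im y + complex.Im x * complex.Re y.
  by case: x y => ? ? [].
move=> [ua ua'] [vb vb']; split.
  by rewrite ReM; under eq_fun do rewrite ReM; apply: cvgB; apply: cvgM.
by rewrite ImM; under eq_fun do rewrite ImM; apply: cvgD; apply: cvgM.
Qed.

Lemma cvgCZ c u a : cvgC u a -> cvgC (fun n => c * u n) (c * a).
Proof. by apply: cvgCM; apply: cvgC_cst. Qed.

Lemma cvgC_sum I (r : seq I) (P : pred I) (U : I -> nat -> R[i]) (A : I -> R[i]) :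
  (forall i, P i -> cvgC (U i) (A i)) ->
  cvgC (fun n => \sum_(i <- r | P i) U i n) (\sum_(i <- r | P i) A i).
Proof.
move=> UA; elim: r => [|i r IHr].
  by under eq_fun do rewrite big_nil; rewrite big_nil; apply: cvgC_cst.
under eq_fun do rewrite big_cons; rewrite big_cons.
by case: ifP => // Pi; apply: cvgCD => //; apply: UA.
Qed.

Lemma norm1_ge0 z : 0 <= norm1 z. Proof. exact: addr_ge0. Qed.

Lemma norm1D a b : norm1 (a + b) <= norm1 a + norm1 b.
Proof. by rewrite /norm1 !raddfD /= addrACA lerD ?ler_normD. Qed.

Lemma norm1M a b : norm1 (a * b) <= norm1 a * norm1 b.
Proof.
case: a b => a a' [b b']; rewrite /norm1 /=.
rewrite mulrDl !mulrDr -!normrM addrACA [X in _ <= _ + X]addrC.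
rewrite addrACA -addrA.
apply: le_trans (lerD (ler_normB _ _) (ler_normD _ _)) _.
by rewrite le_eqVlt; apply/orP; left; apply/eqP; ring.
Qed.

Lemma norm1_sum I (r : seq I) (P : pred I) (F : I -> R[i]) :
  norm1 (\sum_(i <- r | P i) F i) <= \sum_(i <- r | P i) norm1 (F i).
Proof.
elim/big_rec2: _ => [|i y x _ IH]; first by rewrite /norm1 normr0 addr0.
by apply: le_trans (norm1D _ _) _; rewrite lerD2l.
Qed.

Lemma norm1_real (x : R) : norm1 x%:C%C = `|x|.
Proof. by rewrite /norm1 /= normr0 addr0. Qed.

Lemma norm1X z m : norm1 (z ^+ m) <= norm1 z ^+ m.
Proof.
elim: m => [|m IHm]; first by rewrite !expr0 /norm1 /= normr0 normr1 addr0.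
rewrite !exprS; apply: le_trans (norm1M _ _) _.
by apply: ler_wpM2l IHm; apply: norm1_ge0.
Qed.

Lemma norm1_invn m : norm1 (m`!%:R^-1 : R[i]) = m`!%:R^-1.
Proof.
by rewrite -(rmorph_nat (real_complex R)) -fmorphV norm1_real ger0_norm.
Qed.

Lemma series_expR_cvg (c C : R) :
  \sum_(0 <= m < N) c * (C ^+ m / m`!%:R) @[N --> \oo] --> c * expR C.
Proof.
under eq_fun do rewrite -mulr_sumr.
by apply: cvgMr; apply: is_cvg_series_exp_coeff.
Qed.

(** The defect for [u] and [v] is bounded by the defect [r] for their majorants. The latter tends to
    0 without any estimate of remainders: by the binomial formula, both products of the majorants
    have the limit [c d e^(C + D)]. *)
Lemma exp_dominated_cauchy u v a b :
  exp_dominated u -> exp_dominated v ->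
  cvgC (series u) a -> cvgC (series v) b ->
  cvgC (series (cauchy_product u v)) (a * b).
Proof.
move=> [c [C [c0 C0 uc]]] [d [D [d0 D0 vd]]] ua vb.
pose U m := c * (C ^+ m / m`!%:R); pose V m := d * (D ^+ m / m`!%:R).
pose r N := \sum_(0 <= i < N) U i * \sum_(N - i <= j < N) V j.
have r0 : r N @[N --> \oo] --> 0.
  have -> : 0 = c * expR C * (d * expR D) - c * d * expR (C + D) :> R.
    by rewrite expRD; ring.
  rewrite /r; under eq_fun do rewrite -cauchy_productB.
  apply: cvgB; first by apply: cvgM; apply: series_expR_cvg.
  have -> : cauchy_product U V = fun m => c * d * ((C + D) ^+ m / m`!%:R).
    apply/funext => m; rewrite exprD_fact mulr_sumr; apply: eq_bigr => i _.
    by rewrite /U /V; ring.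
  exact: series_expR_cvg.
pose dlt N := \sum_(0 <= i < N) u i * \sum_(N - i <= j < N) v j.
have dltr N : norm1 (dlt N) <= r N.
  apply: le_trans (norm1_sum _ _ _) _; apply: ler_sum => i _.
  apply: le_trans (norm1M _ _) _; apply: ler_pM; rewrite ?norm1_ge0 //.
  by apply: le_trans (norm1_sum _ _ _) _; apply: ler_sum => j _.
have dlt0 : cvgC dlt 0.
  have sq (f : nat -> R) : (forall N, `|f N| <= r N) -> f @ \oo --> 0.
    move=> fr; apply: (@squeeze_cvgr _ _ _ _ (fun N => - r N) r) => //.
      by apply: nearW => N; rewrite -ler_norml.
    by rewrite -[X in _ --> X]oppr0; apply: cvgN.
  by split; apply: sq => N; apply: le_trans (dltr N);
    rewrite /norm1 ?lerDl ?lerDr.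
have : cvgC (fun N => series u N * series v N + (-1) * dlt N) (a * b + (-1) * 0).
  by apply: cvgCD; [apply: cvgCM|apply: cvgCZ].
rewrite mulr0 addr0; apply: eq_cvgC => N.
by rewrite mulN1r /dlt -cauchy_productB /series /=; ring.
Qed.

Lemma exp_dominatedX z : exp_dominated (fun m => z ^+ m / m`!%:R).
Proof.
exists 1, (norm1 z); split; rewrite ?norm1_ge0 // => m; rewrite mul1r.
apply: le_trans (norm1M _ _) _; rewrite norm1_invn.
by rewrite ler_wpM2r ?norm1X // invr_ge0 ler0n.
Qed.

(** * The complex exponential *)

Definition cexp z : R[i] :=
  (expR (complex.Re z))%:C%C * (cos (complex.Im z) +i* sin (complex.Im z))%C.

(** The series is the Cauchy product of those of [e^x] and [e^(iy)]; the terms of the latter are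
    those of [cos y + i sin y]. *)
Lemma cexp_series z : cvgC (series (fun m => z ^+ m / m`!%:R)) (cexp z).
Proof.
have [x [y ->]] : exists x y : R, z = x%:C%C + 'i%C * y%:C%C.
  by exists (complex.Re z), (complex.Im z); rewrite -complexE.
have -> : cexp (x%:C%C + 'i%C * y%:C%C) = (expR x)%:C%C * (cos y +i* sin y)%C.
  by rewrite /cexp /= !(mul0r, mul1r, subr0, addr0, add0r).
have -> : (fun m => (x%:C%C + 'i%C * y%:C%C) ^+ m / m`!%:R) =
  cauchy_product (fun m => x%:C%C ^+ m / m`!%:R)
                 (fun m => ('i%C * y%:C%C : R[i]) ^+ m / m`!%:R).
  by apply/funext => m; rewrite exprD_fact.
apply: exp_dominated_cauchy; try exact: exp_dominatedX.
  have E N : series (fun m => x%:C%C ^+ m / m`!%:R) N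
             = (series (exp_coeff x) N)%:C%C :> R[i].
    rewrite /series /= rmorph_sum; apply: eq_bigr => m _.
    by rewrite /exp_coeff /= rmorphM rmorphXn fmorphV rmorph_nat.
  split; under eq_fun do rewrite E; rewrite /=; last exact: cvg_cst.
  exact: is_cvg_series_exp_coeff.
have E m : ('i%C * y%:C%C : R[i]) ^+ m / m`!%:R
           = (cos_coeff y m +i* sin_coeff y m)%C.
  have iX : 'i%C ^+ m = ((~~ odd m)%:R * (-1) ^+ m./2
                         +i* ((odd m)%:R * (-1) ^+ m.-1./2))%C :> R[i].
    rewrite -{1}(odd_double_half m) exprD -mul2n exprM sqr_i.
    have -> : (-1) ^+ m./2 = ((-1) ^+ m./2)%:C%C :> R[i].
      by rewrite rmorphXn rmorphN1.
    case: (boolP (odd m)) => om /=.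
      rewrite -[in RHS](odd_double_half m) om /= doubleK.
      by rewrite expr1; apply/eqP; rewrite eq_complex /= !(mul0r, mulr0, mul1r, subr0, add0r, oppr0) !eqxx.
    by rewrite [_ ^+ 0]expr0; apply/eqP; rewrite eq_complex /= !(mul0r, mulr0, mul1r, subr0, add0r, addr0) ?eqxx.
  rewrite exprMn iX -(rmorphXn (real_complex R)) -(rmorph_nat (real_complex R)).
  rewrite -fmorphV; apply/eqP; rewrite eq_complex /=.
  rewrite !(mul0r, mulr0, mul1r, subr0, addr0, add0r).
  by rewrite /cos_coeff /sin_coeff /= exprnP !eqxx.
have Re_sum (I : Type) (r : seq I) (F : I -> R[i]) :
    complex.Re (\sum_(i <- r) F i) = \sum_(i <- r) complex.Re (F i).
  exact: (raddf_sum (@complex.Re R)).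
have Im_sum (I : Type) (r : seq I) (F : I -> R[i]) :
    complex.Im (\sum_(i <- r) F i) = \sum_(i <- r) complex.Im (F i).
  exact: (raddf_sum (@complex.Im R)).
split; rewrite /series /=.
  under eq_fun do (rewrite Re_sum; under eq_bigr do rewrite E).
  by rewrite cos.unlock; apply: is_cvg_series_cos_coeff.
under eq_fun do (rewrite Im_sum; under eq_bigr do rewrite E).
by rewrite sin.unlock; apply: is_cvg_series_sin_coeff.
Qed.

Lemma cos_shift2pi (y : R) (m : int) : cos (y - pi *+ 2 *~ m) = cos y.
Proof.
case: m => m; last by rewrite NegzE mulrNz opprK -pmulrn; rewrite (periodicn (@cosD2pi R)).
by rewrite -pmulrn -[in RHS](subrK (pi *+ 2 *+ m) y) (periodicn (@cosD2pi R)).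
Qed.

Lemma sin_shift2pi (y : R) (m : int) : sin (y - pi *+ 2 *~ m) = sin y.
Proof.
case: m => m; last by rewrite NegzE mulrNz opprK -pmulrn; rewrite (periodicn (@sinD2pi R)).
by rewrite -pmulrn -[in RHS](subrK (pi *+ 2 *+ m) y) (periodicn (@sinD2pi R)).
Qed.

Lemma two_pi_i_int (m : int) :
  (2 * pi)%:C%C * 'i%C * m%:~R = (0 +i* (2 * pi * m%:~R))%C :> R[i].
Proof.
have -> : m%:~R = (m%:~R)%:C%C :> R[i] by rewrite rmorph_int.
apply/eqP; rewrite eq_complex /=.
by rewrite !(mul0r, mulr0, mulr1, subr0, add0r, addr0, oppr0) !eqxx.
Qed.

Lemma cexp_eq1 z :
  cexp z = 1 -> exists m : int, z = (2 * pi)%:C%C * 'i%C * m%:~R.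
Proof.
case: z => x y; rewrite /cexp /= => /eqP.
rewrite eq_complex /= !(mul0r, mulr0, subr0, addr0, add0r) => /andP[/eqP ec /eqP es].
have e0 : expR x != 0 by rewrite gt_eqF ?expR_gt0.
have siny : sin y = 0.
  by move/eqP: es; rewrite mulf_eq0 (negbTE e0) => /eqP.
have cosy0 : 0 < cos y.
  have : 0 < expR x * cos y by rewrite ec.
  by rewrite pmulr_rgt0 ?expR_gt0.
have cosy : cos y = 1.
  have := cos2Dsin2 y; rewrite siny expr0n addr0 => /eqP.
  by rewrite sqrf_eq1 => /orP[/eqP //|/eqP cm]; move: cosy0; rewrite cm; lra.
have x0 : x = 0 by move: ec; rewrite cosy mulr1 -expR0; apply: expR_inj.
pose m := Num.floor (y / (2 * pi)); exists m.
have pi0 : 0 < 2 * pi :> R by rewrite mulr_gt0 ?pi_gt0.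
(* Half of the remainder of [y] modulo [2 pi]: it lies in the interval from 0 to [pi], where [sin]
   is positive except at 0, and [cos (2 t) = 1] forces [sin t = 0]. *)
pose t := y / 2 - pi * m%:~R.
have t0 : 0 <= t < pi.
  have := floor_itv (y / (2 * pi)); rewrite -/m.
  rewrite ler_pdivlMr // ltr_pdivrMr // intrD => /andP[h1 h2].
  by apply/andP; rewrite /t; split; lra.
have sint : sin t = 0.
  have tE : t *+ 2 = y - pi *+ 2 *~ m.
    by rewrite /t -mulr_natr -[in RHS]mulrzr -[in RHS]mulr_natr; field.
  have cos2t : cos (t *+ 2) = 1 by rewrite tE cos_shift2pi.
  have c2 : cos t ^+ 2 = 1 by move: cos2t; rewrite cos_mulr2n; lra.
  have /eqP : sin t ^+ 2 = 0 by have := cos2Dsin2 t; rewrite c2; lra.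
  by rewrite sqrf_eq0 => /eqP.
have tt0 : t = 0.
  apply/eqP; rewrite eq_le (andP t0).1 andbT leNgt; apply/negP => tp.
  by have := @sin_gt0_pi _ t; rewrite tp (andP t0).2 sint ltxx => /(_ isT).
have yE : y = 2 * pi * m%:~R by move: tt0; rewrite /t; lra.
by rewrite x0 yE two_pi_i_int.
Qed.

Lemma cexp_two_pi_i (m : int) : cexp ((2 * pi)%:C%C * 'i%C * m%:~R) = 1.
Proof.
rewrite two_pi_i_int /cexp /= expR0 mul1r.
have -> : 2 * pi * m%:~R = 0 - pi *+ 2 *~ (- m) :> R.
  by rewrite mulrNz opprK add0r -mulr_natr -[RHS]mulrzr; ring.
by rewrite cos_shift2pi sin_shift2pi cos0 sin0.
Qed.
End ComplexSequences.

(** * Truncations, and the exponential of a derivation of polynomials *)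

Definition mtrunc (K : nzRingType) (n k : nat) (F : fps K n) : {mpoly K[n]} :=
  \sum_(b : 'X_{1..n < k.+1}) F b *: 'X_[b].

Lemma mcoeff_mtrunc (K : nzRingType) (n k : nat) (F : fps K n) a :
  (mdeg a <= k)%N -> (mtrunc k F)@_a = F a.
Proof. by move=> ak; rewrite /mtrunc mcoeff_mpoly. Qed.

Lemma mcoeff_mtrunc_gt (K : nzRingType) (n k : nat) (F : fps K n) a :
  (k < mdeg a)%N -> (mtrunc k F)@_a = 0.
Proof.
move=> ka; rewrite raddf_sum /= big1 // => b _; rewrite mcoeffZ mcoeffX.
case: (val b =P a) => [ba|_]; last by rewrite mulr0.
by have := bmdeg b; rewrite ba ltnS leqNgt ka.
Qed.

Lemma mtrunc_approx (K : comNzRingType) (n k : nat) (f : {mpoly K[n]}) :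
  vanishes_below k.+1 (f - mtrunc k (fun a => f@_a)).
Proof. by move=> a ak; rewrite mcoeffB mcoeff_mtrunc // subrr. Qed.

Lemma mtrunc_const (K : nzRingType) (n k : nat) (F : fps K n) :
  F 0%MM = 0 -> vanishes_below 1 (mtrunc k F).
Proof.
move=> F0 a; rewrite ltnS leqn0 mdeg_eq0 => /eqP ->.
by rewrite mcoeff_mtrunc ?mdeg0.
Qed.

(** As [q] vanishes at 0, the derivation does not lower degrees and acts on [k]-jets by a finite
    matrix. This lets limits of coefficients pass through it. *)
Lemma mcoeff_deriv_along (K : comNzRingType) (n k : nat)
    (q : 'I_n -> {mpoly K[n]}) f a :
  (forall i, vanishes_below 1 (q i)) -> (mdeg a <= k)%N ->
  (deriv_along q f)@_a =
  \sum_(b : 'X_{1..n < k.+1}) f@_b * (deriv_along q 'X_[b])@_a.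
Proof.
move=> q0 ak.
have := vanishes_below_deriv_along q0 (mtrunc_approx (k := k) f) (a := a) ak.
rewrite [deriv_along _ _]linearB mcoeffB => /eqP; rewrite subr_eq0 => /eqP ->.
rewrite /= /mtrunc [deriv_along _ _]linear_sum raddf_sum /=.
by apply: eq_bigr => b _; rewrite linearZ mcoeffZ.
Qed.

Section ExpSeries.
Variables (R : realType) (n : nat) (q : 'I_n -> {mpoly R[i][n]}).
Hypothesis q0 : forall i, vanishes_below 1 (q i).
Implicit Types (f g : {mpoly R[i][n]}) (p : 'I_n -> {mpoly R[i][n]}).

Local Notation D := (deriv_along q).

Definition exp_term m f : {mpoly R[i][n]} := m`!%:R^-1 *: iter m D f.

Lemma mcoeff_exp_term m f a : (exp_term m f)@_a = (iter m D f)@_a / m`!%:R.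
Proof. by rewrite mcoeffZ mulrC. Qed.

Fact iter_deriv_is_linear m : linear (iter m D).
Proof.
elim: m => [|m IHm] c f g //=.
by rewrite IHm linearP.
Qed.

HB.instance Definition _ m :=
  GRing.isLinear.Build R[i] {mpoly R[i][n]} {mpoly R[i][n]} _ (iter m D)
    (iter_deriv_is_linear m).

Lemma exp_termS m f : m.+1%:R *: exp_term m.+1 f = D (exp_term m f).
Proof.
by rewrite /exp_term [deriv_along _ _]linearZ /= scalerA factS natrM invfM mulrA mulfV ?mul1r //.
Qed.

(** Leibniz' rule for [D^m / m!], a form free of binomial coefficients. In the induction, the two
    sums carry the factors [i] and [m + 1 - i], which add up to the [m + 1] of [exp_termS]. *)
Lemma exp_termM m f g :
  exp_term m (f * g) = cauchy_product (exp_term^~ f) (exp_term^~ g) m.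
Proof.
elim: m => [|m IHm].
  by rewrite /cauchy_product big_nat1 subn0 /exp_term /= !fact0 !invr1 !scale1r.
have m0 : m.+1%:R != 0 :> R[i] by rewrite pnatr_eq0.
apply: (scalerI m0); rewrite exp_termS IHm /cauchy_product linear_sum /=.
have -> : \sum_(0 <= i < m.+1) D (exp_term i f * exp_term (m - i) g) =
  \sum_(0 <= i < m.+1) i.+1%:R *: (exp_term i.+1 f * exp_term (m - i) g) +
  \sum_(0 <= i < m.+1) (m.+1 - i)%:R *: (exp_term i f * exp_term (m.+1 - i) g).
  rewrite -big_split /=; apply: eq_big_nat => i /andP[_ lt_i].
  rewrite deriv_alongM -!exp_termS subSn // scalerAl; congr (_ + _).
  by rewrite scalerAr.
have -> : \sum_(0 <= i < m.+1) i.+1%:R *: (exp_term i.+1 f * exp_term (m - i) g)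
  = \sum_(0 <= i < m.+2) i%:R *: (exp_term i f * exp_term (m.+1 - i) g).
  by rewrite [RHS]big_nat_recl //= scale0r add0r.
have -> : \sum_(0 <= i < m.+1) (m.+1 - i)%:R *: (exp_term i f * exp_term (m.+1 - i) g)
  = \sum_(0 <= i < m.+2) (m.+1 - i)%:R *: (exp_term i f * exp_term (m.+1 - i) g).
  by rewrite [RHS]big_nat_recr //= subnn scale0r addr0.
rewrite -big_split scaler_sumr /=; apply: eq_big_nat => i /andP[_ lt_i].
by rewrite -scalerDl -natrD subnKC // -ltnS.
Qed.

(** On [k]-jets the derivation is an operator of a finite-dimensional space. The constant [C] bounds
    its norm, so the coefficients of [D^m f] grow at most like [C^m]. *)
Lemma exp_term_dominated f a : exp_dominated (fun m => (exp_term m f)@_a).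
Proof.
pose k := mdeg a.
pose N f := \sum_(b : 'X_{1..n < k.+1}) norm1 f@_b.
have N0 g : 0 <= N g by apply: sumr_ge0 => b _; apply: norm1_ge0.
pose C := \sum_(b : 'X_{1..n < k.+1}) N (D 'X_[b]).
have C0 : 0 <= C by apply: sumr_ge0.
have NC (I : finType) (F : I -> R) i : (forall j, 0 <= F j) -> F i <= \sum_j F j.
  by move=> F0; rewrite (bigD1 i) //= lerDl sumr_ge0.
have ND g : N (D g) <= C * N g.
  rewrite {1}/N; apply: (@le_trans _ _ (\sum_(c : 'X_{1..n < k.+1})
      \sum_(b : 'X_{1..n < k.+1}) norm1 g@_b * norm1 (D 'X_[b])@_c)).
    apply: ler_sum => c _; rewrite (@mcoeff_deriv_along _ _ k) //; last first.
      by rewrite -ltnS bmdeg.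
    by apply: le_trans (norm1_sum _ _ _) _; apply: ler_sum => b _; apply: norm1M.
  rewrite exchange_big mulrC mulr_suml /=; apply: ler_sum => b _.
  rewrite -mulr_sumr; apply: ler_wpM2l; first exact: norm1_ge0.
  exact: (NC _ (fun b : 'X_{1..n < k.+1} => N (D 'X_[b]))).
have NX m : N (iter m D f) <= C ^+ m * N f.
  elim: m => [|m IHm]; first by rewrite mul1r.
  by rewrite exprS -mulrA; apply: le_trans (ND _) _; apply: ler_wpM2l.
exists (N f), C; split=> // m; rewrite mcoeff_exp_term.
apply: le_trans (norm1M _ _) _; rewrite norm1_invn mulrA ler_wpM2r //.
rewrite mulrC; apply: le_trans (NX m).
have ak : (mdeg a < k.+1)%N by [].
exact: (NC _ (fun b : 'X_{1..n < k.+1} => norm1 (iter m D f)@_b) (BMultinom ak)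
  (fun=> norm1_ge0 _)).
Qed.

(* The exponential of a derivation is multiplicative, so it is determined by
   its values on the variables. *)
Lemma exp_series_mcomp k p :
  (forall i a, (mdeg a <= k)%N ->
    cvgC (series (fun m => (exp_term m 'X_i)@_a)) (p i)@_a) ->
  forall f a, (mdeg a <= k)%N ->
    cvgC (series (fun m => (exp_term m f)@_a)) (mcomp p f)@_a.
Proof.
move=> pX; elim/mpoly_ring_ind => [c|i|f g Hf Hg|f g Hf Hg] a ak.
- (* Only the term [m = 0] is not zero, as in the series of [exp 0]. *)
  rewrite mcompC; have := cvgCZ (c%:MP_[n]@_a) (cexp_series (0 : R[i])).
  have -> : cexp (0 : R[i]) = 1.
    by have := cexp_two_pi_i R 0; rewrite mulr0.
  rewrite mulr1; apply: eq_cvgC => N; rewrite /series /= mulr_sumr.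
  apply: eq_bigr => m _; rewrite mcoeff_exp_term; case: m => [|m].
    by rewrite expr0 mul1r.
  rewrite expr0n mul0r mulr0 iterSr deriv_alongC.
  by rewrite linear0 mcoeff0 mul0r.
- by rewrite mcompX; apply: pX.
- rewrite rmorphD mcoeffD /=; have := cvgCD (Hf a ak) (Hg a ak).
  apply: eq_cvgC => N; rewrite /series /= -big_split; apply: eq_bigr => m _ /=.
  by rewrite !mcoeff_exp_term linearD mcoeffD mulrDl.
rewrite rmorphM mcoeffM /=.
(* A coefficient of the product is a finite sum of products of coefficients, and each of these is
   the limit of a Cauchy product. *)
have : cvgC (fun N => \sum_(b : 'X_{1..n < (mdeg a).+1, (mdeg a).+1}
                              | a == (b.1 + b.2)%MM)
    series (cauchy_product (fun m => (exp_term m f)@_b.1)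
                           (fun m => (exp_term m g)@_b.2)) N)
   (\sum_(b : 'X_{1..n < (mdeg a).+1, (mdeg a).+1} | a == (b.1 + b.2)%MM)
      (mcomp p f)@_b.1 * (mcomp p g)@_b.2).
  apply: cvgC_sum => -[b c] /= /eqP abc.
  have ba : (mdeg b + mdeg c <= mdeg a)%N by rewrite -mdegD -abc.
  apply: exp_dominated_cauchy; try exact: exp_term_dominated.
    by apply: Hf; apply: leq_trans ak; apply: leq_trans (leq_addr _ _) ba.
  by apply: Hg; apply: leq_trans ak; apply: leq_trans (leq_addl _ _) ba.
apply: eq_cvgC => N; rewrite /series /= exchange_big /=.
apply: eq_bigr => m _; rewrite exp_termM raddf_sum /= exchange_big /=.
by apply: eq_bigr => i _; rewrite mcoeffM.
Qed.

End ExpSeries.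

(** * Invariance under the formal exponential, and exponentials of matrices *)

Definition cvgC_expmx (R : realType) (n : nat) (B A : 'M[R[i]]_n) : Prop :=
  forall i j, cvgC (series (fun m => (B ^+ m) i j / m`!%:R)) (A i j).

Section FormalExp.
Variables (R : realType) (n : nat).
Implicit Types (X phi : fvect R[i] n).

(** The derivative reads [F] up to degree [k + 1], but in that degree only against the constant term
    of [X], which is zero. *)
Lemma vf_actE k X (x : 'I_n -> {mpoly R[i][n]}) (F : fps R[i] n)
    (f : {mpoly R[i][n]}) :
  in_maxideal X -> (forall j b, (mdeg b <= k)%N -> X j b = (x j)@_b) ->
  (forall b, (mdeg b <= k)%N -> F b = f@_b) ->
  forall a, (mdeg a <= k)%N -> vf_act X F a = (deriv_along x f)@_a.
Proof.
move=> X0 Xx Ff a ak; rewrite /vf_act /deriv_along raddf_sum /=.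
apply: eq_bigr => j _; rewrite (mcoeff_poly_mul_lin _ _ (ltnSn _)) /fps_mul.
apply: eq_bigr => b ba; have abE := submK ba.
have bak : (mdeg (a - b) + mdeg b <= k)%N by rewrite -mdegD abE.
rewrite -Xx ?(leq_trans _ bak) ?leq_addl //.
have [b0|b0] := eqVneq (mdeg b) 0%N.
  by move/eqP: b0; rewrite mdeg_eq0 => /eqP ->; rewrite X0 !mul0r.
rewrite mcoeff_deriv /fps_deriv Ff // mdegD mdeg1 addn1.
by apply: leq_trans bak; rewrite -addn1 leq_add2l lt0n.
Qed.

(** Both sides are the sum of [D^m X_i / m!]. By multiplicativity this sum is [X_i o phi]; since
    [D^m X_i = D (D^m z_i)], it is also [D phi_i]. *)
Lemma formal_exp_invariant k X phi : in_maxideal X ->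
  is_formal_exp X phi -> forall i a, (mdeg a <= k)%N ->
  (mcomp (fun j => mtrunc k (phi j)) (mtrunc k (X i)))@_a =
  (deriv_along (fun j => mtrunc k (X j)) (mtrunc k (phi i)))@_a.
Proof.
move=> X0 Xphi i a ak; pose q j := mtrunc k (X j).
have q0 j : vanishes_below 1 (q j) by apply/mtrunc_const/X0.
have iterE m j b : (mdeg b <= k)%N ->
    iter m (vf_act X) (fps_var R[i] j) b = (iter m (deriv_along q) 'X_j)@_b.
  elim: m b => [|m IHm] b bk /=; first by rewrite mcoeffX eq_sym.
  by apply: vf_actE bk => // l c ck; rewrite mcoeff_mtrunc.
have pX j b : (mdeg b <= k)%N ->
    cvgC (series (fun m => (exp_term q m 'X_j)@_b)) (mtrunc k (phi j))@_b.
  move=> bk; rewrite mcoeff_mtrunc //; apply: eq_cvgC (cvgCP (Xphi j b)) => N.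
  rewrite /series /=; apply: eq_bigr => m _.
  by rewrite mcoeff_exp_term iterE.
have lim1 := exp_series_mcomp q0 pX (mtrunc k (X i)) ak.
apply: cvgC_unique lim1 _; rewrite (mcoeff_deriv_along _ q0 ak).
have : cvgC (fun N => \sum_(b : 'X_{1..n < k.+1})
    series (fun m => (exp_term q m 'X_i)@_b) N * (deriv_along q 'X_[b])@_a)
  (\sum_(b : 'X_{1..n < k.+1})
    (mtrunc k (phi i))@_b * (deriv_along q 'X_[b])@_a).
  apply: cvgC_sum => b _; apply: cvgCM (cvgC_cst _); apply: pX.
  by rewrite -ltnS bmdeg.
apply: eq_cvgC => N; rewrite /series /=.
under eq_bigr do rewrite mulr_suml.
rewrite exchange_big /=; apply: eq_bigr => m _.
rewrite -(mcoeff_deriv_along _ q0 ak) /exp_term [deriv_along _ _]linearZ /=.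
by rewrite -iterS iterSr deriv_alongX.
Qed.

Variables (A B : 'M[R[i]]_n).
Hypothesis expBA : cvgC_expmx B A.

Local Notation D := (deriv_along (linform B)).

Lemma iter_deriv_linform m i : iter m D 'X_i = linform (B ^+ m) i.
Proof.
elim: m => [|m IHm]; first by rewrite expr0 linform_mx1.
by rewrite iterS IHm deriv_along_linform exprSr -linform_mul.
Qed.

Lemma linear_exp_series f a :
  cvgC (series (fun m => (exp_term (linform B) m f)@_a))
    (mcomp (linform A) f)@_a.
Proof.
have B0 := @vanishes_below_linform _ n B.
apply: (exp_series_mcomp (k := mdeg a) B0) => // i b _.
have [/eqP/mdeg1P[j /eqP ->]|b1] := eqVneq (mdeg b) 1%N.
  rewrite mcoeff_linform; apply: eq_cvgC (expBA i j) => N.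
  rewrite /series /=; apply: eq_bigr => m _.
  by rewrite mcoeff_exp_term iter_deriv_linform mcoeff_linform.
rewrite mcoeff_linform_nlin //; apply: (@eq_cvgC _ (fun=> 0)) (cvgC_cst 0) => N.
rewrite /series /= big1 // => m _.
by rewrite mcoeff_exp_term iter_deriv_linform mcoeff_linform_nlin ?mul0r.
Qed.

(** The entries of [B^m] are the linear coefficients of [D^m z_i], so the bound for derivations
    applies. *)
Lemma expmx_dominated i j : exp_dominated (fun m => (B ^+ m) i j / m`!%:R).
Proof.
have := exp_term_dominated (@vanishes_below_linform _ n B) 'X_i U_(j)%MM.
rewrite (_ : (fun m => _) = fun m => (B ^+ m) i j / m`!%:R) //.
apply/funext => m.
by rewrite mcoeff_exp_term iter_deriv_linform mcoeff_linform.
Qed.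

(** Scalar matrices commute with [B], so the binomial formula turns this series into the Cauchy
    product of those of [e^B] and [e^c]. *)
Lemma expmx_shift c i j :
  cvgC (series (fun m => ((B + c%:M) ^+ m) i j / m`!%:R)) (cexp c * A i j).
Proof.
rewrite mulrC; have := exp_dominated_cauchy (expmx_dominated i j)
  (exp_dominatedX c) (expBA i j) (cexp_series c).
apply: eq_cvgC => N; rewrite /series /=; apply: eq_bigr => m _.
have scalarX l : (c%:M : 'M[R[i]]_n) ^+ l = (c ^+ l)%:M.
  elim: l => [|l IHl]; first by rewrite !expr0.
  by rewrite !exprS IHl [RHS]scalar_mxM.
rewrite addrC exprDn_comm; last by rewrite /GRing.comm -![_ * _]/(_ *m _) scalar_mxC.
rewrite summxE mulr_suml /cauchy_product big_mkord; apply: eq_bigr => l _.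
have le_lm : (l <= m)%N by rewrite -ltnS.
have mulE (M M' : 'M[R[i]]_n) : M * M' = M *m M' by [].
rewrite mulmxnE scalarX mulE mul_scalar_mx mxE.
rewrite -(bin_fact le_lm) -mulr_natr !natrM.
have nz t : t`!%:R != 0 :> R[i] by rewrite pnatr_eq0 -lt0n fact_gt0.
have nzb : 'C(m, l)%:R != 0 :> R[i] by rewrite pnatr_eq0 -lt0n bin_gt0.
by field; rewrite !nz nzb.
Qed.

(* The hypothesis says that [Y] is an eigenvector of the Lie derivative along
   the linear field [B z]. *)
Lemma mcomp_linform_eigen c (Y : 'I_n -> {mpoly R[i][n]}) :
  (forall i, D (Y i) = \sum_j (B + c%:M) i j *: Y j) ->
  forall i, mcomp (linform A) (Y i) = cexp c *: \sum_j A i j *: Y j.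
Proof.
move=> DY i; apply/mpolyP => a.
(* Iterates of [D] become powers of [B + c]. After summation, [e^D] is the pull-back by [A] and
   [e^(B + c)] is [e^c A]. *)
have iterY m l : iter m D (Y l) = \sum_j ((B + c%:M) ^+ m) l j *: Y j.
  elim: m => [|m IHm].
    rewrite (bigD1 l) //= big1 => [|j /negbTE jl].
      by rewrite expr0 mxE eqxx scale1r addr0.
    by rewrite expr0 mxE eq_sym jl scale0r.
  rewrite iterS IHm linear_sum /=.
  under eq_bigr do rewrite linearZ /= DY scaler_sumr.
  rewrite exchange_big /=; apply: eq_bigr => s _.
  rewrite exprSr -[_ * _]/(_ *m _) mxE scaler_suml.
  by apply: eq_bigr => j _; rewrite scalerA.
apply: cvgC_unique (linear_exp_series (Y i) a) _.
have : cvgC (fun N => \sum_j series (fun m => ((B + c%:M) ^+ m) i j / m`!%:R) N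
                              * (Y j)@_a)
  (\sum_j cexp c * A i j * (Y j)@_a).
  by apply: cvgC_sum => j _; apply: cvgCM (cvgC_cst _); apply: expmx_shift.
rewrite mcoeffZ raddf_sum mulr_sumr /=.
rewrite (eq_bigr (fun j => cexp c * (A i j *: Y j)@_a)) => [|j _]; last first.
  by rewrite mcoeffZ mulrA.
apply: eq_cvgC => N; rewrite /series /=.
under eq_bigr do rewrite mulr_suml.
rewrite exchange_big /=; apply: eq_bigr => m _.
rewrite mcoeff_exp_term iterY raddf_sum /= mulr_suml.
by apply: eq_bigr => j _; rewrite mcoeffZ mulrAC.
Qed.

End FormalExp.

(** * Matrices acting on fields, and parts of given degree and weight *)

Definition mxact (K : nzRingType) (n : nat) (M : 'M[K]_n)
    (Y : 'I_n -> {mpoly K[n]}) : 'I_n -> {mpoly K[n]} :=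
  fun i => \sum_j M i j *: Y j.

Section MxAct.
Variables (K : comNzRingType) (n : nat) (gamma : 'I_n -> K).
Implicit Types (M : 'M[K]_n) (Y : 'I_n -> {mpoly K[n]}) (f : {mpoly K[n]}).

Lemma mxactM M1 M2 Y i : mxact M1 (mxact M2 Y) i = mxact (M1 *m M2) Y i.
Proof.
rewrite /mxact; under eq_bigr do rewrite scaler_sumr.
rewrite exchange_big /=; apply: eq_bigr => l _.
by rewrite mxE scaler_suml; apply: eq_bigr => j _; rewrite scalerA.
Qed.

Lemma mxact1 Y i : mxact 1%:M Y i = Y i.
Proof.
rewrite /mxact (bigD1 i) //= big1 ?mxE ?eqxx ?scale1r ?addr0 // => j /negbTE.
by rewrite eq_sym !mxE => ->; rewrite scale0r.
Qed.

Lemma eq_mxact M Y Z i : Y =1 Z -> mxact M Y i = mxact M Z i.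
Proof. by move=> YZ; apply: eq_bigr => j _; rewrite YZ. Qed.

Lemma mxactD M1 M2 Y i : mxact (M1 + M2) Y i = mxact M1 Y i + mxact M2 Y i.
Proof. by rewrite /mxact -big_split; apply: eq_bigr => j _; rewrite mxE scalerDl. Qed.

Lemma mxact_scalar c Y i : mxact c%:M Y i = c *: Y i.
Proof.
rewrite /mxact (bigD1 i) //= big1 ?mxE ?eqxx ?mulr1n ?addr0 // => j /negbTE.
by rewrite eq_sym !mxE => ->; rewrite scale0r.
Qed.

Lemma mxact_linear (F : {linear {mpoly K[n]} -> {mpoly K[n]}}) M Y i :
  F (mxact M Y i) = mxact M (fun j => F (Y j)) i.
Proof. by rewrite /mxact linear_sum; apply: eq_bigr => j _; rewrite linearZ. Qed.

(** [mxact M] composes with a linear map on the left and [mcomp p] composes with [p] on the right,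
    so they commute. *)
Lemma mcomp_mxact p M Y i :
  mcomp p (mxact M Y i) = mxact M (fun j => mcomp p (Y j)) i.
Proof. exact: (mxact_linear (mcomp p)). Qed.

Lemma deriv_along_mxact q M Y i :
  deriv_along q (mxact M Y i) = mxact M (fun j => deriv_along q (Y j)) i.
Proof. exact: (mxact_linear (deriv_along q)). Qed.

(** When [M] and [N] commute, the linear field [N z] is invariant under the map [M z]. *)
Lemma deriv_along_mcomp_comm M N f : M *m N = N *m M ->
  deriv_along (linform N) (mcomp (linform M) f) =
  mcomp (linform M) (deriv_along (linform N) f).
Proof.
move=> MN; rewrite /deriv_along rmorph_sum /=.
under eq_bigr => j _ do rewrite mderiv_mcomp mulr_sumr.
rewrite exchange_big /=; apply: eq_bigr => l _; rewrite rmorphM /=.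
rewrite mcomp_linform -linform_mul -MN linform_mul mulr_suml.
by apply: eq_bigr => j _; rewrite mderiv_linform mulrC -mulrA mul_mpolyC
  -scalerAr -scalerAl mulrC.
Qed.

Lemma deriv_along_linformD M N f :
  deriv_along (linform (M + N)) f =
  deriv_along (linform M) f + deriv_along (linform N) f.
Proof.
rewrite /deriv_along -big_split; apply: eq_bigr => j _ /=.
rewrite -mulrDl /linform -big_split; congr (_ * _); apply: eq_bigr => l _.
by rewrite mxE scalerDl.
Qed.

(** Says that [M] commutes with the diagonal matrix of the [gamma i]. *)
Definition preserves_weight M := forall i j, M i j != 0 -> gamma i = gamma j.

Lemma of_weight_mxact l M Y i : preserves_weight M ->
  (forall i, of_weight gamma (gamma i - l) (Y i)) ->
  of_weight gamma (gamma i - l) (mxact M Y i).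
Proof.
move=> Mw Yw; apply: of_weight_sum => j _.
have [->|/Mw ->] := eqVneq (M i j) 0; first by rewrite scale0r; apply: of_weight0.
exact: of_weightZ.
Qed.

Lemma of_weight_deriv_linform M c f : preserves_weight M ->
  of_weight gamma c f -> of_weight gamma c (deriv_along (linform M) f).
Proof.
move=> Mw fc; rewrite -[c]addr0; apply: of_weight_deriv_along fc => j.
by rewrite addr0; apply: of_weight_linform => l; apply: Mw.
Qed.

(** Euler's identity with weights, monomial by monomial. *)
Lemma deriv_along_diag M c f : (forall i j, M i j = gamma i *+ (i == j)) ->
  of_weight gamma c f -> deriv_along (linform M) f = c *: f.
Proof.
move=> Md fc.
have linM j : linform M j = gamma j *: 'X_j.
  rewrite /linform (bigD1 j) //= big1 => [|l /negbTE lj]; rewrite Md.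
    by rewrite eqxx addr0.
  by rewrite eq_sym lj mulr0n scale0r.
rewrite {1}[f]mpolyE linear_sum [in RHS](mpolyE f) scaler_sumr big_seq [RHS]big_seq.
apply: eq_bigr => m; rewrite mcoeff_msupp => /fc <-.
rewrite linearZ /= scalerA mulrC -scalerA; congr (_ *: _).
rewrite /deriv_along /weight scaler_suml; apply: eq_bigr => j _.
rewrite linM mderivX -scalerAl -scalerAr -mpolyXD scalerA mulr_natr.
have [->|mj] := eqVneq (m j) 0%N; first by rewrite !mulr0n !scale0r.
by rewrite addmC submK ?lep1mP.
Qed.

Definition bihomog (d : nat) (c : K) f : {mpoly K[n]} :=
  mtrunc d (fun a => if (mdeg a == d) && (weight gamma a == c) then f@_a else 0).

Lemma mcoeff_bihomog d c f a : (bihomog d c f)@_a =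
  if (mdeg a == d) && (weight gamma a == c) then f@_a else 0.
Proof.
have [ad|ad] := leqP (mdeg a) d; first by rewrite mcoeff_mtrunc.
by rewrite (gtn_eqF ad) /= mcoeff_mtrunc_gt.
Qed.

Lemma of_weight_bihomog d c f : of_weight gamma c (bihomog d c f).
Proof.
move=> a; rewrite mcoeff_bihomog; case: ifP => [/andP[_ /eqP //]|_].
by rewrite eqxx.
Qed.

Lemma vanishes_below_bihomog d c f : vanishes_below d (bihomog d c f).
Proof. by move=> a ad; rewrite mcoeff_bihomog (ltn_eqF ad). Qed.

Variable A : 'M[K]_n.
Hypothesis Aw : preserves_weight A.
Variable p : 'I_n -> {mpoly K[n]}.
Hypothesis p0 : forall i, vanishes_below 1 (p i).
Hypothesis pA : forall i, vanishes_below 2 (p i - linform A i).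
Hypothesis pw : forall i, of_weight gamma (gamma i) (p i).

(** Substituting [p] keeps weights and does not lower degrees, so only monomials of [f] of weight
    [c] and degree at most [d] count. Degrees below [d] are excluded by hypothesis, or because a
    linear [p] keeps degrees; in degree [d] only the linear part of [p] matters. *)
Lemma mcoeff_mcomp_lowest d c f a :
  mdeg a = d -> weight gamma a = c ->
  p =1 linform A \/
    (forall b, weight gamma b = c -> (mdeg b < d)%N -> f@_b = 0) ->
  (mcomp p f)@_a = (mcomp (linform A) (bihomog d c f))@_a.
Proof.
move=> ad ac f0; transitivity (mcomp p (bihomog d c f))@_a; last first.
  have := @vanishes_below_mcompB _ _ d 1 _ _ _ p0 (@vanishes_below_linform _ _ A)
    pA (@vanishes_below_bihomog d c f) a.
  rewrite ad add1n => /(_ (ltnSn _)) /eqP.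
  by rewrite mcoeffB subr_eq0 => /eqP.
apply/eqP; rewrite -subr_eq0 -mcoeffB -rmorphB /= mcompE raddf_sum /=.
rewrite big1 // => b _; rewrite mcoeffZ mcoeffB mcoeff_bihomog.
case: ifP => [_|nbdc]; first by rewrite subrr mul0r.
rewrite subr0; have [->|fb] := eqVneq f@_b 0; first by rewrite mul0r.
have [->|nz] := eqVneq (mcomp p 'X_[b])@_a 0; first by rewrite mulr0.
have bc : weight gamma b = c by rewrite -(of_weight_mcompX pw nz).
case/negP: nbdc; rewrite bc eqxx andbT.
case: f0 => [pE|f0].
  move: nz; rewrite (eq_mcomp _ pE) => nz; apply: contraNT nz => bd.
  by rewrite (dhomog_nemf_coeff (dhomog_mcompX A b)) //= ad eq_sym.
rewrite eqn_leq; apply/andP; split; rewrite leqNgt.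
  by apply: contraNN nz => db; rewrite (vanishes_below_mcompX p0) ?ad.
by apply: contraNN fb => bd; rewrite f0.
Qed.

(** The derivative of [p i] in direction [j] is [A i j] plus terms of positive degree. Such a term
    could only meet a monomial of [q j] of weight [gamma j - l] and degree below [d], which both
    cases of the hypothesis exclude. *)
Lemma mcoeff_deriv_along_lowest d l (q : 'I_n -> {mpoly K[n]}) i a :
  mdeg a = d -> weight gamma a = gamma i - l ->
  p =1 linform A \/
    (forall j b, weight gamma b = gamma j - l -> (mdeg b < d)%N -> (q j)@_b = 0) ->
  (deriv_along q (p i))@_a =
  (mxact A (fun j => bihomog d (gamma j - l) (q j)) i)@_a.
Proof.
move=> ad ac q0; rewrite /deriv_along /mxact !raddf_sum /=.
apply: eq_bigr => j _; set g := (p i)^`M(j).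
have g0 : vanishes_below 1 (g - (A i j)%:MP).
  rewrite -mderiv_linform -mderivB.
  exact: (vanishes_below_mderiv (d := 2)).
rewrite -[g](subrK (A i j)%:MP) mulrDr mcoeffD [X in X + _](_ : _ = 0) ?add0r.
  rewrite mulrC mul_mpolyC !mcoeffZ mcoeff_bihomog ad eqxx /= ac.
  have [->|/Aw ->] := eqVneq (A i j) 0; first by rewrite !mul0r.
  by rewrite eqxx.
case: q0 => [pE|q0].
  by rewrite /g pE mderiv_linform subrr mulr0 mcoeff0.
rewrite mcoeffM big1 // => -[b e] /= /eqP abe.
have [e0|e0] := posnP (mdeg e); first by rewrite g0 ?mulr0 ?e0.
have bd : (mdeg b < d)%N by rewrite -ad [X in (_ < mdeg X)%N](_ : _ = b + e)%MM // mdegD -{1}[mdeg b]addn0 ltn_add2l.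
have [->|nz] := eqVneq (g - (A i j)%:MP)@_e 0; first by rewrite mulr0.
have eE : (val e == 0%MM) = false by apply/negbTE; rewrite -mdeg_eq0 -lt0n.
move: nz; rewrite mcoeffB mcoeffC eE mulr0 subr0.
move/(of_weight_mderiv (j := j) (@pw i)) => ew.
rewrite (q0 j) ?mul0r //; apply: (addIr (weight gamma e)).
by rewrite -weightD -abe ac ew; ring.
Qed.

End MxAct.

(** * Linear maps and linear fields acting on fields of a given weight *)

Section LinearCore.
Variables (R : realType) (n : nat) (gamma : 'I_n -> R[i]).
Variables (A B S N : 'M[R[i]]_n).
Hypotheses (expBA : cvgC_expmx B A) (BSN : B = S + N).
Hypothesis Sdiag : forall i j, S i j = gamma i *+ (i == j).
Hypotheses (SN : S *m N = N *m S) (Nnil : exists m, N ^+ m = 0).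
Implicit Types (Y Z : 'I_n -> {mpoly R[i][n]}).

Let mulE (M M' : 'M[R[i]]_n) : M * M' = M *m M'. Proof. by []. Qed.

(** Entrywise, the commutation reads [(gamma i - gamma j) M i j = 0]. *)
Lemma commuting_preserves_weight (M : 'M[R[i]]_n) :
  S *m M = M *m S -> preserves_weight gamma M.
Proof.
move=> SM i j Mij; have /matrixP/(_ i j) := SM.
rewrite !mxE (bigD1 i) //= big1 => [|l /negbTE li]; last first.
  by rewrite Sdiag eq_sym li mul0r.
rewrite [in RHS](bigD1 j) //= [in RHS]big1 => [|l /negbTE lj]; last first.
  by rewrite Sdiag lj mulr0.
rewrite !Sdiag !eqxx !addr0 mulrC => /(mulfI Mij); exact.
Qed.

Lemma expmx_comm (M : 'M[R[i]]_n) : B *m M = M *m B -> A *m M = M *m A.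
Proof.
move=> BM; have BmM m : B ^+ m *m M = M *m B ^+ m.
  elim: m => [|m IHm]; first by rewrite expr0 mul1mx mulmx1.
  by rewrite exprS mulE -mulmxA IHm mulmxA BM -mulmxA.
apply/matrixP => i j; rewrite !mxE.
have : cvgC (fun n0 => \sum_l series (fun m => (B ^+ m) i l / m`!%:R) n0 * M l j)
   (\sum_l A i l * M l j).
  apply: cvgC_sum => l _; apply: cvgCM (cvgC_cst _); apply: (expBA i l).
have : cvgC (fun n0 => \sum_l M i l * series (fun m => (B ^+ m) l j / m`!%:R) n0)
   (\sum_l M i l * A l j).
  apply: cvgC_sum => l _; apply: cvgCZ; apply: (expBA l j).
move=> h1 h2; apply: cvgC_unique h2 _; apply: eq_cvgC h1 => K.
rewrite /series /=.
under eq_bigr do rewrite mulr_sumr.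
under [RHS]eq_bigr do rewrite mulr_suml.
rewrite exchange_big [RHS]exchange_big /=; apply: eq_bigr => m _.
have /matrixP/(_ i j) := BmM m; rewrite !mxE => BmMij.
under eq_bigr do rewrite mulrA.
under [RHS]eq_bigr do rewrite mulrAC.
by rewrite -!mulr_suml BmMij.
Qed.

Let SB : S *m B = B *m S.
Proof. by rewrite BSN mulmxDr mulmxDl SN. Qed.

Let Nw : preserves_weight gamma N.
Proof. exact: commuting_preserves_weight. Qed.

Let Aw : preserves_weight gamma A.
Proof. by apply: commuting_preserves_weight; rewrite expmx_comm. Qed.

Let AN : A *m N = N *m A.
Proof. by apply: expmx_comm; rewrite BSN mulmxDr mulmxDl SN. Qed.

(** The bracket with [S] is multiplication by [-l] and the bracket with [N] vanishes, so [Y] is a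
    true eigenvector for [B], as [mcomp_linform_eigen] requires. *)
Lemma lie_eigen l Y i : of_weight gamma (gamma i - l) (Y i) ->
  deriv_along (linform N) (Y i) = mxact N Y i ->
  deriv_along (linform B) (Y i) = mxact (B + (- l)%:M) Y i.
Proof.
move=> Yw YN; rewrite BSN deriv_along_linformD YN (deriv_along_diag Sdiag Yw).
have SY : mxact S Y i = gamma i *: Y i.
  by rewrite /mxact (bigD1 i) //= Sdiag eqxx mulr1n big1 ?addr0 // => j;
    rewrite eq_sym Sdiag => /negbTE ->; rewrite mulr0n scale0r.
by rewrite !mxactD mxact_scalar SY scalerBl scaleNr addrAC.
Qed.

Lemma mcomp_expmx_eigen l Y :
  (forall i, of_weight gamma (gamma i - l) (Y i)) ->
  (forall i, deriv_along (linform N) (Y i) = mxact N Y i) ->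
  forall i, mcomp (linform A) (Y i) = cexp (- l) *: mxact A Y i.
Proof.
move=> Yw YN; apply: (mcomp_linform_eigen expBA) => i.
exact: lie_eigen.
Qed.

(** The index depends on [f]: on variables it comes from [N], and in products indices add up by
    Leibniz' rule. *)
Lemma deriv_nilpotent (f : {mpoly R[i][n]}) :
  exists m, iter m (deriv_along (linform N)) f = 0.
Proof.
elim/mpoly_ring_ind: f => [c|i|f g [m fm] [m' gm]|f g [m fm] [m' gm]].
- by exists 1%N; rewrite /= deriv_alongC.
- have [m Nm] := Nnil; exists m; rewrite iter_deriv_linform Nm.
  by rewrite /linform big1 // => j _; rewrite mxE scale0r.
- exists (m + m')%N; rewrite linearD /= {1}addnC !iterD fm gm.
  by rewrite ![iter _ _ 0]linear0 addr0.
exists (m + m')%N; have : exp_term (linform N) (m + m') (f * g) = 0.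
  rewrite exp_termM /cauchy_product big_nat_cond big1 // => j /andP[/andP[_ jm] _].
  rewrite /exp_term; have [mj|mj] := leqP m j.
    by rewrite -(subnK mj) iterD fm [iter _ _ 0]linear0 scaler0 mul0r.
  have m'j : (m' <= m + m' - j)%N by rewrite addnC -addnBA ?leq_addr // ltnW.
  by rewrite -(subnK m'j) [iter (_ + _) _ g]iterD gm [iter _ _ 0]linear0 scaler0 mulr0.
rewrite /exp_term => /eqP; rewrite scaler_eq0 invr_eq0 pnatr_eq0.
by rewrite (gtn_eqF (fact_gt0 _)) => /eqP.
Qed.

(** A non-zero space stable under a nilpotent operator meets its kernel; so, to show that [P]
    contains only zero, one may restrict to the kernel. *)
Lemma nilpotent_descent (op : ('I_n -> {mpoly R[i][n]}) -> 'I_n -> {mpoly R[i][n]})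
    (P : ('I_n -> {mpoly R[i][n]}) -> Prop) :
  (forall Z, P Z -> P (op Z)) ->
  (forall Z, P Z -> (forall i, op Z i = 0) -> forall i, Z i = 0) ->
  forall m Z, P Z -> (forall i, iter m op Z i = 0) -> forall i, Z i = 0.
Proof.
move=> Pop P0; elim=> [|m IHm] Z PZ //; rewrite iterSr => opZ.
by apply: P0 => //; apply: IHm => //; apply: Pop.
Qed.

Hypothesis Aunit : A \in unitmx.

(* [e^(ad N)] is unipotent, so on the [l]-weight space the pull-back by [A] has
   [e^(-l)] as its only eigenvalue. *)
Lemma invariant_nonresonant l Y : cexp (- l) != 1 ->
  (forall i, of_weight gamma (gamma i - l) (Y i)) ->
  (forall i, mcomp (linform A) (Y i) = mxact A Y i) ->
  forall i, Y i = 0.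
Proof.
move=> l1 Yw YA.
pose P Z := (forall i, of_weight gamma (gamma i - l) (Z i)) /\
  (forall i, mcomp (linform A) (Z i) = mxact A Z i).
(* [ad N] is [opD - opN], a difference of commuting operators which preserve [P] and are nilpotent,
   locally for [opD]. Two descents reduce to their common kernel, where [N] commutes with [Z] and
   [mcomp_expmx_eigen] gives [(e^(-l) - 1) A Z = 0]. *)
pose opN Z := mxact N Z; pose opD Z i := deriv_along (linform N) (Z i : {mpoly R[i][n]}).
have mx0 M Z i : (forall j, Z j = 0) -> mxact M Z i = 0.
  by move=> Z0; rewrite /mxact big1 // => j _; rewrite Z0 scaler0.
have P_opN Z : P Z -> P (opN Z).
  move=> [Zw ZA]; split=> i; first exact: of_weight_mxact.
  rewrite mxact_linear (eq_mxact _ _ ZA) mxactM -AN -mxactM; exact: eq_mxact.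
have P_opD Z : P Z -> P (opD Z).
  move=> [Zw ZA]; split=> i; first exact: of_weight_deriv_linform.
  by rewrite -deriv_along_mcomp_comm // ZA mxact_linear.
have P0 Z : P Z -> (forall i, opN Z i = 0) -> (forall i, opD Z i = 0) ->
    forall i, Z i = 0.
  move=> [Zw ZA] NZ DZ; have AZ i : mxact A Z i = 0.
    have := mcomp_expmx_eigen Zw _ i; rewrite ZA => /(_ (fun j => _)) ZE.
    have /eqP : (cexp (- l) - 1) *: mxact A Z i = 0.
      rewrite scalerBl scale1r -ZE ?subrr // => j.
      by rewrite -[LHS]/(opD Z j) -[RHS]/(opN Z j) DZ NZ.
    by rewrite scaler_eq0 subr_eq0 (negbTE l1) => /eqP.
  move=> i; rewrite -[Z i]mxact1 -(mulVmx Aunit) -mxactM; exact: mx0.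
have iterN m Z i : iter m opN Z i = mxact (N ^+ m) Z i.
  elim: m i => [|m IHm] i; first by rewrite expr0 mxact1.
  by rewrite iterS /opN (eq_mxact _ _ IHm) mxactM exprS.
have iterDE m Z i : iter m opD Z i = iter m (deriv_along (linform N)) (Z i).
  by elim: m i => [|m IHm] i //=; rewrite /opD IHm.
have P1 Z : P Z -> (forall i, opN Z i = 0) -> forall i, Z i = 0.
  move=> PZ NZ.
  (* The index of nilpotency depends on the component; the sum of all of them serves for every
     component. *)
  have [M MZ] : exists M : 'I_n -> nat,
      forall i, iter (M i) (deriv_along (linform N)) (Z i) = 0.
    by apply: (fin_all_exists (fun i => deriv_nilpotent (Z i))).
  apply: (nilpotent_descent (op := opD)
    (P := fun Z => P Z /\ forall i, opN Z i = 0) _ _ (m := \sum_i M i)) => //.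
  - move=> Z' [PZ' NZ']; split=> [|i]; first exact: P_opD.
    by rewrite /opN /opD -mxact_linear -/(opN Z' i) NZ' linear0.
  - by move=> Z' [PZ' NZ'] DZ' i; apply: P0.
  move=> i; rewrite iterDE (bigD1 i) //= addnC iterD MZ.
  by rewrite [iter _ _ 0]linear0.
have [m Nm] := Nnil; apply: (nilpotent_descent (op := opN) (P := P) _ _ (m := m)) => //.
move=> i; rewrite iterN Nm /mxact big1 // => j _; by rewrite mxE scale0r.
Qed.

End LinearCore.

(** * Smooth functions of several real variables *)

Lemma near_eq_differentiable (R : numFieldType) (V W : normedModType R)
    (f g : V -> W) (x : V) :
  (\forall y \near x, f y = g y) -> differentiable f x -> differentiable g x.
Proof.
move=> fg df; have [cdf /eqaddoP fE] := (diff_locallyP x f).1 df.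
have fgx : f x = g x by apply: nbhs_singleton fg.
have gE : g \o shift x = cst (g x) + 'd f x +o_ (0 : V) id.
  apply/eqaddoP => e e0; move: (fE e e0).
  have fg' : \forall h \near (0 : V), f (h + x) = g (h + x).
    by apply: filterS ((nbhs0P _ _).1 fg) => h; rewrite addrC.
  apply: filterS2 fg' => h fgh.
  by rewrite -[(_ - _) h]/(f (h + x) - (f x + 'd f x h)) fgh fgx.
by apply/diff_locallyP; rewrite (diff_unique cdf gE).
Qed.

Section SmoothFunctions.
Variables (R : realType) (n : nat).
Local Notation V := 'cV[R]_n.
Local Notation e_ j := (delta_mx j 0 : 'cV[R]_n).
Implicit Types (f g : V -> R) (W : set V).

Lemma cV_sum_delta (v : V) : v = \sum_j v j 0 *: e_ j.
Proof.
apply/matrixP => i k; rewrite ord1 summxE (bigD1 i) //= big1 => [|j /negbTE ji].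
  by rewrite !mxE !eqxx mulr1 addr0.
by rewrite !mxE eq_sym ji mulr0.
Qed.

Lemma derive_partial f x v : differentiable f x ->
  'D_v f x = \sum_j v j 0 * partial j f x.
Proof.
move=> df; rewrite deriveE // {1}[v]cV_sum_delta linear_sum.
by apply: eq_bigr => j _; rewrite linearZ /partial deriveE.
Qed.

Lemma differentiable_cV (U : normedModType R) (F : U -> V) x :
  (forall i, differentiable (fun y => F y i 0) x) -> differentiable F x.
Proof.
move=> dF; have -> : F = \sum_i (fun y => F y i 0 *: e_ i).
  by apply/funext => y; rewrite fct_sumE; apply: cV_sum_delta.
by apply: differentiable_sum => i; apply: differentiableZl.
Qed.

Lemma differentiable_coordinate (U : normedModType R) (F : U -> V) x i :
  differentiable F x -> differentiable (fun y => F y i 0) x.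
Proof.
move=> dF; apply: (differentiable_comp (g := fun M : V => M i 0)) dF _.
exact: differentiable_coord.
Qed.

Lemma derive_coordinate (U : normedModType R) (F : U -> V) x i v :
  differentiable F x -> ('D_v F x) i 0 = 'D_v (fun y => F y i 0) x.
Proof. by move=> dF; rewrite derive_mx ?mxE //; apply: diff_derivable. Qed.

Lemma derive_comp (U U' W' : normedModType R) (F : U -> U') (f : U' -> W') x v :
  differentiable F x -> differentiable f (F x) ->
  'D_v (f \o F) x = 'D_('D_v F x) f (F x).
Proof.
move=> dF df; have dfF := differentiable_comp dF df.
by rewrite (deriveE _ dfF) (deriveE _ df) (deriveE _ dF) (diff_comp dF df).
Qed.

(** Recursive in the order, because the product and chain rules express partial derivatives through
    functions that are smooth to one order less. *)
Fixpoint smooth_upto (m : nat) (W : set V) (f : V -> R) : Prop :=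
  (forall x, W x -> differentiable f x) /\
  (if m is m'.+1 then forall j, smooth_upto m' W (partial j f) else True).

Lemma smooth_upto_diff m W f x : smooth_upto m W f -> W x -> differentiable f x.
Proof. by case: m => [|m] [df _] Wx; apply: df. Qed.

Lemma smooth_upto_partial m W f j :
  smooth_upto m.+1 W f -> smooth_upto m W (partial j f).
Proof. by case=> _; apply. Qed.

Lemma smooth_uptoW m W f : smooth_upto m.+1 W f -> smooth_upto m W f.
Proof.
elim: m f => [|m IHm] f [df pf]; first by [].
by split=> // j; apply/IHm/pf.
Qed.

Lemma smooth_upto_sub m W W' f : W `<=` W' ->
  smooth_upto m W' f -> smooth_upto m W f.
Proof.
move=> WW'; elim: m f => [|m IHm] f [df pf].
  by split=> // x Wx; apply/df/WW'.
by split=> [x Wx|j]; [apply/df/WW'|apply/IHm/pf].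
Qed.

Section OnOpen.
Variable W : set V.
Hypothesis Wopen : open W.

Lemma near_open (P : V -> Prop) x : (forall y, W y -> P y) -> W x ->
  \forall y \near x, P y.
Proof. by move=> WP Wx; apply: filterS WP _; apply: open_nbhs_nbhs. Qed.

Lemma eq_partial f g j x : (forall y, W y -> f y = g y) -> W x ->
  partial j f x = partial j g x.
Proof. by move=> fg Wx; apply: near_eq_derive; apply: near_open Wx. Qed.

Lemma eq_smooth_upto m f g : (forall x, W x -> f x = g x) ->
  smooth_upto m W f -> smooth_upto m W g.
Proof.
elim: m f g => [|m IHm] f g fg [df pf].
  split=> // x Wx; apply: near_eq_differentiable (df x Wx).
  exact: near_open Wx.
split=> [x Wx|j]; first by apply: near_eq_differentiable (df x Wx); apply: near_open Wx.
by apply: IHm (pf j) => x Wx; apply: eq_partial.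
Qed.

Lemma partialD f g j x : differentiable f x -> differentiable g x ->
  partial j (f + g) x = partial j f x + partial j g x.
Proof. by move=> df dg; rewrite /partial deriveD //; apply: diff_derivable. Qed.

Lemma partialM f g j x : differentiable f x -> differentiable g x ->
  partial j (f * g) x = partial j f x * g x + f x * partial j g x.
Proof.
move=> df dg; rewrite /partial deriveM; try exact: diff_derivable.
by rewrite addrC /GRing.scale /= [g x * _]mulrC.
Qed.

Lemma smooth_uptoD m f g :
  smooth_upto m W f -> smooth_upto m W g -> smooth_upto m W (f + g).
Proof.
elim: m f g => [|m IHm] f g [df pf] [dg pg].
  by split=> // x Wx; apply: differentiableD; [apply: df|apply: dg].
split=> [x Wx|j]; first by apply: differentiableD; [apply: df|apply: dg].
apply: (@eq_smooth_upto _ (partial j f + partial j g)) => [x Wx|]; last exact: IHm (pf j) (pg j).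
by rewrite partialD //; [apply: df|apply: dg].
Qed.

Lemma smooth_upto_cst m c : smooth_upto m W (cst c : V -> R).
Proof.
elim: m c => [|m IHm] c; first by split=> // x _; apply: differentiable_cst.
split=> [x _|j]; first exact: differentiable_cst.
apply: (@eq_smooth_upto _ (cst 0)) => // x Wx.
by rewrite /partial derive_cst.
Qed.

Lemma smooth_upto_sum m I (r : seq I) (F : I -> V -> R) :
  (forall i, smooth_upto m W (F i)) -> smooth_upto m W (\sum_(i <- r) F i).
Proof.
move=> sF; elim/big_rec: _ => [|i f _ sf]; first exact: smooth_upto_cst.
exact: smooth_uptoD.
Qed.

Lemma smooth_uptoM m f g :
  smooth_upto m W f -> smooth_upto m W g -> smooth_upto m W (f * g).
Proof.
elim: m f g => [|m IHm] f g sf sg; move: (sf) (sg) => [df pf] [dg pg].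
  by split=> // x Wx; apply: differentiableM; [apply: df|apply: dg].
split=> [x Wx|j]; first by apply: differentiableM; [apply: df|apply: dg].
apply: (@eq_smooth_upto _ (partial j f * g + f * partial j g)) => [x Wx|].
  by rewrite partialM //; [apply: df|apply: dg].
by apply: smooth_uptoD;
  [apply: IHm (pf j) (smooth_uptoW sg)|apply: IHm (smooth_uptoW sf) (pg j)].
Qed.

Variables (W' : set V) (F : V -> V).
Hypothesis FWW' : forall x, W x -> W' (F x).

Lemma partial_comp f j x :
  (forall i, differentiable (fun y => F y i 0) x) -> differentiable f (F x) ->
  partial j (f \o F) x = \sum_l partial l f (F x) * partial j (fun y => F y l 0) x.
Proof.
move=> dF df; have dF' := differentiable_cV dF.
rewrite /partial derive_comp // derive_partial //; apply: eq_bigr => l _.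
by rewrite derive_coordinate // mulrC.
Qed.

Lemma smooth_upto_comp m f : (forall i, smooth_upto m W (fun y => F y i 0)) ->
  smooth_upto m W' f -> smooth_upto m W (f \o F).
Proof.
elim: m f => [|m IHm] f sF sf.
  split=> // x Wx; apply: differentiable_comp.
    by apply: differentiable_cV => i; apply: smooth_upto_diff (sF i) Wx.
  by apply: smooth_upto_diff sf _; apply: FWW'.
split=> [x Wx|j].
  apply: differentiable_comp.
    by apply: differentiable_cV => i; apply: smooth_upto_diff (sF i) Wx.
  by apply: smooth_upto_diff sf _; apply: FWW'.
apply: (@eq_smooth_upto _ (\sum_l (partial l f \o F) * partial j (fun y => F y l 0))).
  move=> x Wx; rewrite fct_sumE partial_comp //.
    by move=> i; apply: smooth_upto_diff (sF i) Wx.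
  by apply: smooth_upto_diff sf _; apply: FWW'.
apply: smooth_upto_sum => l; apply: smooth_uptoM.
  apply: IHm; last exact: smooth_upto_partial.
  by move=> i; apply: smooth_uptoW.
exact: smooth_upto_partial.
Qed.

End OnOpen.

Lemma smooth_onP (W : set V) (F : V -> V) i : smooth_on W F ->
  forall m, smooth_upto m W (fun y => F y i 0).
Proof.
move=> sF m; have {sF} : forall s x, W x ->
    differentiable (foldr (@partial R n) (fun y => F y i 0) s) x by move=> s; apply: sF.
elim: m (fun y => F y i 0) => [|m IHm] f sf.
  by split=> //; apply: (sf [::]).
split=> [|j]; first by apply: (sf [::]).
(* The derivative taken first is the last element of the list. *)
by apply: IHm => s x Wx; have := sf (rcons s j) x Wx; rewrite foldr_rcons.
Qed.

End SmoothFunctions.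

(** * Symmetry of second partial derivatives *)

Section Schwarz.
Variables (R : realType) (n : nat).
Local Notation V := 'cV[R]_n.
Local Notation e_ j := (delta_mx j 0 : 'cV[R]_n).
Implicit Types (f g : V -> R) (W : set V).

Lemma is_derive_curve (f : V -> R) (c : R -> V) (t : R) (v : V) :
  is_derive t 1 c v -> differentiable f (c t) ->
  is_derive t 1 (fun s => f (c s)) ('D_v f (c t)).
Proof.
move=> [dc cv] df.
have dc' : differentiable c t by apply/derivable1_diffP.
have dfc := differentiable_comp dc' df.
apply: DeriveDef; first exact: diff_derivable.
by rewrite -[LHS]/('D_1 (f \o c) t) (derive_comp _ dc' df) cv.
Qed.

Lemma is_derive_line (x v : V) (t : R) :
  is_derive t 1 (fun s : R => x + s *: v) v.
Proof.
have ds : is_diff t (fun s : R => s *: v) (fun s : R => s *: v).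
  exact: is_diff_scalel.
have dv : derivable (fun s : R => s *: v) t 1 by exact: diff_derivable.
have Dv : 'D_1 (fun s : R => s *: v) t = v.
  by rewrite deriveE // (diff_val (df := fun s : R => s *: v)) scale1r.
have dx : derivable (cst x : R -> V) t 1 by exact: derivable_cst.
apply: DeriveDef; first exact: derivableD dx dv.
by rewrite (deriveD dx dv) derive_cst Dv add0r.
Qed.

Lemma mvt_line g (x v : V) (h : R) : 0 <= h ->
  (forall s, 0 <= s <= h -> differentiable g (x + s *: v)) ->
  exists2 s, 0 <= s <= h & g (x + h *: v) - g x = h * 'D_v g (x + s *: v).
Proof.
move=> h0 dg; pose u s := g (x + s *: v).
have du s : 0 <= s <= h -> is_derive s 1 u ('D_v g (x + s *: v)).
  by move=> sh; apply: is_derive_curve (is_derive_line x v s) (dg s sh).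
have [||s sh us] := @MVT_segment R u (fun s => 'D_v g (x + s *: v)) 0 h h0.
- by move=> s; rewrite in_itv /= => /andP[s0 sh]; apply: du; rewrite !ltW.
- apply: derivable_within_continuous => s; rewrite in_itv /= => sh.
  exact: (@ex_derive _ _ _ _ _ _ _ (du s sh)).
exists s; first by move: sh; rewrite in_itv.
by move: us; rewrite /u scale0r addr0 subr0 mulrC.
Qed.

Lemma derive_shift_sub f (a y v : V) : differentiable f y -> differentiable f (y + a) ->
  differentiable (fun y => f (y + a) - f y) y /\
  'D_v (fun y => f (y + a) - f y) y = 'D_v f (y + a) - 'D_v f y.
Proof.
move=> dy dya.
have ds : differentiable (fun y : V => y + a) y by apply: differentiableD.
have Ds : 'D_v (fun y : V => y + a) y = v.
  by rewrite (@deriveD _ _ _ id (cst a)) // derive_id derive_cst addr0.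
have dfs : differentiable (f \o (fun y : V => y + a)) y.
  exact: differentiable_comp.
split; first exact: differentiableB dfs dy.
rewrite (@deriveB _ _ _ (f \o (fun y : V => y + a)) f); try exact: diff_derivable.
by rewrite (derive_comp _ ds dya) Ds.
Qed.

(** The mean value theorem along [e_ i], for the increment of [f] along [e_ j], then along [e_ j].
    Up to regrouping, the second difference is symmetric in [i] and [j], whence Schwarz' theorem. *)
Lemma second_difference f i j x h : 0 <= h ->
  (forall s t, 0 <= s <= h -> 0 <= t <= h ->
     differentiable f (x + s *: e_ i + t *: e_ j) /\
     differentiable (partial i f) (x + s *: e_ i + t *: e_ j)) ->
  exists s t, [/\ 0 <= s <= h, 0 <= t <= h &
    f (x + h *: e_ i + h *: e_ j) - f (x + h *: e_ i) - (f (x + h *: e_ j) - f x)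
    = h * (h * partial j (partial i f) (x + s *: e_ i + t *: e_ j))].
Proof.
move=> h0 df; have hh : 0 <= h <= h by rewrite h0 lexx.
have h00 : 0 <= (0 : R) <= h by rewrite lexx.
pose g y := f (y + h *: e_ j) - f y.
have dg s : 0 <= s <= h -> differentiable g (x + s *: e_ i) /\
    'D_(e_ i) g (x + s *: e_ i) =
     partial i f (x + s *: e_ i + h *: e_ j) - partial i f (x + s *: e_ i).
  move=> sh; apply: derive_shift_sub; last by case: (df s h sh hh).
  by case: (df s 0 sh h00); rewrite scale0r addr0.
have [s sh gs] := mvt_line h0 (fun s sh => (dg s sh).1).
have [|t th gt] := @mvt_line (partial i f) (x + s *: e_ i) (e_ j) h h0.
  by move=> t th; case: (df s t sh th).
exists s, t; split=> //.
by rewrite -[partial j _ _]/('D_(e_ j) _ _) -gt -(dg s sh).2 -gs /g addrAC.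
Qed.

Lemma eq_at_limit (U : normedModType R) (F G : U -> R) x :
  {for x, continuous F} -> {for x, continuous G} ->
  (forall r, 0 < r -> exists y z, [/\ `|x - y| < r, `|x - z| < r & F y = G z]) ->
  F x = G x.
Proof.
move=> cF cG FG; apply: contrapT => /eqP; rewrite -subr_eq0 => ab.
pose e := `|F x - G x| / 2.
have e0 : 0 < e by rewrite divr_gt0 ?normr_gt0.
have nF : \forall y \near x, `|F x - F y| < e.
  by move/cvgrPdist_lt : cF => /(_ e e0).
have nG : \forall y \near x, `|G x - G y| < e.
  by move/cvgrPdist_lt : cG => /(_ e e0).
have [r r0 rP] := (nbhs_normP _ _).1 (filterI nF nG).
have [y [z [xy xz yz]]] := FG r r0.
have [/= Fy _] := rP _ xy; have [/= _ Gz] := rP _ xz.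
rewrite yz in Fy; have : `|F x - G x| < e + e.
  rewrite (_ : F x - G x = (F x - G z) + (G z - G x)); last by ring.
  by apply: le_lt_trans (ler_normD _ _) _; rewrite ltrD // distrC.
by rewrite /e -splitr ltxx.
Qed.

Lemma partial_comm W f i j x : open W -> W x -> smooth_upto 2 W f ->
  partial i (partial j f) x = partial j (partial i f) x.
Proof.
move=> Wo Wx sf; apply: eq_at_limit => [||r r0].
- by apply/differentiable_continuous/(smooth_upto_diff (m := 0) _ Wx)/smooth_upto_partial/smooth_upto_partial.
- by apply/differentiable_continuous/(smooth_upto_diff (m := 0) _ Wx)/smooth_upto_partial/smooth_upto_partial.
have [d d0 dW] := (nbhs_normP _ _).1 (open_nbhs_nbhs (conj Wo Wx)).
(* Displacements with coefficients at most [h] have norm at most [h C], half of the minimum: they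
   stay in [W] and within [r] of [x]. *)
pose C := `|e_ i| + `|e_ j| + 1; pose h := Num.min r d / (2 * C).
have C0 : 0 < C by rewrite /C ltr_wpDl ?addr_ge0.
have h0 : 0 < h by rewrite divr_gt0 ?lt_min ?r0 // mulr_gt0.
have ball_st s t : 0 <= s <= h -> 0 <= t <= h ->
    `|x - (x + s *: e_ i + t *: e_ j)| < Num.min r d.
  move=> /andP[s0 sh] /andP[t0 th].
  rewrite -addrA opprD addrA subrr add0r normrN.
  apply: le_lt_trans (ler_normD _ _) _; rewrite !normrZ !ger0_norm //.
  apply: (@le_lt_trans _ _ (h * C)).
    rewrite /C !mulrDr mulr1 -addrA lerD ?ler_wpM2r //.
    by rewrite ler_wpDr ?ler_wpM2r // ltW.
  rewrite /h invfM mulrA mulfVK ?gt_eqF // ltr_pdivrMr //.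
  by rewrite mulr_natr mulr2n ltrDl lt_min r0.
have inW s t : 0 <= s <= h -> 0 <= t <= h -> W (x + s *: e_ i + t *: e_ j).
  by move=> sh th; apply: dW; have := ball_st s t sh th; rewrite lt_min => /andP[].
have [|s [t [sh th E1]]] := @second_difference f i j x h (ltW h0).
  move=> s t sh th; split; first exact: smooth_upto_diff sf (inW _ _ sh th).
  exact: smooth_upto_diff (smooth_upto_partial i sf) (inW _ _ sh th).
have [|t' [s' [th' sh' E2]]] := @second_difference f j i x h (ltW h0).
  move=> t' s' th' sh'; rewrite addrAC.
  split; first exact: smooth_upto_diff sf (inW _ _ sh' th').
  exact: smooth_upto_diff (smooth_upto_partial j sf) (inW _ _ sh' th').
exists (x + s' *: e_ i + t' *: e_ j), (x + s *: e_ i + t *: e_ j); split.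
- by have := ball_st s' t' sh' th'; rewrite lt_min => /andP[].
- by have := ball_st s t sh th; rewrite lt_min => /andP[].
have eqw (p q u v w z : R) : p - q - (u - v) = h * (h * w) ->
    p - u - (q - v) = h * (h * z) -> z = w.
  move=> H1 H2; apply: (mulfI (lt0r_neq0 h0)); apply: (mulfI (lt0r_neq0 h0)).
  by rewrite -H1 -H2; ring.
rewrite (addrAC x (t' *: e_ j) (s' *: e_ i)) in E2.
rewrite (addrAC x (h *: e_ j) (h *: e_ i)) in E2.
exact: eqw E1 E2.
Qed.

End Schwarz.

Local Opaque mcomp.

(** * Taylor polynomials of sums, products and compositions *)

Section Taylor.
Variables (R : realType) (n : nat).
Local Notation V := 'cV[R]_n.
Implicit Types (f g : V -> R) (W : set V) (a : 'X_{1..n}).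

Definition smooth_fun W f := forall m, smooth_upto m W f.

(** The derivative used by [taylor], with the list of directions as a parameter in order to induct
    on it. *)
Definition mixed_partial (l : seq 'I_n) a f : V -> R :=
  foldr (fun j g => iter (a j) (partial j) g) f l.

Definition taylor_coef f : fps R n := fun a =>
  mixed_partial (enum 'I_n) a f 0 / (\prod_j (a j)`!)%:R.

Definition taylor_upto k f (p : {mpoly R[i][n]}) : Prop :=
  forall a, (mdeg a <= k)%N -> p@_a = (taylor_coef f a)%:C%C.

Lemma taylor_coef0 f : taylor_coef f 0%MM = f 0.
Proof.
rewrite /taylor_coef big1 ?divr1 => [|j _]; last by rewrite mnm0E.
rewrite /mixed_partial; elim: (enum _) => //= j l IHl.
by rewrite mnm0E.
Qed.

Lemma taylor_uptoW k f p : taylor_upto k.+1 f p -> taylor_upto k f p.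
Proof. by move=> fp a ak; apply: fp; apply: leqW. Qed.

Section OnOpen.
Variable W : set V.
Hypotheses (Wopen : open W) (W0 : W 0).

Lemma smooth_partial f j : smooth_fun W f -> smooth_fun W (partial j f).
Proof. by move=> sf m; apply/smooth_upto_partial/sf. Qed.

Lemma smooth_iter_partial f j m :
  smooth_fun W f -> smooth_fun W (iter m (partial j) f).
Proof. by move=> sf; elim: m => //= m IHm; apply: smooth_partial. Qed.

Lemma smooth_mixed_partial f l a :
  smooth_fun W f -> smooth_fun W (mixed_partial l a f).
Proof. by move=> sf; elim: l => //= j l IHl; apply: smooth_iter_partial. Qed.

Lemma eq_iter_partial f g j m : (forall x, W x -> f x = g x) ->
  forall x, W x -> iter m (partial j) f x = iter m (partial j) g x.
Proof.
move=> fg; elim: m => [|m IHm] //= x Wx.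
exact: (@eq_partial _ _ _ Wopen _ _ _ _ IHm Wx).
Qed.

Lemma eq_mixed_partial f g l a : (forall x, W x -> f x = g x) ->
  forall x, W x -> mixed_partial l a f x = mixed_partial l a g x.
Proof.
move=> fg; elim: l => [|j l IHl] //= x Wx.
exact: (@eq_iter_partial _ _ _ _ IHl _ Wx).
Qed.

Lemma eq_taylor_coef f g : (forall x, W x -> f x = g x) ->
  taylor_coef f =1 taylor_coef g.
Proof. by move=> fg a; rewrite /taylor_coef (eq_mixed_partial _ _ fg). Qed.

Lemma partial_iter_comm f i j m : smooth_fun W f ->
  forall x, W x ->
    partial j (iter m (partial i) f) x = iter m (partial i) (partial j f) x.
Proof.
move=> sf; elim: m => [|m IHm] //= x Wx.
rewrite (partial_comm _ _ Wopen Wx (smooth_iter_partial i m sf 2)).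
exact: (@eq_partial _ _ _ Wopen _ _ _ _ IHm Wx).
Qed.

Lemma partial_mixed_comm f l a j : smooth_fun W f ->
  forall x, W x ->
    partial j (mixed_partial l a f) x = mixed_partial l a (partial j f) x.
Proof.
move=> sf; elim: l => [|i l IHl] //= x Wx.
rewrite (partial_iter_comm _ _ _ (smooth_mixed_partial l a sf) Wx).
exact: (@eq_iter_partial _ _ _ _ IHl _ Wx).
Qed.

Lemma mixed_partial_notin f l a j : j \notin l ->
  mixed_partial l (a + U_(j))%MM f = mixed_partial l a f.
Proof.
elim: l => [|i l IHl] //=; rewrite inE negb_or => /andP[ij jl].
by rewrite IHl // mnmDE mnm1E (negbTE ij) addn0.
Qed.

(** By symmetry of second derivatives, the additional derivative in direction [j] can be taken
    first. *)
Lemma mixed_partialD1 f l a j : smooth_fun W f -> uniq l -> j \in l ->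
  forall x, W x ->
    mixed_partial l (a + U_(j))%MM f x = mixed_partial l a (partial j f) x.
Proof.
move=> sf; elim: l => [|i l IHl] //= /andP[il ul]; rewrite inE.
have [ji|ij] := eqVneq j i; move=> /= jl x Wx.
  rewrite -ji in il *; rewrite mixed_partial_notin // mnmDE mnm1E eqxx addn1 iterSr.
  by apply: eq_iter_partial Wx => y Wy; apply: partial_mixed_comm.
rewrite mnmDE mnm1E (negbTE ij) addn0.
by apply: eq_iter_partial Wx => y Wy; apply: IHl.
Qed.

Lemma taylor_coef_partial f j a : smooth_fun W f ->
  taylor_coef (partial j f) a = taylor_coef f (a + U_(j))%MM *+ (a j).+1.
Proof.
move=> sf; rewrite /taylor_coef.
rewrite -(mixed_partialD1 _ sf (enum_uniq _)) ?mem_enum //.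
have -> : (\prod_i ((a + U_(j))%MM i)`! = (a j).+1 * \prod_i (a i)`!)%N.
  rewrite (bigD1 j) //= [in RHS](bigD1 j) //= mnmDE mnm1E eqxx addn1 factS.
  rewrite mulnA; congr (_ * _)%N; apply: eq_bigr => i /negbTE ij.
  by rewrite mnmDE mnm1E eq_sym ij addn0.
rewrite natrM -[RHS]mulr_natl.
have c0 : (a j).+1%:R != 0 :> R by rewrite pnatr_eq0.
by rewrite invfM [RHS]mulrCA mulVKf.
Qed.

Lemma taylor_upto_partial k f p j : smooth_fun W f ->
  taylor_upto k.+1 f p -> taylor_upto k (partial j f) p^`M(j).
Proof.
move=> sf fp a ak; rewrite mcoeff_deriv fp; last by rewrite mdegD mdeg1 addn1.
by rewrite taylor_coef_partial // rmorphMn.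
Qed.

(** A polynomial is determined by its constant term and its partial derivatives. Taylor expansions
    of products and compositions thus follow from the rules of differentiation by induction on [k],
    with no sum over multi-indices. *)
Lemma taylor_uptoS k f p : smooth_fun W f -> p@_0%MM = (f 0)%:C%C ->
  (forall j, taylor_upto k (partial j f) p^`M(j)) -> taylor_upto k.+1 f p.
Proof.
move=> sf p0 pf a ak; have [a0|] := eqVneq a 0%MM.
  by rewrite a0 p0 taylor_coef0.
rewrite -mdeg_eq0 => a0; have [j aj] : exists j, (0 < a j)%N.
  apply/existsP; apply: contraNT a0; rewrite negb_exists => /forallP a0.
  by rewrite mdegE big1 // => j _; apply/eqP; rewrite -leqn0 leqNgt.
have ja : (U_(j) <= a)%MM by rewrite lep1mP -lt0n.
have aE := submK ja; set b := (a - U_(j))%MM in aE.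
have bk : (mdeg b <= k)%N by rewrite -ltnS -addn1 -(mdeg1 j) -mdegD aE.
have := pf j b bk; rewrite mcoeff_deriv taylor_coef_partial // aE rmorphMn /=.
move=> pE; have b0 : (b j).+1%:R != 0 :> R[i] by rewrite pnatr_eq0.
by apply: (mulfI b0); rewrite !mulr_natl.
Qed.

Lemma taylor_upto0 f p : p@_0%MM = (f 0)%:C%C -> taylor_upto 0 f p.
Proof.
move=> p0 a; rewrite leqn0 mdeg_eq0 => /eqP ->.
by rewrite p0 taylor_coef0.
Qed.

Lemma taylor_upto_const k f p : taylor_upto k f p -> p@_0%MM = (f 0)%:C%C.
Proof. by move=> fp; rewrite fp ?mdeg0 // taylor_coef0. Qed.

Lemma eq_taylor_upto k f g p : (forall x, W x -> f x = g x) ->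
  taylor_upto k f p -> taylor_upto k g p.
Proof. by move=> fg fp a ak; rewrite fp // (eq_taylor_coef fg). Qed.

Lemma smooth_funD f g : smooth_fun W f -> smooth_fun W g -> smooth_fun W (f + g).
Proof. by move=> sf sg m; apply: smooth_uptoD. Qed.

Lemma smooth_funM f g : smooth_fun W f -> smooth_fun W g -> smooth_fun W (f * g).
Proof. by move=> sf sg m; apply: smooth_uptoM. Qed.

Lemma smooth_fun_diff f x : smooth_fun W f -> W x -> differentiable f x.
Proof. by move=> sf; apply: smooth_upto_diff (sf 0%N). Qed.

Lemma taylor_uptoD k f g p q : smooth_fun W f -> smooth_fun W g ->
  taylor_upto k f p -> taylor_upto k g q -> taylor_upto k (f + g) (p + q).
Proof.
elim: k f g p q => [|k IHk] f g p q sf sg fp gq; have p0 := taylor_upto_const fp;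
  have q0 := taylor_upto_const gq.
  by apply: taylor_upto0; rewrite mcoeffD p0 q0 -rmorphD.
apply: taylor_uptoS; first exact: smooth_funD.
  by rewrite mcoeffD p0 q0 -rmorphD.
move=> j; apply: (@eq_taylor_upto _ (partial j f + partial j g)) => [x Wx|].
  by rewrite partialD //; apply: smooth_fun_diff Wx.
rewrite mderivD; apply: IHk; try exact: smooth_partial.
  exact: taylor_upto_partial.
exact: taylor_upto_partial.
Qed.

Lemma taylor_uptoM k f g p q : smooth_fun W f -> smooth_fun W g ->
  taylor_upto k f p -> taylor_upto k g q -> taylor_upto k (f * g) (p * q).
Proof.
have pq0 (p1 q1 : {mpoly R[i][n]}) (f1 g1 : V -> R) :
    p1@_0%MM = (f1 0)%:C%C -> q1@_0%MM = (g1 0)%:C%C ->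
    (p1 * q1)@_0%MM = ((f1 * g1) 0)%:C%C.
  move=> p0 q0; rewrite [LHS](rmorphM (@mcoeff n R[i] 0%MM)) /=.
  by rewrite p0 q0 -rmorphM.
elim: k f g p q => [|k IHk] f g p q sf sg fp gq; have p0 := taylor_upto_const fp;
  have q0 := taylor_upto_const gq; first by apply/taylor_upto0/pq0.
apply: taylor_uptoS; [exact: smooth_funM|exact: pq0|].
move=> j; apply: (@eq_taylor_upto _ (partial j f * g + f * partial j g)) => [x Wx|].
  by rewrite partialM //; apply: smooth_fun_diff Wx.
have spf := smooth_partial j sf; have spg := smooth_partial j sg.
rewrite mderivM; apply: taylor_uptoD.
- exact: smooth_funM.
- exact: smooth_funM.
- by apply: IHk => //; [apply: taylor_upto_partial|apply: taylor_uptoW].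
- by apply: IHk => //; [apply: taylor_uptoW|apply: taylor_upto_partial].
Qed.

Lemma smooth_fun_sum I (r : seq I) (F : I -> V -> R) :
  (forall i, smooth_fun W (F i)) -> smooth_fun W (\sum_(i <- r) F i).
Proof. by move=> sF m; apply: smooth_upto_sum => // i; apply: sF. Qed.

Lemma taylor_upto_sum k I (r : seq I) (F : I -> V -> R) (P : I -> {mpoly R[i][n]}) :
  (forall i, smooth_fun W (F i)) -> (forall i, taylor_upto k (F i) (P i)) ->
  taylor_upto k (\sum_(i <- r) F i) (\sum_(i <- r) P i).
Proof.
move=> sF FP; elim: r => [|i r IHr].
  rewrite !big_nil; elim: k {FP} => [|k IHk].
    by apply: taylor_upto0; rewrite mcoeff0.
  apply: taylor_uptoS => [m||j]; [exact: smooth_upto_cst|by rewrite mcoeff0|].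
  rewrite mderiv0; apply: eq_taylor_upto IHk => x Wx.
  by rewrite /partial derive_cst.
by rewrite !big_cons; apply: taylor_uptoD => //; apply: smooth_fun_sum.
Qed.

End OnOpen.

(** The constant terms agree because [F 0 = 0]; the chain rule, valid for functions and polynomials
    alike, reduces degree [k + 1] to degree [k]. *)
Lemma taylor_upto_comp k W W' f (F : V -> V) (p : 'I_n -> {mpoly R[i][n]}) q :
  open W -> W 0 -> open W' -> F 0 = 0 -> (forall x, W x -> W' (F x)) ->
  (forall l, smooth_fun W (fun y => F y l 0)) ->
  (forall l, taylor_upto k (fun y => F y l 0) (p l)) ->
  smooth_fun W' f -> taylor_upto k f q -> taylor_upto k (f \o F) (mcomp p q).
Proof.
move=> Wo W0 W'o F0 FWW' sF; have sfF f1 : smooth_fun W' f1 -> smooth_fun W (f1 \o F).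
  by move=> sf m; apply: smooth_upto_comp (sf m) => // l; apply: sF.
have p0 m (q1 : {mpoly R[i][n]}) f1 : (forall l, taylor_upto m (fun y => F y l 0) (p l)) ->
    q1@_0%MM = (f1 0)%:C%C -> (mcomp p q1)@_0%MM = ((f1 \o F) 0)%:C%C.
  move=> Fp q0; have p1 l : vanishes_below 1 (p l).
    move=> a; rewrite ltnS leqn0 mdeg_eq0 => /eqP ->.
    by rewrite (taylor_upto_const (Fp l)) F0 mxE.
  have q1c : vanishes_below 1 (q1 - (q1@_0)%:MP).
    move=> a; rewrite ltnS leqn0 mdeg_eq0 => /eqP ->.
    by rewrite mcoeffB mcoeffC eqxx mulr1 subrr.
  have := vanishes_below_mcomp p1 q1c (a := 0%MM).
  rewrite mdeg0 rmorphB /= mcompC mcoeffB mcoeffC eqxx mulr1 => /(_ isT)/eqP.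
  by rewrite subr_eq0 q0 /= F0 => /eqP.
have W'0 : W' 0 by rewrite -F0; apply: FWW'.
elim: k f q => [|k IHk] f q Fp sf fq; have q0 := taylor_upto_const fq.
  by apply: taylor_upto0; apply: p0 q0.
apply: (taylor_uptoS Wo W0 (sfF _ sf)); first exact: p0 q0.
move=> j; rewrite mderiv_mcomp.
apply: (@eq_taylor_upto W Wo W0 _
  (\sum_l (partial l f \o F) * partial j (fun y => F y l 0))) => [x Wx|].
  rewrite fct_sumE partial_comp //.
    by move=> l; apply: smooth_fun_diff (sF l) Wx.
  by apply: smooth_fun_diff sf _; apply: FWW'.
have sG l : smooth_fun W (partial l f \o F) by apply/sfF/smooth_partial.
have sH l : smooth_fun W (partial j (fun y => F y l 0)) by apply: smooth_partial.
apply: (taylor_upto_sum Wo W0) => l; first exact: smooth_funM.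
apply: (taylor_uptoM Wo W0) => //.
  apply: IHk; [by move=> s; apply: taylor_uptoW|exact: smooth_partial|].
  exact: (taylor_upto_partial W'o W'0).
exact: (taylor_upto_partial Wo W0).
Qed.

End Taylor.

Local Opaque mcomp mtrunc.

(** * Flows, and the Taylor expansion of the invariance *)

Section Flow.
Variables (R : realType) (n : nat).
Local Notation V := 'cV[R]_n.

Lemma taylor_invariant k (W W' : set V) (phi X : V -> V) :
  open W -> W 0 -> open W' -> (forall x, W x -> W' x) ->
  (forall x, W x -> W' (phi x)) -> phi 0 = 0 -> X 0 = 0 ->
  (forall i, smooth_fun W (fun y => phi y i 0)) ->
  (forall i, smooth_fun W' (fun y => X y i 0)) ->
  (forall x, W x -> forall i,
    X (phi x) i 0 = \sum_j X x j 0 * partial j (fun y => phi y i 0) x) ->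
  forall i a, (mdeg a <= k)%N ->
    (mcomp (fun j => mtrunc k (ctaylor phi j)) (mtrunc k (ctaylor X i)))@_a =
    (deriv_along (fun j => mtrunc k (ctaylor X j)) (mtrunc k (ctaylor phi i)))@_a.
Proof.
move=> Wo W0 W'o WW' WphiW' phi0 X0 sphi sX inv i a ak.
have tE m (F : V -> V) j : taylor_upto m (fun y => F y j 0) (mtrunc m (ctaylor F j)).
  by move=> b bm; rewrite mcoeff_mtrunc.
have sXW j : smooth_fun W (fun y => X y j 0).
  by move=> m; apply: smooth_upto_sub (sX j m).
have L := taylor_upto_comp Wo W0 W'o phi0 WphiW' sphi (tE k phi) (sX i) (tE k X i).
(* Differentiation loses one degree, so [phi] is expanded up to [k + 1]. *)
have Rt : taylor_upto k (\sum_j (fun y => X y j 0) * partial j (fun y => phi y i 0))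
  (\sum_j mtrunc k (ctaylor X j) * (mtrunc k.+1 (ctaylor phi i))^`M(j)).
  apply: (taylor_upto_sum Wo W0) => j.
    by apply: smooth_funM => //; apply: smooth_partial.
  apply: (taylor_uptoM Wo W0) => //; first exact: smooth_partial.
  exact: (taylor_upto_partial Wo W0).
have LR : taylor_upto k ((fun y => X y i 0) \o phi)
  (\sum_j mtrunc k (ctaylor X j) * (mtrunc k.+1 (ctaylor phi i))^`M(j)).
  apply: (eq_taylor_upto Wo W0) Rt => x Wx.
  by rewrite fct_sumE /= inv.
have q0 j : vanishes_below 1 (mtrunc k (ctaylor X j)).
  apply: mtrunc_const; rewrite /ctaylor -[taylor _ _ _]/(taylor_coef _ _).
  by rewrite taylor_coef0 X0 mxE.
rewrite (L a ak) -(LR a ak).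
(* The surplus terms of degree [k + 1] do not reach degree [k], because [X] vanishes at 0. *)
have d0 : vanishes_below k.+1 (mtrunc k.+1 (ctaylor phi i) - mtrunc k (ctaylor phi i)).
  move=> b bk; rewrite mcoeffB !mcoeff_mtrunc ?subrr //.
  exact: leqW.
apply/eqP; rewrite -subr_eq0; apply/eqP.
have := vanishes_below_deriv_along q0 d0 (a := a) ak.
by rewrite linearB mcoeffB.
Qed.

(** * Integral curves *)

Lemma locally_lipschitz (U : set V) (X : V -> V) p : open U -> U p ->
  (forall i, smooth_upto 1 U (fun y => X y i 0)) ->
  exists2 r, 0 < r & exists2 M, 0 <= M &
    (forall y, `|p - y| < r -> U y) /\
    forall y z, `|p - y| < r -> `|p - z| < r -> forall i,
      `|X y i 0 - X z i 0| <= M * \sum_l `|y l 0 - z l 0|.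
Proof.
move=> Uo Up sX.
pose D i l y := partial l (fun y => X y i 0) y.
have tri (u v : R) : `|u - v| < 1 -> `|v| < `|u| + 1.
  move=> uv; rewrite (_ : v = u - (u - v)); last by ring.
  by apply: le_lt_trans (ler_normB _ _) _; rewrite ltrD2l.
have near_D i l : \forall y \near p, `|D i l y| < `|D i l p| + 1.
  have cD : {for p, continuous (D i l)}.
    by apply/differentiable_continuous/(smooth_upto_diff (m := 0) _ Up)/smooth_upto_partial/sX.
  move/cvgrPdist_lt : cD => /(_ 1 ltr01); apply: filterS => y.
  exact: tri.
(* The partial derivatives are continuous at [p], hence bounded nearby; the double sum is one bound
   for all components and directions. *)
pose M := \sum_i \sum_l (`|D i l p| + 1).
have M0 : 0 <= M by do 2!(apply: sumr_ge0 => ? _); rewrite addr_ge0.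
have near_all : \forall y \near p, forall i l, `|D i l y| < `|D i l p| + 1.
  apply: filter_forall _ (fun i => filter_forall _ (near_D i)).
have nU : nbhs p U by apply: open_nbhs_nbhs.
have [r r0 rP] := (nbhs_normP _ _).1 (filterI nU near_all).
exists r => //; exists M => //; split=> [y py|y z py pz i].
  by case: (rP y py).
(* Balls are convex, so the mean value theorem applies on the segment from [z] to [y]. *)
have seg s : 0 <= s <= 1 -> `|p - (z + s *: (y - z))| < r.
  move=> /andP[s0 s1].
  have -> : p - (z + s *: (y - z)) = (1 - s) *: (p - z) + s *: (p - y).
    by apply/matrixP => i' j'; rewrite !mxE; ring.
  apply: le_lt_trans (ler_normD _ _) _; rewrite !normrZ.
  rewrite (ger0_norm s0) ger0_norm ?subr_ge0 //.
  have [s00|s00] := eqVneq s 0; first by rewrite s00 mul0r addr0 subr0 mul1r.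
  have sp : 0 < s by rewrite lt_neqAle eq_sym s00.
  have h1 : (1 - s) * `|p - z| <= (1 - s) * r by rewrite ler_wpM2l ?subr_ge0 // ltW.
  have h2 : s * `|p - y| < s * r by rewrite ltr_pM2l.
  by apply: lt_le_trans (ler_ltD h1 h2) _; rewrite -mulrDl subrK mul1r.
have dX s : 0 <= s <= 1 -> differentiable (fun y => X y i 0) (z + s *: (y - z)).
  move=> s01; apply: smooth_upto_diff (sX i) _.
  by case: (rP _ (seg s s01)).
have [s s01 E] := mvt_line ler01 dX.
have zy : z + 1 *: (y - z) = y by rewrite scale1r addrC subrK.
rewrite zy mul1r (derive_partial _ (dX s s01)) in E.
rewrite E; apply: le_trans (ler_norm_sum _ _ _) _; rewrite mulr_sumr.
apply: ler_sum => l _; rewrite normrM mulrC !mxE; apply: ler_wpM2r => //.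
have [_ /(_ i l) Ds] := rP _ (seg s s01).
apply: le_trans (ltW Ds) _; rewrite /M (bigD1 i) //= (bigD1 l) //=.
rewrite -addrA lerDl addr_ge0 //; first by apply: sumr_ge0 => ? _; rewrite addr_ge0.
by do 2!(apply: sumr_ge0 => ? _); rewrite addr_ge0.
Qed.

(** Gronwall's argument for [h], the sum of the squares of the coordinates of [c1 - c2]: a Lipschitz
    bound gives [h' <= K h], so [h e^(-K t)] does not increase; it is non-negative and zero at
    [t0]. *)
Lemma ode_local (U : set V) (X : V -> V) (c1 c2 : R -> V) (t0 T : R) :
  open U -> (forall i, smooth_upto 1 U (fun y => X y i 0)) -> t0 < T ->
  c1 t0 = c2 t0 ->
  (forall t, t0 <= t <= T -> U (c1 t) /\ is_derive t 1 c1 (X (c1 t))) ->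
  (forall t, t0 <= t <= T -> U (c2 t) /\ is_derive t 1 c2 (X (c2 t))) ->
  exists2 d, 0 < d & forall t, t0 <= t <= T -> t <= t0 + d -> c1 t = c2 t.
Proof.
move=> Uo sX t0T c12 h1 h2.
have t00 : t0 <= t0 <= T by rewrite lexx ltW.
have [r r0 [M M0 [rU lip]]] := locally_lipschitz Uo (h1 t0 t00).1 sX.
have cont (c : R -> V) : (forall t, t0 <= t <= T -> U (c t) /\ is_derive t 1 c (X (c t))) ->
    \forall t \near t0, `|c t0 - c t| < r.
  move=> hc; have [_ [dc _]] := hc t0 t00.
  have : {for t0, continuous c} by apply/differentiable_continuous/derivable1_diffP.
  by move/cvgrPdist_lt => /(_ r r0).
have [d d0 dP] := (nbhs_normP _ _).1 (filterI (cont _ h1) (cont _ h2)).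
(* Each [2 M |w_i| |w_l|] is at most [M (w_i^2 + w_l^2)], and the sum of these over [i] and [l] is
   [2 M n h]. *)
pose K : R := 2 * M * n%:R.
exists (d / 2); first by rewrite divr_gt0.
move=> t1 /andP[t01 t1T] t1d.
have inball t : t0 <= t <= t1 -> `|c1 t0 - c1 t| < r /\ `|c1 t0 - c2 t| < r.
  move=> /andP[t0t tt1]; have : `|t0 - t| < d.
    rewrite distrC ger0_norm ?subr_ge0 // ltrBlDl.
    by apply: le_lt_trans tt1 (le_lt_trans t1d _); rewrite ltrD2l ltr_pdivrMr // ltr_pMr // ltr1n.
  by move=> td; case: (dP t td) => /= h h'; split; rewrite // c12.
have tT t : t0 <= t <= t1 -> t0 <= t <= T.
  by move=> /andP[-> tt1]; apply: le_trans tt1 t1T.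
pose w i t : R := c1 t i 0 - c2 t i 0.
pose dw i t : R := X (c1 t) i 0 - X (c2 t) i 0.
have Dw i t : t0 <= t <= t1 -> is_derive t 1 (w i) (dw i t).
  move=> tt; have [_ D1] := h1 t (tT t tt); have [_ D2] := h2 t (tT t tt).
  have coord (c : R -> V) v : is_derive t 1 c v -> is_derive t 1 (fun s => c s i 0) (v i 0).
    move=> [dc cv]; have dc' : differentiable c t by apply/derivable1_diffP.
    apply: DeriveDef; first by apply/diff_derivable/differentiable_coordinate.
    by rewrite -derive_coordinate // cv.
  exact: is_deriveB (coord _ _ D1) (coord _ _ D2).
pose h t : R := \sum_i w i t ^+ 2.
pose dh t : R := \sum_i 2 * w i t * dw i t.
have Dh t : t0 <= t <= t1 -> is_derive t 1 h (dh t).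
  move=> tt; have -> : h = \sum_i (fun t => w i t ^+ 2).
    by apply/funext => s; rewrite fct_sumE.
  apply: is_derive_sum => i; have Di := Dw i t tt.
  have -> : (fun t => w i t ^+ 2) = w i * w i by apply/funext => s; rewrite expr2.
  apply: is_derive_eq (is_deriveM Di Di) _.
  by rewrite /GRing.scale /=; ring.
have dh_le t : t0 <= t <= t1 -> dh t <= K * h t.
  move=> tt; have [b1 b2] := inball t tt.
  apply: (@le_trans _ _ (\sum_i \sum_l M * (w i t ^+ 2 + w l t ^+ 2))).
    apply: ler_sum => i _; apply: le_trans (ler_norm _) _.
    rewrite normrM; apply: (@le_trans _ _ (`|2 * w i t| * (M * \sum_l `|w l t|))).
      by apply: ler_wpM2l => //; apply: lip.
    rewrite mulrCA mulr_sumr mulr_sumr; apply: ler_sum => l _.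
    rewrite ler_wpM2l // normrM ger0_norm //.
    have := sqr_ge0 (`|w i t| - `|w l t|).
    rewrite -[w i t ^+ 2]real_normK ?num_real // -[w l t ^+ 2]real_normK ?num_real //.
    by nra.
  rewrite le_eqVlt; apply/orP; left; apply/eqP.
  under eq_bigr do rewrite -mulr_sumr big_split /= sumr_const card_ord.
  rewrite -mulr_sumr big_split /= sumr_const card_ord -/(h t).
  rewrite /K -mulr_natr; under eq_bigr do rewrite -mulr_natr.
  by rewrite -mulr_suml -/(h t); ring.
pose g t : R := h t * expR (- K * t).
have Dg t : t0 <= t <= t1 -> is_derive t 1 g ((dh t - K * h t) * expR (- K * t)).
  move=> tt; have De : is_derive t 1 (fun s => expR (- K * s)) (- K * expR (- K * t)).
    have Dl : is_derive t 1 (fun s : R => - K * s) (- K).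
      by apply: is_derive_eq (is_deriveZ (- K) (is_derive_id t 1)) _;
        rewrite /GRing.scale /= mulr1.
    apply: is_derive_eq (is_derive1_comp (is_derive_expR _) Dl) _.
    by rewrite mulrC.
  apply: is_derive_eq (is_deriveM (Dh t tt) De) _.
  by rewrite /GRing.scale /=; ring.
have g0 : g t0 = 0.
  by rewrite /g /h big1 ?mul0r // => i _; rewrite /w c12 subrr expr0n.
have gt1 : g t1 <= g t0.
  apply: (@ler0_derive1_le_cc _ g t0 t1) => //.
  - move=> t; rewrite in_itv /= => /andP[a b].
    have tt : t0 <= t <= t1 by rewrite !ltW.
    exact: (@ex_derive _ _ _ _ _ _ _ (Dg t tt)).
  - move=> t; rewrite in_itv /= => /andP[a b].
    have tt : t0 <= t <= t1 by rewrite !ltW.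
    rewrite derive1E (@derive_val _ _ _ _ _ _ _ (Dg t tt)).
    by rewrite pmulr_lle0 ?expR_gt0 // subr_le0 dh_le.
  - apply: derivable_within_continuous => t; rewrite in_itv /= => tt.
    exact: (@ex_derive _ _ _ _ _ _ _ (Dg t tt)).
  - by rewrite in_itv /= lexx t01.
  - by rewrite in_itv /= lexx t01.
have h0 : h t1 = 0.
  apply/eqP; rewrite eq_le sumr_ge0 ?andbT => [|i _]; last exact: sqr_ge0.
  by move: gt1; rewrite g0 /g pmulr_lle0 ?expR_gt0.
apply/matrixP => i j; rewrite ord1; apply/eqP; rewrite -subr_eq0 -sqrf_eq0.
rewrite eq_le sqr_ge0 andbT -h0 /h (bigD1 i) //= lerDl.
by apply: sumr_ge0 => l _; apply: sqr_ge0.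
Qed.

(** At the supremum [t0] of the times up to which the curves agree, they agree by continuity, and
    [ode_local] extends the agreement beyond [t0]. *)
Lemma ode_unique (U : set V) (X : V -> V) (c1 c2 : R -> V) (T : R) :
  open U -> (forall i, smooth_upto 1 U (fun y => X y i 0)) ->
  c1 0 = c2 0 ->
  (forall t, 0 <= t <= T -> U (c1 t) /\ is_derive t 1 c1 (X (c1 t))) ->
  (forall t, 0 <= t <= T -> U (c2 t) /\ is_derive t 1 c2 (X (c2 t))) ->
  forall t, 0 <= t <= T -> c1 t = c2 t.
Proof.
move=> Uo sX c12 h1 h2 t1 /andP[t10 t1T]; apply: contrapT => ne.
pose E : set R := [set t | 0 <= t <= T /\ forall s, 0 <= s <= t -> c1 s = c2 s].
have T0 : 0 <= T by apply: le_trans t10 t1T.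
have E0 : E 0.
  split=> [|s]; first by rewrite lexx.
  by rewrite -eq_le => /eqP <-.
have Eub t : E t -> t <= t1.
  move=> [_ Et]; rewrite leNgt; apply/negP => tt.
  by apply/ne/Et; rewrite t10 ltW.
have hE : has_sup E by split; [exists 0|exists t1 => t /Eub].
pose t0 := sup E.
have t0t1 : t0 <= t1 by apply: ge_sup; [exists 0|move=> t /Eub].
have t00 : 0 <= t0 by exact: (@ub_le_sup _ _ hE.2 0 E0).
have before s : 0 <= s < t0 -> c1 s = c2 s.
  move=> /andP[s0 st0]; have [t [_ Et] st] := sup_gt hE.1 st0.
  by apply: Et; rewrite s0 ltW.
have cont (c : R -> V) : (forall t, 0 <= t <= T -> U (c t) /\ is_derive t 1 c (X (c t))) ->
    {for t0, continuous c}.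
  move=> hc; have [|_ [dc _]] := hc t0; first by rewrite t00 (le_trans t0t1).
  by apply/differentiable_continuous/derivable1_diffP.
have at0 : c1 t0 = c2 t0.
  have [->//|t0n] := eqVneq t0 0.
  have t0p : 0 < t0 by rewrite lt_neqAle eq_sym t0n.
  apply: contrapT => /eqP; rewrite -subr_eq0 -normr_gt0 => d0.
  pose e := `|c1 t0 - c2 t0| / 2.
  have e0 : 0 < e by rewrite divr_gt0.
  have n1 : \forall t \near t0, `|c1 t0 - c1 t| < e.
    by move/cvgrPdist_lt : (cont _ h1) => /(_ e e0).
  have n2 : \forall t \near t0, `|c2 t0 - c2 t| < e.
    by move/cvgrPdist_lt : (cont _ h2) => /(_ e e0).
  have [r r0 rP] := (nbhs_normP _ _).1 (filterI n1 n2).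
  (* The minimum keeps [s] non-negative, and the half keeps it within [r] of [t0]. *)
  pose s := t0 - Num.min (r / 2) t0.
  have m0 : 0 < Num.min (r / 2) t0 by rewrite lt_min t0p andbT divr_gt0.
  have s0 : 0 <= s < t0.
    by rewrite subr_ge0 ge_min lexx orbT /= ltrBlDl ltrDr.
  have [|/= a b] := rP s.
    rewrite /= /s opprB addrC subrK gtr0_norm // gt_min ltr_pdivrMr //.
    by rewrite ltr_pMr // ltr1n.
  rewrite (before s s0) in a; have : `|c1 t0 - c2 t0| < e + e.
    have -> : c1 t0 - c2 t0 = (c1 t0 - c2 s) + (c2 s - c2 t0) by rewrite addrA subrK.
    by apply: le_lt_trans (ler_normD _ _) _; rewrite ltrD // distrC.
  by rewrite /e -splitr ltxx.
have Et0 : forall s, 0 <= s <= t0 -> c1 s = c2 s.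
  move=> s /andP[s0]; rewrite le_eqVlt => /orP[/eqP -> //|st].
  by apply: before; rewrite s0.
have t0T : t0 < T.
  rewrite lt_neqAle (le_trans t0t1 t1T) andbT; apply/eqP => t0T.
  by apply/ne/Et0; rewrite t10 t0T.
have sub t : t0 <= t <= T -> 0 <= t <= T.
  by move=> /andP[t0t ->]; rewrite (le_trans t00).
have [d d0 dP] := ode_local Uo sX t0T at0 (fun t tt => h1 t (sub t tt))
  (fun t tt => h2 t (sub t tt)).
pose t2 := Num.min (t0 + d) T.
have t02 : t0 < t2 by rewrite lt_min t0T ltrDl d0.
have : E t2.
  split; first by rewrite ge_min lexx orbT (le_trans t00) // ltW.
  move=> s /andP[s0 st2]; have [st|st] := leP s t0; first by apply: Et0; rewrite s0.
  move: st2; rewrite le_min => /andP[sd sT].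
  by apply: dP => //; rewrite ltW.
by move=> /(ub_le_sup hE.2); rewrite leNgt t02.
Qed.

(** Integral curves are given for times at least 0, so equality is known on the right only; the
    right-hand limit of the difference quotient of [f - g] already determines its derivative. *)
Lemma eq_right_derive (f g : R -> R) (a b d : R) : 0 < d ->
  (forall s, 0 <= s < d -> f s = g s) ->
  is_derive (0 : R) 1 f a -> is_derive (0 : R) 1 g b -> a = b.
Proof.
move=> d0 fg Df Dg; apply/eqP; rewrite -subr_eq0; apply/eqP.
pose h := f - g; have [dh hv] : is_derive (0 : R) 1 h (a - b) by apply: is_deriveB.
have q : t^-1 *: ((h \o shift 0) (t *: 1) - h 0) @[t --> (0 : R)^'] --> a - b.
  by rewrite -hv; apply: dh.
have nz : \forall t \near (0 : R)^'+, t^-1 *: ((h \o shift 0) (t *: 1) - h 0) = 0.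
  near=> t; have t0 : 0 < t by [].
  have td : t < d by near: t; apply: nbhs_right_lt.
  have h0 s : 0 <= s < d -> h s = 0 by move=> /fg fs; rewrite /h fctE fs subrr.
  rewrite /= addr0 [_ *: 1]mulr1 !h0 ?subrr ?scaler0 // ?lexx ?d0 //.
  by rewrite ltW.
have q' := cvg_dnbhs_at_right q.
have z : t^-1 *: ((h \o shift 0) (t *: 1) - h 0) @[t --> (0 : R)^'+] --> (0 : R).
  apply/cvgrPdist_lt => e e0; apply: filterS nz => t ->.
  by rewrite subrr normr0.
have hR : hausdorff_space R by exact: norm_hausdorff.
have := @cvg_unique R hR _ _ _ _ q' z; exact.
Unshelve. all: end_near.
Qed.

Lemma is_derive_shift_curve (c : R -> V) (s t : R) (v : V) :
  is_derive (s + t) 1 c v -> is_derive t 1 (fun t => c (s + t)) v.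
Proof.
move=> [dc cv]; have dc' : differentiable c (s + t) by apply/derivable1_diffP.
have ds : is_derive t 1 (fun t : R => s + t) 1.
  have dl : is_derive t 1 (cst s + id : R -> R) (0 + 1) by exact: is_deriveD.
  by rewrite add0r in dl.
have ds' : differentiable (fun t : R => s + t) t.
  by apply/derivable1_diffP; apply: (@ex_derive _ _ _ _ _ _ _ ds).
apply: DeriveDef; first exact/diff_derivable/(differentiable_comp ds' dc').
have := derive_comp (1 : R) ds' dc'; rewrite (@derive_val _ _ _ _ _ _ _ ds) cv; exact.
Qed.

Lemma is_derive_coordinate (c : R -> V) (t : R) (v : V) i :
  is_derive t 1 c v -> is_derive t 1 (fun s => c s i 0) (v i 0).
Proof.
move=> [dc cv]; have dc' : differentiable c t by apply/derivable1_diffP.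
apply: DeriveDef; first by apply/diff_derivable/differentiable_coordinate.
by rewrite -derive_coordinate // cv.
Qed.

(* The time-one map of a flow commutes with the flow, hence preserves the
   vector field. *)
Lemma exp_germ_invariant (X phi : V -> V) :
  smooth_germ phi -> phi 0 = 0 -> is_exp_germ X phi ->
  exists W W' : set V, [/\ open W, W 0, open W' & forall x, W x -> W' x] /\
   [/\ forall x, W x -> W' (phi x),
       forall i, smooth_fun W (fun y => phi y i 0),
       forall i, smooth_fun W' (fun y => X y i 0)
     & forall x, W x -> forall i,
         X (phi x) i 0 = \sum_j X x j 0 * partial j (fun y => phi y i 0) x].
Proof.
move=> [W0 [W0o W00] sphi] phi0 [U [[Uo U0] sX curves]].
pose Q x := exists c : R -> V, [/\ c 0 = x, c 1 = phi x
  & forall t : R, 0 <= t <= 1 -> U (c t) /\ is_derive t 1 c (X (c t))].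
have [N0 [N0o N00] N0Q] : exists2 B, open_nbhs (0 : V) B & B `<=` Q.
  by have : nbhs (0 : V) Q := curves; rewrite nbhsE.
have sphi' i : smooth_fun W0 (fun y => phi y i 0) by apply: smooth_onP.
have sX' i : smooth_fun U (fun y => X y i 0) by apply: smooth_onP.
have cphi x : W0 x -> {for x, continuous phi}.
  move=> W0x; apply/differentiable_continuous/differentiable_cV => i.
  exact: smooth_fun_diff (sphi' i) W0x.
pose O := N0 `&` U; have Oo : open O by apply: openI.
(* Both [x] and [phi x] must be starting points of integral curves up to time 1; [W] is open by
   continuity of [phi]. *)
pose W := [set x | [/\ W0 x, O x & O (phi x)]].
have Wopen : open W.
  rewrite openE => x [W0x Ox Opx].
  have nW0 : nbhs x W0 by apply: open_nbhs_nbhs.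
  have nO : nbhs x O by apply: open_nbhs_nbhs.
  have npO : nbhs x (phi @^-1` O) by apply: cphi => //; apply: open_nbhs_nbhs.
  by apply: filterS3 nW0 nO npO.
have sX1 i : smooth_upto 1 U (fun y => X y i 0) by apply: sX'.
exists W, U; split; first by split=> // [|x [_ [_ Ux] _] //]; split; rewrite ?phi0.
split=> [x [_ _ [_ Upx]] //|i m||x [W0x [N0x Ux] [N0px Upx]] i].
- by apply: smooth_upto_sub (sphi' i m) => x [].
- exact: sX'.
have [c [c0 c1 hc]] := N0Q x N0x; have [e [e0 e1 he]] := N0Q _ N0px.
have h01 : 0 <= (0 : R) <= 1 by rewrite lexx ler01.
have cc : {for 0, continuous c}.
  have [_ [dc _]] := hc 0 h01.
  by apply/differentiable_continuous/derivable1_diffP.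
have nN : \forall t \near (0 : R), N0 (c t).
  by apply: cc; rewrite c0; apply: open_nbhs_nbhs.
have [d d0 dP] := (nbhs_normP _ _).1 nN.
(* The integral curve [u] from [c s] follows [c] for a time [1 - s], up to [phi x], then [e] for a
   time [s]: its end point [phi (c s)] is [e s]. *)
have flow s : 0 <= s < Num.min d 1 -> phi (c s) = e s.
  move=> /andP[s0]; rewrite lt_min => /andP[sd s1].
  have N0cs : N0 (c s) by apply: dP; rewrite /= sub0r normrN ger0_norm.
  have [u [u0 u1 hu]] := N0Q _ N0cs.
  have E1 t : 0 <= t <= 1 - s -> u t = c (s + t).
    apply: (ode_unique Uo sX1 (c1 := u) (c2 := fun t => c (s + t))) => [|t'|t'].
    - by rewrite addr0.
    - by move=> /andP[t0 t1]; apply: hu; rewrite t0 (le_trans t1) // gerBl.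
    move=> /andP[t0 t1]; have [|Uc Dc] := hc (s + t').
      by rewrite addr_ge0 //= -lerBrDl.
    by split=> //; apply: is_derive_shift_curve.
  have E2 t : 0 <= t <= s -> u (1 - s + t) = e t.
    apply: (ode_unique Uo sX1 (c1 := fun t => u (1 - s + t)) (c2 := e)) => [|t'|t'].
    - by rewrite addr0 E1 ?e0 ?lexx ?subr_ge0 ?ltW // addrC subrK c1.
    - move=> /andP[t0 t1]; have [|Uc Dc] := hu (1 - s + t').
        by rewrite addr_ge0 ?subr_ge0 ?(ltW s1) //= addrAC lerBlDr lerD2l.
      by split=> //; apply: is_derive_shift_curve.
    by move=> /andP[t0 t1]; apply: he; rewrite t0 (le_trans t1) // ltW.
  by rewrite -E2 ?s0 ?lexx // subrK u1.
have dphi : differentiable (fun y => phi y i 0) (c 0).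
  by rewrite c0; apply: smooth_fun_diff (sphi' i) W0x.
have [_ Dc] := hc 0 h01; have [_ De] := he 0 h01.
(* At time 0, [phi o c] has velocity [Dphi . X] at [x], and [e] has velocity [X (phi x)]. *)
have D1 := is_derive_curve Dc dphi.
have D2 := is_derive_coordinate i De.
have d1 : 0 < Num.min d 1 by rewrite lt_min d0 ltr01.
have flow' s : 0 <= s < Num.min d 1 -> phi (c s) i 0 = e s i 0.
  by move=> /flow ->.
have := eq_right_derive d1 flow' D1 D2.
rewrite c0 e0 => <-; rewrite derive_partial //.
by rewrite -c0.
Qed.

End Flow.

(** * Complex coordinates diagonalizing a real Jordan form *)

Section RealCoordinates.
Variables (R : realType) (n : nat) (T : {set 'I_n}) (S : 'M[R[i]]_n).
Hypothesis Sjordan : real_jordan_form T S.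

Local Notation P := (real_coords R T).
Local Notation I := ('i%C : R[i]).

Variant index_kind (j : 'I_n) : Prop :=
  | FirstOfBlock q of block2 T j q
  | SecondOfBlock p of block2 T p j
  | Single of j \notin T & (forall p, ~~ block2 T p j).

Lemma index_kindP j : index_kind j.
Proof.
have [_ Tnext _ _] := Sjordan.
have [jT|jT] := boolP (j \in T).
  by have [q qj _] := Tnext j jT; apply: (@FirstOfBlock _ q); rewrite /block2 jT qj eqxx.
have [/existsP[p pj]|] := boolP [exists p, block2 T p j].
  exact: (@SecondOfBlock _ p).
by rewrite negb_exists => /forallP nb; apply: Single.
Qed.

Lemma block2P p q : block2 T p q ->
  [/\ p \in T, q \notin T, p != q, forall l, block2 T p l = (l == q)
    & forall l, block2 T l q = (l == p)].
Proof.
move=> /andP[pT /eqP qp]; have [_ Tnext _ _] := Sjordan.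
split=> //.
- have [q' q'p] := Tnext p pT; suff -> : q' = q by [].
  by apply: val_inj; rewrite /= q'p qp.
- by apply/eqP => pq; move: qp; rewrite pq => /eqP; rewrite -{1}[val q]addn0 -addn1 eqn_add2l.
- by move=> l; rewrite /block2 pT /= -qp; apply/eqP/eqP => [/val_inj|->].
move=> l; rewrite /block2 qp eqSS -[X in _ && X]/(val p == val l) val_eqE eq_sym.
by case: eqP => [->|_]; rewrite ?pT ?andbF.
Qed.

Lemma real_coords_first p q l : block2 T p q ->
  P p l = (l == p)%:R + (l == q)%:R.
Proof.
move=> /[dup] pq /block2P[pT qT npq pl lq]; rewrite mxE pT pl.
have [->|_] := eqVneq l p; first by rewrite (negbTE npq) addr0.
by rewrite add0r.
Qed.

Lemma real_coords_second p q l : block2 T p q ->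
  P q l = I * (l == q)%:R - I * (l == p)%:R.
Proof.
move=> /[dup] pq /block2P[pT qT npq pl lq]; rewrite mxE (negbTE qT) lq.
have -> : [exists p0, block2 T p0 q] by apply/existsP; exists p.
have [->|_] := eqVneq l q; first by rewrite eq_sym (negbTE npq) mulr1 mulr0 subr0.
by rewrite mulr0 sub0r; case: eqP => _; rewrite ?mulr1 ?mulr0 ?oppr0.
Qed.

Lemma real_coords_single j l : j \notin T -> (forall p, ~~ block2 T p j) ->
  P j l = (l == j)%:R.
Proof.
move=> jT nb; rewrite mxE (negbTE jT); case: ifP => // /existsP[p].
by rewrite (negbTE (nb p)).
Qed.

(** On a block, [w_p = (z_p + i z_q) / 2] and [w_q = (z_p - i z_q) / 2]. *)
Definition real_coords_inv : 'M[R[i]]_n := \matrix_(j, l)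
  if j \in T then ((l == j)%:R + I * (block2 T j l)%:R) / 2
  else if [exists p, block2 T p j] then ((block2 T l j)%:R - I * (l == j)%:R) / 2
  else (l == j)%:R.

Local Notation Q := real_coords_inv.

Lemma sum_pick2 (F G : 'I_n -> R[i]) (x y : R[i]) p q :
  (forall l, F l = x * (l == p)%:R + y * (l == q)%:R) ->
  \sum_l F l * G l = x * G p + y * G q.
Proof.
have pick r : \sum_l (l == r)%:R * G l = G r.
  rewrite (bigD1 r) //= eqxx mul1r big1 ?addr0 // => l /negbTE ->.
  by rewrite mul0r.
move=> FE; under eq_bigr do rewrite FE mulrDl -!mulrA.
by rewrite big_split /= -!mulr_sumr !pick.
Qed.

Lemma sum_pick1 (F G : 'I_n -> R[i]) (x : R[i]) p :
  (forall l, F l = x * (l == p)%:R) -> \sum_l F l * G l = x * G p.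
Proof.
move=> FE; rewrite (@sum_pick2 F G x 0 p p) ?mul0r ?addr0 // => l.
by rewrite FE mul0r addr0.
Qed.

Lemma real_coordsK : P *m Q = 1%:M.
Proof.
have two : (2 : R[i]) != 0 by rewrite pnatr_eq0.
have II : I * I = -1 by rewrite -expr2 sqr_i.
have Qfirst p q l : block2 T p q -> Q p l = ((l == p)%:R + I * (l == q)%:R) / 2.
  by move=> /block2P[pT _ _ pl _]; rewrite mxE pT pl.
have Qsecond p q l : block2 T p q -> Q q l = ((l == p)%:R - I * (l == q)%:R) / 2.
  move=> /[dup] pq /block2P[_ qT _ _ lq]; rewrite mxE (negbTE qT) lq.
  by have -> : [exists p0, block2 T p0 q] by apply/existsP; exists p.
apply/matrixP => j l; rewrite [LHS]mxE [RHS]mxE eq_sym.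
case: (index_kindP j) => [q jq|p pj|jT nb].
- rewrite (@sum_pick2 _ _ 1 1 j q) => [|m].
    by rewrite (Qfirst _ _ _ jq) (Qsecond _ _ _ jq); field.
  by rewrite (real_coords_first _ jq) !mul1r.
- rewrite (@sum_pick2 _ _ I (- I) j p) => [|m].
    rewrite (Qfirst _ _ _ pj) (Qsecond _ _ _ pj).
    transitivity (- (I * I) * (l == j)%:R); first by field.
    by rewrite II opprK mul1r.
  by rewrite (real_coords_second _ pj) mulNr.
rewrite (@sum_pick1 _ _ 1 j) => [|m].
  rewrite mul1r mxE (negbTE jT); case: ifP => // /existsP[p].
  by rewrite (negbTE (nb p)).
by rewrite (real_coords_single _ jT nb) mul1r.
Qed.

Lemma real_coords_unit : P \in unitmx.
Proof. by have [] := mulmx1_unit real_coordsK. Qed.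

Lemma real_coords_diag : is_diag_mx (invmx P *m S *m P).
Proof.
have [_ _ Sblock Ssupp] := Sjordan.
have II : I * I = -1 by rewrite -expr2 sqr_i.
(* Each sum selects at most the partner of [j] in its block: a block with entries [lambda], [mu]
   gets [lambda + i mu] at its first index and [lambda - i mu] at its second. *)
pose gamma j := S j j + I * \sum_l (block2 T j l)%:R * S l j
                - I * \sum_l (block2 T l j)%:R * S j l.
have no_first j q : block2 T j q -> \sum_l (block2 T l j)%:R * S j l = 0.
  move=> /block2P[jT _ _ _ _]; rewrite big1 // => l _.
  case: (boolP (block2 T l j)) => [/block2P[_ jT' _ _ _]|_]; last by rewrite mul0r.
  by rewrite jT in jT'.
have no_second j : j \notin T -> \sum_l (block2 T j l)%:R * S l j = 0.
  by move=> jT; rewrite big1 // => l _; rewrite /block2 (negbTE jT) mul0r.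
have gfirst p q : block2 T p q -> gamma p = S p p + I * S q p.
  move=> pq; rewrite /gamma (no_first _ _ pq) mulr0 subr0.
  rewrite (@sum_pick1 _ _ 1 q) ?mul1r // => l.
  by have [_ _ _ -> _] := block2P pq; rewrite mul1r.
have gsecond p q : block2 T p q -> gamma q = S q q - I * S q p.
  move=> pq; have [_ qT _ _ lq] := block2P pq.
  rewrite /gamma (no_second _ qT) mulr0 addr0 (@sum_pick1 _ _ 1 p) ?mul1r // => l.
  by rewrite lq mul1r.
have gsingle j : j \notin T -> (forall p, ~~ block2 T p j) -> gamma j = S j j.
  move=> jT nb; rewrite /gamma (no_second _ jT) mulr0 addr0 big1 ?mulr0 ?subr0 // => l _.
  by rewrite (negbTE (nb l)) mul0r.
have Srow j l : S j l = S j j * (l == j)%:R +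
    (if (l != j) then S j l else 0).
  by have [->|] := eqVneq l j; rewrite ?mulr1 ?mulr0 ?addr0 ?add0r.
have Sout j l : l != j -> ~~ block2 T j l -> ~~ block2 T l j -> S j l = 0.
  move=> lj b1 b2; apply/eqP; apply: contraT => /Ssupp.
  by rewrite eq_sym (negbTE lj) (negbTE b1) (negbTE b2).
have SP : S *m P = P *m diag_mx (\row_j gamma j).
  apply/matrixP => j l; rewrite mul_mx_diag [LHS]mxE [RHS]mxE [X in _ = _ * X]mxE.
  case: (index_kindP j) => [q jq|p pj|jT nb].
  - have [jT qT njq jl lq] := block2P jq; have [Sqq Sjq] := Sblock _ _ jq.
    rewrite (@sum_pick2 _ _ (S j j) (S j q) j q) => [|m]; last first.
      have [->|mj] := eqVneq m j; first by rewrite (negbTE njq) mulr1 mulr0 addr0.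
      have [->|mq] := eqVneq m q; first by rewrite mulr1 mulr0 add0r.
      rewrite !mulr0 addr0; apply: Sout => //; first by rewrite jl.
      by apply/negP => /block2P[_]; rewrite jT.
    rewrite (real_coords_first _ jq) (real_coords_second _ jq).
    have [->|lj] := eqVneq l j.
      by rewrite (negbTE njq) (gfirst _ _ jq) Sjq /= mulr0n mulr1n; ring.
    have [->|lq'] := eqVneq l q; last by rewrite /= !mulr0n; ring.
    by rewrite (gsecond _ _ jq) Sjq Sqq /= mulr0n mulr1n; ring.
  - have [pT jT npj pl lj] := block2P pj; have [Sjj Spj] := Sblock _ _ pj.
    rewrite (@sum_pick2 _ _ (S j j) (S j p) j p) => [|m]; last first.
      have [->|mj] := eqVneq m j; first by rewrite eq_sym (negbTE npj) mulr1 mulr0 addr0.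
      have [->|mp] := eqVneq m p; first by rewrite mulr1 mulr0 add0r.
      rewrite !mulr0 addr0; apply: Sout => //; last by rewrite lj.
      by rewrite /block2 (negbTE jT).
    rewrite (real_coords_first _ pj) (real_coords_second _ pj).
    have [->|lj'] := eqVneq l j.
      rewrite eq_sym (negbTE npj) (gsecond _ _ pj) /= mulr0n mulr1n.
      transitivity (I * S j j - (I * I) * S j p); last by ring.
      by rewrite II; ring.
    have [->|lp] := eqVneq l p; last by rewrite /= !mulr0n; ring.
    rewrite (gfirst _ _ pj) Sjj /= mulr0n mulr1n.
    transitivity (- I * S p p - (I * I) * S j p); last by ring.
    by rewrite II; ring.
  rewrite (@sum_pick1 _ _ (S j j) j) => [|m]; last first.
    have [->|mj] := eqVneq m j; first by rewrite mulr1.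
    by rewrite mulr0; apply: Sout => //; rewrite /block2 (negbTE jT).
  rewrite (real_coords_single _ jT nb).
  have [->|lj] := eqVneq l j; last by rewrite mulr0 mul0r.
  by rewrite mulr1 mul1r gsingle.
rewrite -mulmxA SP mulmxA mulVmx ?real_coords_unit // mul1mx.
exact: diag_mx_is_diag.
Qed.

End RealCoordinates.

Local Opaque mcomp deriv_along.

(** * Comparison of both sides of the invariance in diagonalizing coordinates *)

Section DiagonalCore.
Variables (R : realType) (n k : nat) (gamma : 'I_n -> R[i]).
Variables (A B S N : 'M[R[i]]_n).
Hypotheses (expBA : cvgC_expmx B A) (BSN : B = S + N).
Hypothesis Sdiag : forall i j, S i j = gamma i *+ (i == j).
Hypotheses (SN : S *m N = N *m S) (Nnil : exists m, N ^+ m = 0).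
Hypothesis Aunit : A \in unitmx.
Hypothesis Nweak : forall Y : 'I_n -> {mpoly R[i][n]},
  (forall i, vanishes_below 1 (Y i)) ->
  (forall i a, (Y i)@_a != 0 -> weak_monomial gamma i a) ->
  forall i, deriv_along (linform N) (Y i) = mxact N Y i.

Variables p q : 'I_n -> {mpoly R[i][n]}.
Hypotheses (p0 : forall i, vanishes_below 1 (p i))
  (q0 : forall i, vanishes_below 1 (q i)).
Hypothesis qB : forall i, vanishes_below 2 (q i - linform B i).
Hypothesis invar :
  forall i, vanishes_below k.+1 (mcomp p (q i) - deriv_along q (p i)).

Let Bw : preserves_weight gamma B.
Proof.
by apply: (commuting_preserves_weight Sdiag); rewrite BSN mulmxDr mulmxDl SN.
Qed.

Let Aw : preserves_weight gamma A.
Proof.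
apply: (commuting_preserves_weight Sdiag); apply/esym/(expmx_comm expBA).
by rewrite BSN mulmxDr mulmxDl SN.
Qed.

Lemma weak_weight l i a : l != 0 -> cexp (- l) = 1 ->
  weight gamma a = gamma i - l -> weak_monomial gamma i a.
Proof.
move=> l0 /cexp_eq1[m lE] aw; exists (- m).
  by rewrite oppr_eq0; apply: contra_neq l0 => m0; rewrite -[l]opprK lE m0 mulr0 oppr0.
by rewrite -[\sum_k _]/(weight gamma a) aw opprB addrC subrK -[l]opprK lE rmorphN mulrN.
Qed.

(** A strongly resonant map equal to [p] below degree [k]: the linear part in case (a), the jet of
    order [k - 1] in case (b). *)
Variable p' : 'I_n -> {mpoly R[i][n]}.
Hypotheses (p'0 : forall i, vanishes_below 1 (p' i))
  (p'A : forall i, vanishes_below 2 (p' i - linform A i))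
  (p'w : forall i, of_weight gamma (gamma i) (p' i))
  (pp' : forall i, vanishes_below k (p i - p' i)).

Local Notation Y d l := (fun i => bihomog gamma d (gamma i - l) (q i)).

Lemma field_strongly_resonant :
  (forall i b, (2 <= mdeg b < k)%N -> ~ weak_monomial gamma i b) ->
  forall d l i b, (d < k)%N -> l != 0 -> mdeg b = d ->
    weight gamma b = gamma i - l -> (q i)@_b = 0.
Proof.
move=> noweak; elim/ltn_ind=> d IHd l i b dk l0 bd bw.
have [d0|d0] := posnP d; first by rewrite q0 // bd d0.
(* [noweak] starts in degree 2, so degree 1 is treated apart: [B] commutes with [S], hence has only
   strongly resonant monomials. *)
have [d1|d1] := eqVneq d 1%N.
  have bB : (q i)@_b = (linform B i)@_b.
    have := @qB i b; rewrite bd d1 => /(_ isT)/eqP.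
    by rewrite mcoeffB subr_eq0 => /eqP.
  rewrite bB; apply: contra_neq_eq l0 => qb.
  have : weight gamma b = gamma i.
    by apply: (of_weight_linform (M := B)) qb => j; apply: Bw.
  by rewrite bw -{2}[gamma i]subr0 => /addrI/oppr_inj.
have d2 : (1 < d)%N by case: d d0 d1 {IHd dk bd} => [|[|]].
have [l1|l1] := eqVneq (cexp (- l)) 1.
  by case: (noweak i b); [rewrite bd d2|apply: weak_weight l1 bw].
have : Y d l i = 0.
  apply: (invariant_nonresonant expBA BSN Sdiag SN Nnil Aunit (Y := Y d l) l1)
    => [j|j].
    exact: of_weight_bihomog.
  apply/mpolyP => a.
  have Aout : (mdeg a != d) || (weight gamma a != gamma j - l) ->
      (mxact A (Y d l) j)@_a = 0.
    move=> aout; rewrite /mxact raddf_sum /= big1 // => m _.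
    rewrite mcoeffZ mcoeff_bihomog; have [->|/Aw jm] := eqVneq (A j m) 0.
      by rewrite mul0r.
    by rewrite -jm; case: ifP aout => [/andP[-> ->]|]; rewrite ?mulr0.
  have [ad|ad] := eqVneq (mdeg a) d; last first.
    rewrite Aout ?ad // mcompE raddf_sum /= big1 // => m _.
    rewrite mcoeffZ mcoeff_bihomog; case: ifP => [/andP[/eqP md _]|_].
      by rewrite (dhomog_nemf_coeff (dhomog_mcompX A m)) ?mulr0 //= md.
    by rewrite mul0r.
  have [aw|aw] := eqVneq (weight gamma a) (gamma j - l); last first.
    rewrite Aout ?aw ?orbT //; apply: contra_neq_eq aw.
    apply: of_weight_mcomp => [s|]; last exact: of_weight_bihomog.
    by apply: of_weight_linform => t; apply: Aw.
  (* By the induction hypothesis the field has no part of weight [l] below degree [d], so its part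
     of degree [d] meets only the linear part of [p']. *)
  have low : p' =1 linform A \/ (forall b, weight gamma b = gamma j - l ->
      (mdeg b < d)%N -> (q j)@_b = 0).
    by right=> b' b'w b'd; apply: (IHd _ b'd l _ _ (ltn_trans b'd dk)) b'w.
  have low' : p' =1 linform A \/ (forall j b, weight gamma b = gamma j - l ->
      (mdeg b < d)%N -> (q j)@_b = 0).
    by right=> j' b' b'w b'd; apply: (IHd _ b'd l _ _ (ltn_trans b'd dk)) b'w.
  rewrite -(mcoeff_mcomp_lowest p'0 p'A p'w ad aw low).
  rewrite -(mcoeff_deriv_along_lowest Aw p'A p'w ad aw low').
  (* [p] and [p'] differ only from degree [k] on, which is not seen in degree [d < k]. *)
  have e1 : (mcomp p (q j))@_a = (mcomp p' (q j))@_a.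
    apply/eqP; rewrite -subr_eq0 -mcoeffB; apply/eqP.
    have pp2 i' : vanishes_below k.-1.+1 (p i' - p' i').
      by rewrite prednK ?(leq_ltn_trans _ dk).
    apply: (vanishes_below_mcompB p0 p'0 pp2 (@q0 j)).
    by rewrite addn1 prednK ?(leq_ltn_trans _ dk) // ad.
  have e2 : (deriv_along q (p j))@_a = (deriv_along q (p' j))@_a.
    apply/eqP; rewrite -subr_eq0 -mcoeffB -linearB; apply/eqP.
    by apply: (vanishes_below_deriv_along q0 (@pp' j)); rewrite ad.
  rewrite -e1 -e2; apply/eqP; rewrite -subr_eq0 -mcoeffB; apply/eqP.
  by apply: invar; rewrite ad ltnS ltnW.
by move/mpolyP/(_ b); rewrite mcoeff_bihomog bd bw !eqxx mcoeff0.
Qed.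

Lemma no_weak_coefficient :
  (2 <= k)%N ->
  p' =1 linform A \/
    (forall i b, (2 <= mdeg b < k)%N -> ~ weak_monomial gamma i b) ->
  forall i a, mdeg a = k -> weak_monomial gamma i a -> (p i)@_a = 0.
Proof.
move=> k2 cond i a ak [m m0 am].
pose l : R[i] := (2 * pi)%:C%C * 'i%C * m%:~R.
have l0 : l != 0.
  rewrite /l two_pi_i_int eq_complex /= eqxx /= mulf_neq0 ?intr_eq0 //.
  by rewrite mulf_neq0 ?pnatr_eq0 // gt_eqF ?pi_gt0.
have l1 : cexp (- l) = 1.
  by rewrite /l -mulrN -rmorphN cexp_two_pi_i.
have aw : weight gamma a = gamma i - l.
  by rewrite /l -am opprB addrC subrK.
have low : p' =1 linform A \/ (forall j b, weight gamma b = gamma j - l ->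
    (mdeg b < k)%N -> (q j)@_b = 0).
  case: cond => [|cond]; [by left|right=> j b bw bk].
  exact: (field_strongly_resonant cond bk l0 (erefl _) bw).
pose h j := p j - p' j.
(* The part of weight [l] of [f_k]. Subtracting [p'] does not change it, as [p'] has only strongly
   resonant monomials and [l <> 0]. *)
pose H j := bihomog gamma k (gamma j - l) (h j).
have weakH (F : 'I_n -> {mpoly R[i][n]}) j :
    deriv_along (linform N) (bihomog gamma k (gamma j - l) (F j)) =
    mxact N (fun j => bihomog gamma k (gamma j - l) (F j)) j.
  apply: (Nweak (Y := fun j => bihomog gamma k (gamma j - l) (F j))) => [s|s b].
    exact: vanishes_belowW (ltnW k2) (@vanishes_below_bihomog _ _ _ _ _ _).
  by move/of_weight_bihomog; apply: weak_weight.
have hk j : vanishes_below k (h j) by apply: pp'.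
have kk : k.-2.+2 = k by case: (k) k2 => [|[|]].
have split0 (x y z : R[i]) : x - y - z = 0 -> x = y + z.
  by move/eqP; rewrite subr_eq0 subr_eq addrC => /eqP.
(* In degree [k], replacing [p'] by [p] in the composition adds only the linear part of the field
   applied to [h]. *)
have E1 : (mcomp p (q i))@_a = (mcomp p' (q i))@_a + (mxact B H i)@_a.
  have pp2 j : vanishes_below k.-2.+2 (p j - p' j) by rewrite kk; apply: pp'.
  have := mcomp_linearize (@q0 i) p0 p'0 pp2 (a := a).
  rewrite ak kk ltnSn => /(_ isT).
  rewrite 2!mcoeffB => /split0 E; apply: etrans E _.
  apply: (congr1 (+%R (mcomp p' (q i))@_a)).
  rewrite !raddf_sum /=; apply: eq_bigr => j _; rewrite !mcoeffZ mcoeff_bihomog.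
  have -> : (q i)@_U_(j) = B i j.
    have := @qB i U_(j)%MM; rewrite mdeg1 => /(_ isT)/eqP.
    by rewrite mcoeffB subr_eq0 mcoeff_linform => /eqP.
  have [->|/Bw ij] := eqVneq (B i j) 0; first by rewrite !mul0r.
  by rewrite ak aw ij !eqxx mcoeffB.
(* Since [h] has order [k], only the linear part of the field acts on it in degree [k]. *)
have E2 : (deriv_along q (p i))@_a =
    (deriv_along q (p' i))@_a + (deriv_along (linform B) (H i))@_a.
  have -> : deriv_along q (p i) = deriv_along q (p' i) + deriv_along q (h i).
    by rewrite /h linearB addrC subrK.
  rewrite mcoeffD; apply: (congr1 (+%R (deriv_along q (p' i))@_a)).
  transitivity (deriv_along (linform B) (h i))@_a.
    apply/eqP; rewrite -subr_eq0 -mcoeffB deriv_alongBl; apply/eqP.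
    apply: (vanishes_below_deriv_alongM qB (@hk i)).
    by rewrite ak -{1}kk -[in X in (_ < X)%N]kk.
  apply/eqP; rewrite -subr_eq0 -mcoeffB -linearB; apply/eqP.
  rewrite (mcoeff_deriv_along (k := k) _ (@vanishes_below_linform _ _ B)) ?ak //.
  apply: big1 => b _; rewrite mcoeffB mcoeff_bihomog.
  case: ifP => [_|nb]; first by rewrite subrr mul0r.
  have [bk|bk] := ltnP (mdeg b) k; first by rewrite hk // subr0 mul0r.
  have [->|nz] := eqVneq (deriv_along (linform B) 'X_[b])@_a 0; first by rewrite mulr0.
  case/negP: nb; rewrite eqn_leq bk andbT -ltnS bmdeg /=.
  have Xb : of_weight gamma (weight gamma b) 'X_[R[i], b].
    by move=> c; rewrite mcoeffX; case: (val b =P c) => [->|]; rewrite ?eqxx.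
  by rewrite -aw -(of_weight_deriv_linform Bw Xb nz).
have := @invar i a; rewrite ak ltnSn => /(_ isT).
rewrite mcoeffB E1 E2.
have lowi : p' =1 linform A \/ (forall b, weight gamma b = gamma i - l ->
    (mdeg b < k)%N -> (q i)@_b = 0).
  by case: low => [|low]; [left|right=> b; apply: low].
rewrite (mcoeff_mcomp_lowest p'0 p'A p'w ak aw lowi).
rewrite (mcoeff_deriv_along_lowest Aw p'A p'w ak aw low).
have YA : mcomp (linform A) (Y k l i) = mxact A (Y k l) i.
  rewrite (mcomp_expmx_eigen expBA BSN Sdiag (l := l) (Y := Y k l)).
  - by rewrite l1 scale1r.
  - by move=> j; apply: of_weight_bihomog.
  - by move=> j; apply: weakH.
have HB : deriv_along (linform B) (H i) = mxact (B + (- l)%:M) H i.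
  by apply: (lie_eigen BSN Sdiag); [apply: of_weight_bihomog|apply: weakH].
have HBa : (deriv_along (linform B) (H i))@_a = (mxact B H i)@_a - l * (H i)@_a.
  by rewrite HB mxactD mxact_scalar mcoeffD mcoeffZ mulNr.
(* As [e^(-l) = 1], the field contributes the same [A Y] to both sides; [B H] cancels as well, and
   [l H] remains. *)
have cancel3 (x y z : R[i]) : x + y - (x + (y - z)) = 0 -> z = 0 by move=> <-; ring.
rewrite YA HBa => /cancel3.
move/eqP; rewrite mulf_eq0 (negbTE l0) /= mcoeff_bihomog ak aw !eqxx /= => /eqP.
rewrite /h mcoeffB => /eqP; rewrite subr_eq0 => /eqP ->.
apply: contra_neq_eq l0 => /p'w; rewrite aw -{2}[gamma i]subr0.
by move=> /addrI/oppr_inj.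
Qed.

End DiagonalCore.

Local Opaque mcomp deriv_along mtrunc.

(** * Linear changes of coordinates *)

Definition to_coords (K : comUnitRingType) (n : nat) (P : 'M[K]_n)
    (f : 'I_n -> {mpoly K[n]}) : 'I_n -> {mpoly K[n]} :=
  mxact (invmx P) (fun l => mcomp (linform P) (f l)).

Section ToCoords.
Variables (K : comUnitRingType) (n : nat) (P : 'M[K]_n).
Hypothesis Punit : P \in unitmx.
Local Notation Q := (invmx P).
Implicit Types (f g : 'I_n -> {mpoly K[n]}).

Lemma in_coordsE (F : fvect K n) f i a :
  (forall l b, mdeg b = mdeg a -> F l b = (f l)@_b) ->
  in_coords P F i a = (to_coords P f i)@_a.
Proof.
move=> Ff; rewrite /in_coords /to_coords /mxact raddf_sum /=.
apply: eq_bigr => l _; rewrite mcoeffZ (lin_substE _ (f := f l)) // => b.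
exact: Ff.
Qed.

Lemma eq_to_coords f g : f =1 g -> to_coords P f =1 to_coords P g.
Proof. by move=> fg i; apply: eq_mxact => l; rewrite fg. Qed.

Lemma vanishes_below_mxact d (M : 'M[K]_n) f i :
  (forall l, vanishes_below d (f l)) -> vanishes_below d (mxact M f i).
Proof. by move=> f0; apply: vanishes_below_sum => l _; apply: vanishes_belowZ. Qed.

Lemma vanishes_below_to_coords d f i :
  (forall l, vanishes_below d (f l)) -> vanishes_below d (to_coords P f i).
Proof.
move=> f0; apply: vanishes_below_mxact => l.
by apply: vanishes_below_mcomp => // j; apply: vanishes_below_linform.
Qed.

Lemma to_coordsB f g i :
  to_coords P f i - to_coords P g i = to_coords P (fun l => f l - g l) i.
Proof.
rewrite /to_coords /mxact -sumrB; apply: eq_bigr => l _.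
by rewrite rmorphB scalerBr.
Qed.

Lemma to_coords_linform (M : 'M[K]_n) i :
  to_coords P (linform M) i = linform (Q *m M *m P) i.
Proof.
rewrite -mulmxA linform_mul; apply: eq_bigr => l _.
by rewrite mcomp_linform linform_mul.
Qed.

Lemma to_coordsK f i :
  to_coords P (mxact P (fun l => mcomp (linform Q) (f l))) i = f i.
Proof.
rewrite /to_coords.
rewrite (@eq_mxact _ _ _ _ (mxact P f)) ?mxactM ?mulVmx ?mxact1 // => l.
rewrite mcomp_mxact; apply: eq_mxact => j.
by apply: mcomp_linformV; rewrite mulVmx.
Qed.

Lemma mxact_to_coords f i : mxact P (to_coords P f) i = mcomp (linform P) (f i).
Proof. by rewrite mxactM mulmxV // mxact1. Qed.

Lemma mcomp_to_coords f g i :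
  mcomp (to_coords P f) (to_coords P g i) =
  to_coords P (fun l => mcomp f (g l)) i.
Proof.
rewrite [LHS]mcomp_mxact; apply: eq_mxact => l; rewrite !mcompA.
by apply: eq_mcomp => j; rewrite mcomp_linform; apply: mxact_to_coords.
Qed.

Lemma deriv_along_to_coords f g i :
  deriv_along (to_coords P f) (to_coords P g i) =
  to_coords P (fun l => deriv_along f (g l)) i.
Proof.
rewrite [LHS]deriv_along_mxact; apply: eq_mxact => l.
by apply: deriv_along_mcomp_linform; rewrite mulVmx.
Qed.

Lemma to_coords_mxact (M : 'M[K]_n) f i :
  to_coords P (mxact M f) i = mxact (Q *m M *m P) (to_coords P f) i.
Proof.
rewrite -mulmxA -mxactM; apply: eq_mxact => l.
rewrite mcomp_mxact -mxactM; apply: eq_mxact => j.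
by rewrite mxact_to_coords.
Qed.

End ToCoords.

Lemma expmx_conj (R : realType) (n : nat) (P B A : 'M[R[i]]_n) :
  P \in unitmx -> cvgC_expmx B A ->
  cvgC_expmx (invmx P *m B *m P) (invmx P *m A *m P).
Proof.
move=> Punit BA i j.
have BX m : (invmx P *m B *m P) ^+ m = invmx P *m B ^+ m *m P.
  have mulE (M M' : 'M[R[i]]_n) : M * M' = M *m M' by [].
  elim: m => [|m IHm]; first by rewrite !expr0 mulmx1 mulVmx.
  by rewrite [in RHS]exprS exprS IHm !mulE !mulmxA mulmxK.
have mxE3 (M : 'M[R[i]]_n) : (invmx P *m M *m P) i j =
    \sum_s \sum_t invmx P i t * M t s * P s j.
  by rewrite mxE; apply: eq_bigr => s _; rewrite mxE mulr_suml.
have : cvgC (fun N => \sum_s \sum_t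
     invmx P i t * series (fun m => (B ^+ m) t s / m`!%:R) N * P s j)
  (\sum_s \sum_t invmx P i t * A t s * P s j).
  apply: cvgC_sum => s _; apply: cvgC_sum => t _.
  by apply: cvgCM (cvgC_cst _); apply: cvgCZ.
rewrite mxE3; apply: eq_cvgC => N; rewrite /series /=.
under [RHS]eq_bigr do rewrite BX mxE3 mulr_suml.
rewrite [RHS]exchange_big /=; apply: eq_bigr => s _.
under [RHS]eq_bigr do rewrite mulr_suml.
rewrite [RHS]exchange_big /=; apply: eq_bigr => t _.
rewrite mulr_sumr mulr_suml; apply: eq_bigr => m _; ring.
Qed.

Lemma linear_fvectE (K : comNzRingType) (n : nat) (M : 'M[K]_n) i a :
  linear_fvect M i a = (linform M i)@_a.
Proof.
rewrite /linear_fvect raddf_sum /=; apply: eq_bigr => j _.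
by rewrite mcoeffZ mcoeffX /fps_var eq_sym.
Qed.

Lemma mtrunc_linear_part (K : comNzRingType) (n k : nat) (F : fvect K n) i :
  (1 <= k)%N -> in_maxideal F ->
  vanishes_below 2 (mtrunc k (F i) - linform (linear_part F) i).
Proof.
move=> k1 F0 a; rewrite ltnS => a1.
rewrite mcoeffB mcoeff_mtrunc ?(leq_trans a1) //.
move: a1; rewrite leq_eqVlt => /orP[/mdeg1P[j /eqP ->]|].
  by rewrite mcoeff_linform mxE subrr.
rewrite ltnS leqn0 mdeg_eq0 => /eqP ->.
by rewrite F0 mcoeff_linform_nlin ?mdeg0 // subrr.
Qed.

Lemma mcoeff_mtrunc_homog_part (K : nzRingType) (n k : nat) (F : fvect K n) l b :
  mdeg b = k -> homog_part k F l b = (mtrunc k (F l))@_b.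
Proof. by move=> bk; rewrite /homog_part bk eqxx mcoeff_mtrunc ?bk. Qed.

Lemma mcoeff_mtrunc_jet (K : nzRingType) (n k : nat) (F : fvect K n) l b :
  (mdeg b <= k.-1)%N -> jet k.-1 F l b = (mtrunc k (F l))@_b.
Proof.
by move=> bk; rewrite /jet bk mcoeff_mtrunc // (leq_trans bk) // leq_pred.
Qed.

Lemma in_coords_homog_part_eq0 (K : comUnitRingType) (n k : nat) (P : 'M[K]_n)
    (F : fvect K n) i a : mdeg a != k -> in_coords P (homog_part k F) i a = 0.
Proof.
move=> ak; rewrite (@in_coordsE _ _ P _ (fun=> 0)) => [|l b ba].
  rewrite /to_coords /mxact big1 ?mcoeff0 // => l _.
  by rewrite rmorph0 scaler0.
by rewrite /homog_part ba (negbTE ak) mcoeff0.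
Qed.

(** Transports the hypothesis on [N], stated for power series in the coordinates [z], to polynomial
    fields in the coordinates [w]. The bracket vanishes when the derivative of [Y] along [N z]
    equals [N Y]. *)
Lemma commutes_with_weak_coords (R : realType) (n : nat) (P S N : 'M[R[i]]_n)
    (Y : 'I_n -> {mpoly R[i][n]}) :
  P \in unitmx -> commutes_with_weak P S N ->
  (forall i, vanishes_below 1 (Y i)) ->
  (forall i a, (Y i)@_a != 0 -> weak_monomial (eigen_coefs P S) i a) ->
  forall i, deriv_along (linform (invmx P *m N *m P)) (Y i) =
            mxact (invmx P *m N *m P) Y i.
Proof.
move=> Punit Ncomm Y0 Yweak i.
pose y := mxact P (fun l => mcomp (linform (invmx P)) (Y l)).
have yE : to_coords P y =1 Y by apply: to_coordsK.
have y0 l : vanishes_below 1 (y l).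
  apply: vanishes_below_mxact => j; apply: vanishes_below_mcomp => // s.
  exact: vanishes_below_linform.
pose Yz : fvect R[i] n := fun l a => (y l)@_a.
have Yz0 : in_maxideal Yz by move=> l; apply: y0; rewrite mdeg0.
have N0 : in_maxideal (linear_fvect N).
  by move=> l; rewrite linear_fvectE mcoeff_linform_nlin // mdeg0.
have NY l : deriv_along (linform N) (y l) = mxact N y l.
  rewrite -[mxact N y l]deriv_along_linform; apply/mpolyP => a.
  have Yzweak : weakly_resonant P S Yz.
    by move=> j b; rewrite (@in_coordsE _ _ P _ y) // yE; apply: Yweak.
  have E1 : vf_act (linear_fvect N) (Yz l) a = (deriv_along (linform N) (y l))@_a.
    by apply: (vf_actE (k := mdeg a) N0) => // j b _; apply: linear_fvectE.
  have E2 : vf_act Yz (linear_fvect N l) a = (deriv_along y (linform N l))@_a.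
    by apply: (vf_actE (k := mdeg a) Yz0) => // b _; apply: linear_fvectE.
  apply: etrans (esym E1) _; apply: etrans _ E2.
  by apply/eqP; rewrite -subr_eq0; apply/eqP; apply: Ncomm.
transitivity (to_coords P (fun l => deriv_along (linform N) (y l)) i).
  have <- := deriv_along_to_coords Punit (linform N) y i; rewrite yE.
  by apply: eq_bigr => j _; rewrite to_coords_linform.
rewrite (eq_to_coords _ NY) to_coords_mxact //; exact: eq_mxact.
Qed.

(** The part common to the three cases, which then only have to supply the invariance up to degree
    [k]. *)
Theorem formal_obstruction (R : realType) (n k : nat) (A B S N P : 'M[R[i]]_n)
    (phi X : fvect R[i] n) :
  A \in unitmx -> is_expmx B A -> is_jordan_decomp B S N -> (2 <= k)%N ->
  P \in unitmx -> is_diag_mx (invmx P *m S *m P) -> commutes_with_weak P S N ->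
  in_maxideal phi -> linear_part phi = A ->
  in_maxideal X -> linear_part X = B ->
  condition_a k P S phi \/ condition_b k P S phi ->
  ~ (forall i a, (mdeg a <= k)%N ->
       (mcomp (fun j => mtrunc k (phi j)) (mtrunc k (X i)))@_a =
       (deriv_along (fun j => mtrunc k (X j)) (mtrunc k (phi i)))@_a).
Proof.
move=> Aunit BA [BSN _ [m Nm] SN] k2 Punit Sdiag Ncomm phi0 phiA X0 XB cond inv.
pose Q := invmx P; pose gamma := eigen_coefs P S.
pose tp l := mtrunc k (phi l); pose tq l := mtrunc k (X l).
pose p := to_coords P tp; pose q := to_coords P tq.
have k1 : (1 <= k)%N by apply: ltnW.
have BA' : cvgC_expmx (Q *m B *m P) (Q *m A *m P).
  by apply: expmx_conj => // i j; apply: cvgCP.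
have conjM (M M' : 'M[R[i]]_n) : Q *m M *m P *m (Q *m M' *m P) = Q *m (M *m M') *m P.
  by rewrite !mulmxA mulmxK.
have BSN' : Q *m B *m P = Q *m S *m P + Q *m N *m P.
  by rewrite BSN mulmxDr mulmxDl.
have Sdiag' i j : (Q *m S *m P) i j = gamma i *+ (i == j).
  have [<-|ij] := eqVneq i j; first by rewrite mulr1n.
  by rewrite mulr0n; apply: (is_diag_mxP Sdiag).
have SN' : Q *m S *m P *m (Q *m N *m P) = Q *m N *m P *m (Q *m S *m P).
  by rewrite !conjM SN.
have Nm' : exists m, (Q *m N *m P) ^+ m = 0.
  exists m; have -> : (Q *m N *m P) ^+ m = Q *m N ^+ m *m P.
    elim: (m) => [|l IHl]; first by rewrite !expr0 mulmx1 mulVmx.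
    by rewrite !exprS IHl; apply: conjM.
  by rewrite Nm mulmx0 mul0mx.
have Aunit' : Q *m A *m P \in unitmx by rewrite !unitmx_mul unitmx_inv Punit Aunit.
have Nweak Y := commutes_with_weak_coords (Y := Y) Punit Ncomm.
have tp0 l : vanishes_below 1 (tp l) by apply/mtrunc_const/phi0.
have tq0 l : vanishes_below 1 (tq l) by apply/mtrunc_const/X0.
have p0 i : vanishes_below 1 (p i) by apply: vanishes_below_to_coords.
have q0 i : vanishes_below 1 (q i) by apply: vanishes_below_to_coords.
have pA i : vanishes_below 2 (p i - linform (Q *m A *m P) i).
  rewrite -to_coords_linform to_coordsB; apply: vanishes_below_to_coords => l.
  by rewrite -phiA; apply: mtrunc_linear_part.
have qB i : vanishes_below 2 (q i - linform (Q *m B *m P) i).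
  rewrite -to_coords_linform to_coordsB; apply: vanishes_below_to_coords => l.
  by rewrite -XB; apply: mtrunc_linear_part.
have inv' i : vanishes_below k.+1 (mcomp p (q i) - deriv_along q (p i)).
  have -> : mcomp p (q i) = to_coords P (fun l => mcomp tp (tq l)) i.
    exact: mcomp_to_coords.
  have -> : deriv_along q (p i) = to_coords P (fun l => deriv_along tq (tp l)) i.
    exact: deriv_along_to_coords.
  rewrite to_coordsB; apply: vanishes_below_to_coords => l a ak.
  by rewrite mcoeffB; apply/eqP; rewrite subr_eq0; apply/eqP; apply: inv.
have Aw : preserves_weight gamma (Q *m A *m P).
  apply: (commuting_preserves_weight Sdiag'); apply/esym/(expmx_comm BA').
  by rewrite BSN' mulmxDr mulmxDl SN'.
(* Conditions (a) and (b) differ only in the strongly resonant map [p'] with which [p] is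
   compared. *)
have concl p' : (forall i, vanishes_below 1 (p' i)) ->
   (forall i, vanishes_below 2 (p' i - linform (Q *m A *m P) i)) ->
   (forall i, of_weight gamma (gamma i) (p' i)) ->
   (forall i, vanishes_below k (p i - p' i)) ->
   p' =1 linform (Q *m A *m P) \/
    (forall i b, (2 <= mdeg b < k)%N -> ~ weak_monomial gamma i b) ->
  ~ has_weak_monomial P S (homog_part k phi).
  move=> p'0 p'A p'w pp' low [j [a [nz weak]]].
  have [ak|ak] := eqVneq (mdeg a) k; last first.
    by case/eqP: nz; exact: in_coords_homog_part_eq0.
  case/eqP: nz; rewrite (@in_coordsE _ _ P _ tp) => [|l b ba].
    exact: (no_weak_coefficient BA' BSN' Sdiag' SN' Nm' Aunit' Nweak p0 q0 qB
      inv' p'0 p'A p'w pp' k2 low).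
  exact: mcoeff_mtrunc_homog_part (etrans ba ak).
case: cond => [[low weak]|[strong noweak weak]]; move: weak.
  apply: (concl (linform (Q *m A *m P))) => [i|i|i|i|]; last by left.
  - exact: vanishes_below_linform.
  - by rewrite subrr; apply: vanishes_below0.
  - by apply: of_weight_linform => j; apply: Aw.
  rewrite -to_coords_linform to_coordsB; apply: vanishes_below_to_coords => l a ak.
  have [a2|a2] := ltnP (mdeg a) 2; first by rewrite -phiA mtrunc_linear_part.
  have ak' := ltnW ak; have a1 : mdeg a != 1%N by rewrite gtn_eqF.
  have low0 : phi l a = 0.
    have ad : (2 <= mdeg a <= k.-1)%N by rewrite a2 -ltnS prednK.
    by have := low (mdeg a) ad l a; rewrite /homog_part eqxx.
  rewrite mcoeffB (mcoeff_linform_nlin _ _ a1) subr0.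
  exact: etrans (mcoeff_mtrunc _ ak') low0.
(* Linear changes of coordinates preserve degrees, so this is also the jet of [phi] expressed in the
   coordinates [w], and [strong] gives its weights. *)
pose p' i := mtrunc k.-1 (fun a => (p i)@_a).
have pp' i : vanishes_below k (p i - p' i).
  move=> a ak; rewrite mcoeffB; apply/eqP; rewrite subr_eq0 eq_sym; apply/eqP.
  by apply: mcoeff_mtrunc; rewrite -ltnS prednK.
have p'E i : p' i = p i - (p i - p' i) by rewrite opprB addrC subrK.
apply: (concl p') => [i|i|i a nz|i|].
- rewrite p'E; apply: vanishes_belowB; first exact: p0.
  exact: vanishes_belowW k1 (pp' i).
- rewrite p'E addrAC; apply: vanishes_belowB; first exact: pA.
  exact: vanishes_belowW k2 (pp' i).
- have [ak|ak] := leqP (mdeg a) k.-1; last first.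
    by case/eqP: nz; exact: mcoeff_mtrunc_gt.
  apply/esym; apply: (strong i a); rewrite (@in_coordsE _ _ P _ tp) => [|l b ba].
    by move: nz; rewrite mcoeff_mtrunc.
  by apply: mcoeff_mtrunc_jet; rewrite ba.
- exact: pp'.
right=> i b /andP[b2 bk]; apply: noweak.
by rewrite b2 -ltnS prednK.
Qed.

(** Serves both real classes, as analytic germs are smooth. *)
Lemma smooth_obstruction (R : realType) (n k : nat) (A B S N : 'M[R[i]]_n)
    (T : {set 'I_n}) (phi X : 'cV[R]_n -> 'cV[R]_n) :
  A \in unitmx -> is_expmx B A -> is_jordan_decomp B S N -> (2 <= k)%N ->
  real_jordan_form T S -> commutes_with_weak (real_coords R T) S N ->
  smooth_germ phi -> phi 0 = 0 -> linear_part (ctaylor phi) = A ->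
  X 0 = 0 -> linear_part (ctaylor X) = B ->
  condition_a k (real_coords R T) S (ctaylor phi) \/
    condition_b k (real_coords R T) S (ctaylor phi) ->
  ~ is_exp_germ X phi.
Proof.
move=> Aunit BA BSN k2 Sjordan Ncomm sphi phi0 phiA X0 XB cond expX.
have maxideal (F : 'cV[R]_n -> 'cV[R]_n) : F 0 = 0 -> in_maxideal (ctaylor F).
  move=> F0 i; rewrite /ctaylor -[taylor _ _ _]/(taylor_coef _ _).
  by rewrite taylor_coef0 F0 mxE.
have [W [W' [[Wo W0 W'o WW'] [WphiW' sphi' sX' inv]]]] :=
  exp_germ_invariant sphi phi0 expX.
apply: (formal_obstruction Aunit BA BSN k2 (real_coords_unit Sjordan)
  (real_coords_diag Sjordan) Ncomm (maxideal _ phi0) phiA (maxideal _ X0) XB cond).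
exact: (taylor_invariant Wo W0 W'o WW' WphiW' phi0 X0 sphi' sX' inv).
Qed.

Theorem theorem1p5 (R : realType) (n k : nat) (A X1 X1s X1N : 'M[R[i]]_n)
    (hn : (1 <= n)%N) (hA : A \in unitmx) (hX1 : is_expmx X1 A)
    (hJ : is_jordan_decomp X1 X1s X1N) (hk : (2 <= k)%N) :
  [/\ (forall T : {set 'I_n},
         X1 \is a mxOver Num.real ->
         real_jordan_form T X1s ->
         commutes_with_weak (real_coords R T) X1s X1N ->
         forall phi : 'cV[R]_n -> 'cV[R]_n,
           local_diff (@smooth_germ R n) phi ->
           linear_part (ctaylor phi) = A ->
           condition_a k (real_coords R T) X1s (ctaylor phi) \/
           condition_b k (real_coords R T) X1s (ctaylor phi) ->
           ~ exists X : 'cV[R]_n -> 'cV[R]_n,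
               [/\ local_vf (@smooth_germ R n) X,
                   linear_part (ctaylor X) = X1
                 & is_exp_germ X phi]),
      (forall T : {set 'I_n},
         X1 \is a mxOver Num.real ->
         real_jordan_form T X1s ->
         commutes_with_weak (real_coords R T) X1s X1N ->
         forall phi : 'cV[R]_n -> 'cV[R]_n,
           local_diff (@analytic_germ R n) phi ->
           linear_part (ctaylor phi) = A ->
           condition_a k (real_coords R T) X1s (ctaylor phi) \/
           condition_b k (real_coords R T) X1s (ctaylor phi) ->
           ~ exists X : 'cV[R]_n -> 'cV[R]_n,
               [/\ local_vf (@analytic_germ R n) X,
                   linear_part (ctaylor X) = X1
                 & is_exp_germ X phi])
    & (is_diag_mx X1s ->
         commutes_with_weak 1%:M X1s X1N ->
         forall phi : fvect R[i] n,
           formal_diff phi ->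
           linear_part phi = A ->
           condition_a k 1%:M X1s phi \/ condition_b k 1%:M X1s phi ->
           ~ exists X : fvect R[i] n,
               [/\ formal_vf X, linear_part X = X1 & is_formal_exp X phi])].
Proof.
split=> [T Xreal jord comm phi|T Xreal jord comm phi|].
- move=> [sphi phi0 _] phiA cond [X [[_ X0] XB expX]].
  exact: (smooth_obstruction hA hX1 hJ hk jord comm sphi phi0 phiA X0 XB cond).
- move=> [[sphi _] phi0 _] phiA cond [X [[_ X0] XB expX]].
  exact: (smooth_obstruction hA hX1 hJ hk jord comm sphi phi0 phiA X0 XB cond).
move=> Sdiag comm phi [phi0 _] phiA cond [X [X0 XB expX]].
have Sdiag' : is_diag_mx (invmx 1%:M *m X1s *m 1%:M) by rewrite invmx1 mul1mx mulmx1.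
apply: (formal_obstruction hA hX1 hJ hk (unitmx1 _ _) Sdiag' comm phi0 phiA X0 XB cond).
by move=> i a ak; apply: formal_exp_invariant.
Qed.
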